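(* Let $\mathcal{R}$ be an integral domain containing $\mathbb{Z}_p$ as a subalgebra, $\mathcal{T}$ a free $\mathcal{R}$-module of finite rank, and $\rho:W_K\to \mathrm{Aut}_{\mathcal{R}}(\mathcal{T})$ a monodromic representation with monodromy $N\in \mathrm{End}_{\mathcal{R}[1/p]}(\mathcal{T}\otimes_{\mathcal R}\mathcal{R}[1/p])$. Put $\mathcal{V}=\mathcal{T}\otimes_{\mathcal{R}}\overline{Q}(\mathcal{R})$ and let $$\mathrm{WD}(\mathcal{V})^{\mathrm{Fr\text{-}ss}}\simeq \bigoplus_{i=1}^m \mathrm{Sp}_{t_i}(\chi_i\otimes\rho_i)_{/\overline{Q}(\mathcal{R})}$$ be an isomorphism of Weil-Deligne representations, where $m$ and $t_1\le t_2\le\cdots\le t_m$ are positive integers, $\chi_1,\dots,\chi_m$ are $(\mathcal{R}^{\mathrm{intal}})^\times$-valued unramified characters of $W_K$ and $\rho_1,\dots,\rho_m$ are irreducible Frobenius-semisimple representations of $W_K$ over $\mathcal{R}^{\mathrm{intal}}[1/p]$ with finite image. For a field $E$ and a ring homomorphism $f:\mathcal{R}\to E$, write $V_f=\mathcal{T}\otimes_{\mathcal{R},f}E$. Let $\lambda:\mathcal{R}\to\overline{\mathbb{Q}}_p$ be a $\mathbb{Z}_p$-algebra homomorphism such that $V_\lambda$ is pure. Then the following hold. 1. For every $j\ge 1$, the rank of $N^j$ does not decrease after specializing at $\lambda$. 2. The Weil-Deligne representations $\mathrm{WD}(V_\lambda)^{\mathrm{Fr\text{-}ss}}$ and $\bigoplus_{i=1}^m\mathrm{Sp}_{t_i}(\lambda^{\mathrm{intal}}\circ(\chi_i\otimes\rho_i))_{/\overline{\mathbb{Q}}_p}$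 are isomorphic. 3. The polynomial $\mathrm{Eul}(\mathcal{V},X)^{-1}$ has coefficients in $\mathcal{R}^{\mathrm{int}}$, and applying $\lambda$ (extended to $\mathcal{R}^{\mathrm{int}}\subset\mathcal{R}^{\mathrm{intal}}$ by $\lambda^{\mathrm{intal}}$) to its coefficients gives $\mathrm{Eul}(V_\lambda,X)^{-1}$. 4. If $\xi:\mathcal{R}\to\overline{\mathbb{Q}}_p$ is a $\mathbb{Z}_p$-algebra homomorphism such that $V_\xi$ is pure, then the automorphic types of $\mathrm{rec}(\iota_p(\mathrm{WD}(V_\xi)^{\mathrm{Fr\text{-}ss}}))$ and $\mathrm{rec}(\iota_p(\mathrm{WD}(V_\lambda)^{\mathrm{Fr\text{-}ss}}))$ are the same. Moreover, for any field extension $\mathcal{K}$ of $\mathbb{Q}_p$ and any $\mathbb{Z}_p$-algebra homomorphism $\mu:\mathcal{R}\to\mathcal{K}$ with $\lambda(\ker\mu)=0$, the Weil-Deligne representation $\mathrm{WD}(V_\mu\otimes_{\mathcal{K}}\overline{\mathcal{K}})^{\mathrm{Fr\text{-}ss}}$ is isomorphic to $\bigoplus_{i=1}^m\mathrm{Sp}_{t_i}(\mu^{\mathrm{intal}}\circ(\chi_i\otimes\rho_i))_{/\overline{\mathcal{K}}}$.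
   Context: Local field. Let $p\neq\ell$ be primes, $K$ a finite extension of $\mathbb{Q}_\ell$ with absolute Galois group $G_K$, inertia group $I_K$, Weil group $W_K$ and residue field of cardinality $q$. Fix a lift $\phi\in G_K$ of the geometric Frobenius; $v_K:W_K\to\mathbb{Z}$ is the homomorphism trivial on $I_K$ with $v_K(\phi)=1$. Denote by $|\mathrm{Art}_K^{-1}|_K$ the unramified character $\sigma\mapsto q^{-v_K(\sigma)}$ of $W_K$. Fix a compatible system $\zeta$ of primitive roots of unity of order prime to $\ell$, and let $t_{\zeta,p}:I_K\to\mathbb{Z}_p$ be the resulting tame surjection; it satisfies $t_{\zeta,p}(\sigma\tau\sigma^{-1})=\varepsilon_p(\sigma)t_{\zeta,p}(\tau)$ with $\varepsilon_p$ the $p$-adic cyclotomic character. A ''representation'' of a group on a module is just a group homomorphism (no continuity assumed). Rings. For a domain $A$: $Q(A)$ is its fraction field, $\overline{Q}(A)$ an algebraic closure of $Q(A)$, and $A^{\mathrm{int}}$ (resp. $A^{\mathrm{intal}}$) is the integral closure of $A$ in $Q(A)$ (resp. $\overline{Q}(A)$). A ring homomorphism $f:A\to B$ of domains extends to $A^{\mathrm{intal}}\to B^{\mathrm{intal}}$; one such extension is fixed and denoted $f^{\mathrm{intal}}$, and the same symbol denotes its unique extension $A^{\mathrm{intal}}[1/p]\to B^{\mathrm{intal}}[1/p]$ when $p\ne0$ in $B$. Weil-Deligne representations. A Weil-Deligne representation of $W_K$ on a free module $M$ of finite rank over a characteristic zero domain $A$ is $(r,M,N)$ with $r:W_K\to\mathrm{Aut}_A(M)$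 a representation with $r(I_K)$ finite and $N\in\mathrm{End}_A(M)$ nilpotent (the monodromy) with $r(\sigma)Nr(\sigma)^{-1}=q^{-v_K(\sigma)}N$ for all $\sigma\in W_K$ (after inverting $\ell$). A representation of $W_K$ on a free $A$-module $M$ of finite rank is irreducible Frobenius-semisimple if $M\otimes\overline{Q}(A)$ is irreducible, $\phi$ acts semisimply on it, and $I_K$ acts through a finite quotient. Over a field containing all characteristic roots of the elements of $r(W_K)$, writing $r(\phi)=r(\phi)^{ss}u$ (commuting semisimple and unipotent parts), the Frobenius-semisimplification $(r,N)^{\mathrm{Fr\text{-}ss}}$ is $(\tilde r,N)$ with $\tilde r(\sigma)=r(\sigma)u^{-v_K(\sigma)}$. For $r:W_K\to\mathrm{Aut}_A(M)$ with $r(I_K)$ finite, $\ell\in A^\times$ and $t\ge1$, $\mathrm{Sp}_t(r)_{/A}$ is the Weil-Deligne representation on $M^t$ where $W_K$ acts by $r|\mathrm{Art}_K^{-1}|_K^{t-1}\oplus\cdots\oplus r|\mathrm{Art}_K^{-1}|_K\oplus r$ and $N$ maps the summand $r|\mathrm{Art}_K^{-1}|_K^{i}$ isomorphically to $r|\mathrm{Art}_K^{-1}|_K^{i+1}$ for $0\le i\le t-2$ and is zero on $r|\mathrm{Art}_K^{-1}|_K^{t-1}$. Monodromic. If $A$ is a $\mathbb{Z}_p$-algebra of characteristic zero, a representation $\rho:W_K\to\mathrm{Aut}_A(M)$ is monodromic with monodromy $N$ if there are a finite extension $K'/K$ and a nilpotent $N\in\mathrm{End}_{A[1/p]}(M\otimes_AA[1/p])$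 with $\rho(\tau)=\exp(t_{\zeta,p}(\tau)N)$ for all $\tau\in I_{K'}$. Its Weil-Deligne parametrization is $\mathrm{WD}(M)=(r,N)$ with $r(\sigma)=\rho(\sigma)\exp(-t_{\zeta,p}(\phi^{-v_K(\sigma)}\sigma)N)$. Assertion 1 means that the rank of $\lambda(N)^j$ (over $\overline{\mathbb{Q}}_p$, $\lambda$ extended to $\mathcal{R}[1/p]$) is not smaller than the rank of $N^j$ (over $Q(\mathcal{R})$). Purity. A $q$-Weil number of weight $w$ is an algebraic number $\alpha$ with $|\iota(\alpha)|=q^{w/2}$ for every embedding $\iota:\mathbb{Q}(\alpha)\to\mathbb{C}$ and $q^n\alpha$ an algebraic integer for some $n$. A Frobenius-semisimple Weil-Deligne representation over $\overline{\mathbb{Q}}_p$ is pure of weight $w\in\mathbb{Z}$ if the eigenvalues of a lift of the geometric Frobenius on $\mathrm{Gr}_iM_\bullet$ are $q$-Weil numbers of weight $w+i$ for all $i$, where $M_\bullet$ is the monodromy filtration. A finite-dimensional representation $V$ of $W_K$ over $\overline{\mathbb{Q}}_p$ is pure (of weight $w$) if it is monodromic and $\mathrm{WD}(V)^{\mathrm{Fr\text{-}ss}}$ is pure (of weight $w$). Euler factors. For a Weil-Deligne representation $(r,V,N)$ over an algebraically closed field of characteristic zero, $\mathrm{Eul}((r,N),X)=\det(1-X\phi\mid V^{I_K,N=0})^{-1}$, where $V^{I_K,N=0}$ is the subspace fixed by $I_K$ and killed by $N$. For monodromic $V$, $\mathrm{Eul}(V,X)=\mathrm{Eul}(\mathrm{WD}(V),X)$.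 Automorphic types. Fix an isomorphism $\iota_p:\overline{\mathbb{Q}}_p\simeq\mathbb{C}$, and let $\mathrm{rec}$ be the (unitarily normalized) local Langlands bijection from $n$-dimensional Frobenius-semisimple complex Weil-Deligne representations of $W_K$ to irreducible admissible representations of $\mathrm{GL}_n(K)$. If $D\simeq\bigoplus_{i=1}^I\mathrm{Sp}_{m_i}(s_i)$ with $s_i$ irreducible Frobenius-semisimple, the automorphic type of $\mathrm{rec}(D)$ is the unordered tuple $((\dim s_1,m_1),\dots,(\dim s_I,m_I))$. *)

(* Defs.v *)
From HB Require Import structures.
From mathcomp Require Import all_boot all_order all_algebra all_fingroup all_field.
From mathcomp Require Import boolp classical_sets reals complex.

Set Implicit Arguments.
Unset Strict Implicit.
Unset Printing Implicit Defensive.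

Import Order.TTheory GRing.Theory Num.Theory.
Local Open Scope ring_scope.

(* [x n] is the representative in [0, p ^ n[ of the class of [x] modulo [p ^ n]. *)
Definition padic_coherent (p : nat) (x : nat -> int) : Prop :=
  forall n, x n = (x n.+1 %% (p ^ n)%N)%Z.

(* The primality proof is a parameter of the type so that the integral domain
   structure can be inferred. *)
Record padic_int (p : nat) (pP : prime p) := PadicInt {
  padic_val :> nat -> int;
  padic_valP : padic_coherent p padic_val }.

HB.instance Definition _ (p : nat) (pP : prime p) := gen_eqMixin (padic_int pP).
HB.instance Definition _ (p : nat) (pP : prime p) :=
  gen_choiceMixin (padic_int pP).

Section PadicIntegers.
Variables (p : nat) (pP : prime p).
Local Notation padic_int := (padic_int pP).

Lemma padic_ext (x y : padic_int) : (forall n, x n = y n) -> x = y.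
Proof.
case: x y => [x xP] [y yP] /= /funext exy; case: _ / exy in yP *.
by congr PadicInt; apply: Prop_irrelevance.
Qed.

Lemma padic_mod (x : padic_int) n : (x n %% (p ^ n)%N)%Z = x n.
Proof. by rewrite padic_valP modz_mod. Qed.

Let modz_expn (a : int) n k :
  ((a %% (p ^ (n + k))%N)%Z = a %[mod (p ^ n)%N])%Z.
Proof.
rewrite [in RHS](divz_eq a (p ^ (n + k))%N) expnD mulnC PoszM mulrA.
by rewrite modzMDl.
Qed.

Lemma padic_of_subproof (f : nat -> int) :
  (forall n, f n.+1 = f n %[mod (p ^ n)%N])%Z ->
  padic_coherent p (fun n => (f n %% (p ^ n)%N)%Z).
Proof.
by move=> fP n /=; rewrite -addn1 modz_expn addn1 fP.
Qed.

Definition padic_of f (fP : (forall n, f n.+1 = f n %[mod (p ^ n)%N])%Z) :=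
  PadicInt pP (padic_of_subproof fP).

Let step (x : padic_int) n : (x n.+1 = x n %[mod (p ^ n)%N])%Z.
Proof. by rewrite -padic_valP padic_mod. Qed.

Fact padic_addP (x y : padic_int) n :
  (x n.+1 + y n.+1 = x n + y n %[mod (p ^ n)%N])%Z.
Proof. by rewrite -modzDm !step modzDm. Qed.
Fact padic_oppP (x : padic_int) n : (- x n.+1 = - x n %[mod (p ^ n)%N])%Z.
Proof. by rewrite -modzNm step modzNm. Qed.
Fact padic_mulP (x y : padic_int) n :
  (x n.+1 * y n.+1 = x n * y n %[mod (p ^ n)%N])%Z.
Proof. by rewrite -modzMm !step modzMm. Qed.

Definition padic_cst (k : int) := padic_of (fun n => erefl (k %% (p ^ n)%N)%Z).
Definition padic_add x y := padic_of (padic_addP x y).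
Definition padic_opp x := padic_of (padic_oppP x).
Definition padic_mul x y := padic_of (padic_mulP x y).

Fact padic_addA : associative padic_add.
Proof. by move=> x y z; apply: padic_ext => n /=; rewrite modzDmr modzDml addrA. Qed.
Fact padic_addC : commutative padic_add.
Proof. by move=> x y; apply: padic_ext => n /=; rewrite addrC. Qed.
Fact padic_add0 : left_id (padic_cst 0) padic_add.
Proof. by move=> x; apply: padic_ext => n /=; rewrite mod0z add0r padic_mod. Qed.
Fact padic_addN : left_inverse (padic_cst 0) padic_opp padic_add.
Proof. by move=> x; apply: padic_ext => n /=; rewrite modzDml addNr. Qed.

HB.instance Definition _ := GRing.isZmodule.Build padic_int
  padic_addA padic_addC padic_add0 padic_addN.

Fact padic_mulA : associative padic_mul.
Proof. by move=> x y z; apply: padic_ext => n /=; rewrite modzMmr modzMml mulrA. Qed.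
Fact padic_mulC : commutative padic_mul.
Proof. by move=> x y; apply: padic_ext => n /=; rewrite mulrC. Qed.
Fact padic_mul1 : left_id (padic_cst 1) padic_mul.
Proof. by move=> x; apply: padic_ext => n /=; rewrite modzMml mul1r padic_mod. Qed.
Fact padic_mulD : left_distributive padic_mul padic_add.
Proof. by move=> x y z; apply: padic_ext => n /=; rewrite modzMml modzDm mulrDl. Qed.
Fact padic_1neq0 : padic_cst 1 != 0.
Proof.
apply/eqP => /(congr1 (fun x : padic_int => x 1%N)) /=.
by rewrite expn1 modz_small ?mod0z // ltz_nat prime_gt1.
Qed.

HB.instance Definition _ := GRing.Zmodule_isComNzRing.Build padic_int
  padic_mulA padic_mulC padic_mul1 padic_mulD padic_1neq0.

Definition padic_unit : {pred padic_int} := fun x => `[< exists y, y * x = 1 >].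
Definition padic_inv (x : padic_int) : padic_int :=
  if pselect (exists y, y * x = 1) is left h then projT1 (cid h) else x.

Fact padic_mulV : {in padic_unit, left_inverse 1 padic_inv *%R}.
Proof.
move=> x /asboolP xu; rewrite /padic_inv; case: pselect => // h.
by case: cid.
Qed.
Fact padic_unitP (x y : padic_int) : y * x = 1 -> padic_unit x.
Proof. by move=> yx1; apply/asboolP; exists y. Qed.
Fact padic_inv_out : {in [predC padic_unit], padic_inv =1 id}.
Proof.
move=> x /negP xnu; rewrite /padic_inv; case: pselect => // h.
by case: xnu; apply/asboolP.
Qed.

HB.instance Definition _ := GRing.ComNzRing_hasMulInverse.Build padic_int
  padic_mulV padic_unitP padic_inv_out.

Lemma padic_mod_le (x : padic_int) n k : (x n = x (n + k)%N %% (p ^ n)%N)%Z.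
Proof.
elim: k => [|k IHk]; first by rewrite addn0 padic_mod.
by rewrite IHk addnS (padic_valP x (n + k)) modz_expn.
Qed.

Fact padic_idomain (x y : padic_int) : x * y = 0 -> (x == 0) || (y == 0).
Proof.
move=> xy0; have [// | /eqP x0] := eqVneq x 0; have [// | /eqP y0] := eqVneq y 0.
have nz (z : padic_int) : z <> 0 -> exists n, z n != 0.
  move=> z0; apply: contrapT => h; apply: z0; apply: padic_ext => n /=.
  by rewrite mod0z; apply/eqP/negPn/negP => zn; apply: h; exists n.
have [[n xn] [k yk]] := (nz x x0, nz y y0).
have := congr1 (fun x : padic_int => x (n + k)%N) xy0.
rewrite /= mod0z => /dvdz_mod0P.
have nd (z : padic_int) i j : z i != 0 -> ~~ (p ^ i %| `|z (i + j)|)%N.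
  apply: contraNN => d; rewrite (padic_mod_le z i j); apply/eqP/dvdz_mod0P.
  by rewrite dvdzE.
move: (nd x n k xn) (nd y k n yk); rewrite [(k + n)%N]addnC.
rewrite dvdzE abszM /=; move: (absz _) (absz _) => a b /= nb na dab.
have [a0|a0] := posnP a; first by rewrite a0 dvdn0 in na.
have [b0|b0] := posnP b; first by rewrite b0 dvdn0 in nb.
move: dab na nb; rewrite !pfactor_dvdn ?muln_gt0 ?a0 ?b0 // lognM // -!ltnNge.
by move=> + na nb; rewrite leqNgt -addSn leq_add // ltnW.
Qed.

HB.instance Definition _ :=
  GRing.ComUnitRing_isIntegral.Build padic_int padic_idomain.

Definition padic := {fraction padic_int}.
HB.instance Definition _ := GRing.Field.on padic.

End PadicIntegers.

Record alg_closure (F : fieldType) := AlgClosure {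
  acl_field :> closedFieldType;
  acl_emb : {rmorphism F -> acl_field};
  acl_alg : integralRange acl_emb }.

Section IntegralClosure.
Variables (A : comNzRingType) (F : fieldType) (f : {rmorphism A -> F}).

Definition intcl_pred : pred F := fun x => `[< integralOver f x >].

Record intcl := Intcl { intcl_val :> F; _ : intcl_pred intcl_val }.

HB.instance Definition _ := [isSub for intcl_val].
HB.instance Definition _ := [Choice of intcl by <:].

Fact intcl_subring : subring_closed intcl_pred.
Proof.
split; first by apply/asboolP; exact: integral1.
  by move=> x y /asboolP ix /asboolP iy; apply/asboolP; exact: integral_sub.
by move=> x y /asboolP ix /asboolP iy; apply/asboolP; exact: integral_mul.
Qed.

HB.instance Definition _ :=
  GRing.SubChoice_isSubComNzRing.Build F intcl_pred intcl intcl_subring.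

Definition intcl_of (a : A) : intcl := Intcl (asboolT (integral_id f a)).

End IntegralClosure.

Section Localization.
Variables (p : nat) (A : comNzRingType) (F : fieldType) (f : {rmorphism A -> F}).

(* The subring f(A)[1/p] of F; it is used when f is injective and p <> 0 in F. *)
Definition locp_pred : pred F :=
  fun x => `[< exists k (a : A), p%:R ^+ k * x = f a >].

Record locp := Locp { locp_val :> F; _ : locp_pred locp_val }.

HB.instance Definition _ := [isSub for locp_val].
HB.instance Definition _ := [Choice of locp by <:].

Fact locp_subring : subring_closed locp_pred.
Proof.
split; first by apply/asboolP; exists 0%N, 1; rewrite mul1r rmorph1.
  move=> x y /asboolP[k [a ka]] /asboolP[l [b lb]]; apply/asboolP.
  exists (k + l)%N, (p%:R ^+ l * a - p%:R ^+ k * b).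
  rewrite rmorphB !rmorphM !rmorphXn !rmorph_nat -ka -lb exprD mulrBr.
  by rewrite !mulrA [p%:R ^+ l * _]mulrC.
move=> x y /asboolP[k [a ka]] /asboolP[l [b lb]]; apply/asboolP.
by exists (k + l)%N, (a * b); rewrite rmorphM -ka -lb exprD mulrACA.
Qed.

HB.instance Definition _ :=
  GRing.SubChoice_isSubComNzRing.Build F locp_pred locp locp_subring.

Fact locp_of_subproof (a : A) : locp_pred (f a).
Proof. by apply/asboolP; exists 0%N, a; rewrite mul1r. Qed.
Definition locp_of (a : A) : locp := Locp (locp_of_subproof a).

End Localization.

Section GaloisGroup.
Variables (K : fieldType) (Kbar : alg_closure K).

Definition galois_axiom (s : Kbar -> Kbar) : Prop :=
  [/\ zmod_morphism s, monoid_morphism s, bijective s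
    & forall x, s (acl_emb Kbar x) = acl_emb Kbar x].

Record galois_aut := GaloisAut {
  gal_fun :> Kbar -> Kbar;
  gal_funP : galois_axiom gal_fun }.

HB.instance Definition _ := gen_eqMixin galois_aut.
HB.instance Definition _ := gen_choiceMixin galois_aut.

Lemma galois_ext (s t : galois_aut) : (forall x, s x = t x) -> s = t.
Proof.
case: s t => [s sP] [t tP] /= /funext est; case: _ / est in tP *.
by congr GaloisAut; apply: Prop_irrelevance.
Qed.

Fact galois_one_subproof : galois_axiom id.
Proof. by split=> //; exists id. Qed.
Definition galois_one := GaloisAut galois_one_subproof.

Fact galois_mul_subproof (s t : galois_aut) : galois_axiom (s \o t).
Proof.
case: s t => [s [sB [s1 sM] sb sK]] [t [tB [t1 tM] tb tK]] /=; split=> /=.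
- by move=> x y /=; rewrite tB sB.
- by split=> [|x y] /=; rewrite ?t1 ?s1 // tM sM.
- exact: bij_comp.
- by move=> x; rewrite tK sK.
Qed.
Definition galois_mul s t := GaloisAut (galois_mul_subproof s t).

Fact galois_inv_exists (s : galois_aut) :
  exists t : galois_aut,
    cancel (s : Kbar -> Kbar) t /\ cancel (t : Kbar -> Kbar) s.
Proof.
case: s => [s [sB [s1 sM] [t st ts] sK]] /=.
suff tP : galois_axiom t by exists (GaloisAut tP).
split.
- by move=> x y; apply: (can_inj st); rewrite sB !ts.
- by split=> [|x y]; apply: (can_inj st); rewrite ?s1 ?sM !ts.
- by exists s.
- by move=> x; apply: (can_inj st); rewrite sK ts.
Qed.
Definition galois_inv s := projT1 (cid (galois_inv_exists s)).
Lemma galois_invK s : cancel (gal_fun s) (galois_inv s) /\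
  cancel (gal_fun (galois_inv s)) s.
Proof. by rewrite /galois_inv; case: cid. Qed.

Fact galois_mulA : associative galois_mul.
Proof. by move=> s t u; apply: galois_ext. Qed.
Fact galois_mul1 : left_id galois_one galois_mul.
Proof. by move=> s; apply: galois_ext. Qed.
Fact galois_mulr1 : right_id galois_one galois_mul.
Proof. by move=> s; apply: galois_ext. Qed.
Fact galois_mulV : left_inverse galois_one galois_inv galois_mul.
Proof. by move=> s; apply: galois_ext => x /=; rewrite (galois_invK s).1. Qed.
Fact galois_mulVr : right_inverse galois_one galois_inv galois_mul.
Proof. by move=> s; apply: galois_ext => x /=; rewrite (galois_invK s).2. Qed.

HB.instance Definition _ := isGroup.Build galois_aut
  galois_mulA galois_mul1 galois_mulr1 galois_mulV galois_mulVr.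

End GaloisGroup.

Section PadicAlgebra.
Variables (l : nat) (lP : prime l).

Section ValuationRing.
Variables (F : fieldType) (j : {rmorphism padic_int lP -> F}).

Definition is_integral (x : F) : Prop := integralOver j x.

(* In the ring of integers of an algebraic extension of Q_l, the maximal ideal,
   i.e. the set of elements of positive valuation, is the radical of (l). *)
Definition in_max_ideal (x : F) : Prop :=
  exists k : nat, is_integral (x ^+ k.+1 / l%:R).

Definition is_uniformizer (pi : F) : Prop :=
  in_max_ideal pi /\
  forall x, in_max_ideal x -> exists2 y, is_integral y & x = pi * y.

Definition is_residue_card (q : nat) : Prop :=
  exists r : 'I_q -> F, (forall i, is_integral (r i)) /\
    forall x, is_integral x -> exists! i, in_max_ideal (x - r i).

Lemma is_integralX x k : is_integral x -> is_integral (x ^+ k).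
Proof.
move=> ix; elim: k => [|k IHk]; first exact: integral1.
by rewrite exprS; apply: integral_mul.
Qed.

Lemma is_integral_sum (I : Type) (s : seq I) (G : I -> F) :
  (forall i, is_integral (G i)) -> is_integral (\sum_(i <- s) G i).
Proof.
by move=> iG; elim/big_ind: _ => //; [exact: integral0 | exact: integral_add].
Qed.

Lemma in_max_idealD x y : is_integral x -> is_integral y ->
  in_max_ideal x -> in_max_ideal y -> in_max_ideal (x + y).
Proof.
move=> ix iy [k xk] [h yh]; exists (k + h).+1; rewrite exprDn mulr_suml.
apply: is_integral_sum => i; rewrite -mulr_natl -mulrA.
apply: integral_mul; first exact: integral_nat.
have [le_ki | lt_ik] := leqP k.+1 ((k + h).+2 - i).
  rewrite -(subnK le_ki) exprD -[X in integralOver _ X]mulrA mulrACA.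
  by do 2?[apply: integral_mul => //]; exact: is_integralX.
have le_hi : (h.+1 <= i)%N.
  move: (nat_of_ord i) lt_ik => {}i; rewrite ltnNge; apply: contraNltn => le_ih.
  by apply: leq_trans (leq_sub2l _ le_ih); rewrite -!addSn addnK.
rewrite -(subnK le_hi) [y ^+ _]exprD mulrA -[X in integralOver _ X]mulrA.
by do 2?[apply: integral_mul => //]; exact: is_integralX.
Qed.

Lemma in_max_idealM x y : is_integral y -> in_max_ideal x -> in_max_ideal (x * y).
Proof.
move=> iy [k xk]; exists k; rewrite exprMn mulrAC.
by apply: integral_mul => //; exact: is_integralX.
Qed.

End ValuationRing.
End PadicAlgebra.

Section WeilGroup.
Variables (l : nat) (lP : prime l) (K : fieldExtType (padic lP)).
Variable Kbar : alg_closure K.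

Definition padic_in_K : padic_int lP -> K := fun z => (tofrac z : padic lP)%:A.
HB.instance Definition _ := GRing.RMorphism.copy padic_in_K
  (in_alg K \o (@tofrac (padic_int lP) : padic_int lP -> padic lP)).

Definition padic_in_Kbar : padic_int lP -> Kbar := acl_emb Kbar \o padic_in_K.
HB.instance Definition _ := GRing.RMorphism.on padic_in_Kbar.

Local Notation intK := (is_integral padic_in_Kbar).
Local Notation maxK := (in_max_ideal padic_in_Kbar).

Definition inertia (s : galois_aut Kbar) : Prop :=
  forall x, intK x -> maxK (s x - x).

(* [s] acts on the residue field of [Kbar] as [Frob ^ (b - a)], where [Frob] is
   the arithmetic Frobenius x |-> x ^ q. *)
Definition acts_as_frob (q : nat) (s : galois_aut Kbar) (a b : nat) : Prop :=
  forall x, intK x -> maxK ((s x) ^+ (q ^ a) - x ^+ (q ^ b)).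

Definition weil_pred (q : nat) : pred (galois_aut Kbar) :=
  fun s => `[< exists a b, acts_as_frob q s a b >].

Record weil (q : nat) := Weil {
  weil_val :> galois_aut Kbar; _ : weil_pred q weil_val }.

HB.instance Definition _ q := [isSub for @weil_val q].
HB.instance Definition _ q := [Choice of weil q by <:].

Lemma intK_gal (s : galois_aut Kbar) x : intK x -> intK (s x).
Proof.
case: s => s [sB sM sb sK] /= [P Pmon Px].
pose S := GRing.isZmodMorphism.Build _ _ s sB.
pose M := GRing.isMonoidMorphism.Build _ _ s sM.
pose sR : {rmorphism Kbar -> Kbar} := HB.pack s S M.
exists P => //.
suff -> : map_poly padic_in_Kbar P = map_poly (sR \o padic_in_Kbar) P.
  by rewrite map_poly_comp -[s x]/(sR x) rmorph_root.
by apply: eq_map_poly => z /=; rewrite /padic_in_Kbar /= sK.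
Qed.

Lemma maxK_exp (x y : Kbar) k : intK x -> intK y -> maxK (x - y) ->
  maxK (x ^+ k - y ^+ k).
Proof.
move=> ix iy mxy; rewrite subrXX; apply: in_max_idealM => //.
by apply: is_integral_sum => i; apply: integral_mul; exact: is_integralX.
Qed.

Lemma maxK_sym (x y : Kbar) : maxK (x - y) -> maxK (y - x).
Proof.
move=> mxy; rewrite -opprB -mulrN1; apply: in_max_idealM => //.
exact/integral_opp/integral1.
Qed.

Lemma maxK_trans (x y z : Kbar) : intK x -> intK y -> intK z ->
  maxK (x - y) -> maxK (y - z) -> maxK (x - z).
Proof.
move=> ix iy iz mxy myz; rewrite -[x - z](subrKA y).
by apply: in_max_idealD => //; exact: integral_sub.
Qed.

Fact weil_group q : group_closed (weil_pred q).
Proof.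
have W1 : weil_pred q 1%g.
  apply/asboolP; exists 0%N, 0%N => x _; rewrite !expn0 !expr1 subrr.
  by exists 0%N; rewrite expr1 mul0r; exact: integral0.
have WV s : weil_pred q s -> weil_pred q s^-1%g.
  move=> /asboolP[a [b sab]]; apply/asboolP; exists b, a => y iy.
  have := sab _ (intK_gal s^-1%g iy).
  by rewrite [s _](galois_invK s).2 => /maxK_sym.
have WM s t : weil_pred q s -> weil_pred q t -> weil_pred q (s * t)%g.
  move=> /asboolP[a [b sab]] /asboolP[c [d tcd]]; apply/asboolP.
  exists (a + c)%N, (b + d)%N => x ix; rewrite -[(s * t)%g x]/(s (t x)).
  have ist := intK_gal s (intK_gal t ix).
  apply: (@maxK_trans _ (t x ^+ (q ^ b) ^+ (q ^ c)));
    try by do !apply: is_integralX => //; exact: intK_gal.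
    rewrite expnD exprM; apply: maxK_exp; try exact: is_integralX.
      by apply: is_integralX; exact: intK_gal.
    by apply: sab; exact: intK_gal.
  rewrite exprAC [in x ^+ _]expnD mulnC exprM.
  apply: maxK_exp; try exact: is_integralX.
    by apply: is_integralX; exact: intK_gal.
  exact: tcd.
by split=> // s t Ws Wt; apply: WM => //; exact: WV.
Qed.

HB.instance Definition _ q := SubChoice_isSubGroup.Build (galois_aut Kbar)
  (weil_pred q) (weil q) (weil_group q).

End WeilGroup.

Section TameCharacter.
Variables (p l : nat) (pP : prime p) (lP : prime l) (K : fieldExtType (padic lP)).
Variables (Kbar : alg_closure K) (q : nat).

Definition geometric_frobenius (phi : galois_aut Kbar) : Prop :=
  forall x, is_integral (padic_in_Kbar Kbar) x ->
    in_max_ideal (padic_in_Kbar Kbar) (phi x ^+ q - x).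

Definition weil_valuation (phi : weil Kbar q) (v : weil Kbar q -> int) : Prop :=
  [/\ {morph v : s t / (s * t)%g >-> s + t},
      forall s : weil Kbar q, inertia s -> v s = 0 & v phi = 1].

Definition compatible_roots (zeta : nat -> Kbar) : Prop :=
  (forall n, coprime n l -> n.-primitive_root (zeta n)) /\
  (forall m n, coprime (m * n) l -> zeta (m * n)%N ^+ m = zeta n).

(* Only the values of [t] on the inertia group are constrained (and used). *)
Definition tame_character (zeta : nat -> Kbar) (t : weil Kbar q -> padic_int pP) :
    Prop :=
  [/\ forall s : weil Kbar q, inertia s ->
        forall (n : nat) (pi : K) (y : Kbar),
          is_uniformizer (@padic_in_K l lP K) pi ->
          y ^+ (p ^ n) = acl_emb Kbar pi ->
          s y = zeta (p ^ n)%N ^ (t s n) * y,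
      forall s s' : weil Kbar q, inertia s -> inertia s' -> t (s * s')%g = t s + t s'
    & forall z, exists2 s, inertia (weil_val s) & t s = z].

End TameCharacter.

Record weil_setup (p l : nat) (pP : prime p) (lP : prime l) := WeilSetup {
  ws_K : fieldExtType (padic lP);
  ws_Kbar : alg_closure ws_K;
  ws_q : nat;
  ws_qP : is_residue_card (@padic_in_K l lP ws_K) ws_q;
  ws_phi : weil ws_Kbar ws_q;
  ws_phiP : geometric_frobenius ws_q ws_phi;
  ws_v : weil ws_Kbar ws_q -> int;
  ws_vP : weil_valuation ws_phi ws_v;
  ws_zeta : nat -> ws_Kbar;
  ws_zetaP : compatible_roots ws_zeta;
  ws_t : weil ws_Kbar ws_q -> padic_int pP;
  ws_tP : tame_character ws_zeta ws_t }.

Definition weil_of (p l : nat) (pP : prime p) (lP : prime l)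
  (S : weil_setup pP lP) : groupType := weil (ws_Kbar S) (ws_q S).
Coercion weil_of : weil_setup >-> groupType.

(* Matrices act on column vectors; a subspace of F^n is the row space of a
   matrix [U] whose rows are the transposes of its vectors, so that [U] is
   stable under [g] iff [stablemx U g^T]. *)
Section Matrices.
Variables (F : fieldType) (n : nat).
Implicit Types g u N U : 'M[F]_n.

Definition nilpotent_mx N : Prop := exists k, N ^+ k = 0.
Definition unipotent_mx u : Prop := nilpotent_mx (u - 1%:M).

Definition semisimple_mx g : Prop :=
  forall U, stablemx U g^T ->
    exists V : 'M[F]_n, [/\ stablemx V g^T, (U :&: V)%MS = 0 & row_full (U + V)%MS].

(* The unipotent part of the multiplicative Jordan decomposition of [g]. *)
Definition unipotent_part g : 'M[F]_n := xget 1%:M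
  [set u : 'M[F]_n | unipotent_mx u /\
    exists s : 'M[F]_n, [/\ semisimple_mx s, s *m u = g & u *m s = g]]%classic.

Definition mx_expz g (k : int) : 'M[F]_n :=
  match k with Posz m => g ^+ m | Negz m => invmx g ^+ m.+1 end.

(* The exponential of a nilpotent matrix (for which N ^+ n = 0). *)
Definition exp_mx N : 'M[F]_n := \sum_(k < n) (k`!%:R)^-1 *: N ^+ k.

(* An increasing filtration [M] of F^n such that N M_i is in M_(i-2) and N^k
   induces an isomorphism Gr_k -> Gr_(-k) for all k >= 0. *)
Definition monodromy_filtration N (M : int -> 'M[F]_n) : Prop :=
  [/\ forall i, (M i <= M (i + 1)%R)%MS,
      (exists i, M i = 0) /\ (exists i, row_full (M i)),
      forall i, (M i *m N^T <= M (i - 2)%R)%MS,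
      forall k : nat,
        (M (- k%:Z)%R <= M k%:Z *m (N^T ^+ k)%R + M (- k%:Z - 1)%R)%MS
    & forall (k : nat) (x : 'rV[F]_n), (x <= M k%:Z)%MS ->
        (x *m (N^T ^+ k)%R <= M (- k%:Z - 1)%R)%MS -> (x <= M (k%:Z - 1)%R)%MS].

Definition gr_eigenvalue (M : int -> 'M[F]_n) g (i : int) (a : F) : Prop :=
  exists x : 'rV[F]_n, [/\ (x <= M i)%MS, ~~ (x <= M (i - 1)%R)%MS
    & ((x *m g^T - a *: x)%R <= M (i - 1)%R)%MS].

(* The polynomial det(1 - X g | U) for a stable subspace [U]. *)
Definition rev_char_poly_on U g : {poly F} :=
  \det (1%:M - 'X *: map_mx polyC (conjmx (row_base U) g^T)).

End Matrices.

Definition is_rep (G : groupType) (A : nzRingType) n (r : G -> 'M[A]_n) : Prop :=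
  r 1%g = 1%:M /\ {morph r : s t / (s * t)%g >-> s *m t}.

Definition irreducible_rep (G : groupType) (F : fieldType) n (r : G -> 'M[F]_n) :
    Prop :=
  (0 < n)%N /\
  forall U : 'M[F]_n, (forall s, stablemx U (r s)^T) -> U != 0 -> row_full U.

Definition weil_number (Rr : realType) (F : fieldType) (q : nat) (w : int) (a : F) :
    Prop :=
  (exists (L : fieldExtType rat) (b : L) (j : {rmorphism L -> F}),
     [/\ j b = a, <<1; b>>%VS = fullv
       & forall s : {rmorphism L -> Rr[i]}, `|s b| = sqrtC q%:R ^ w]) /\
  exists n : int, integralOver (fun k : int => k%:~R : F) (q%:R ^ n * a).

Record wd_rep (G : Type) (F : fieldType) (n : nat) := WDRep {
  wd_r : G -> 'M[F]_n;
  wd_N : 'M[F]_n }.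

Definition wd_map (G : Type) (F E : fieldType) (f : F -> E) n
  (D : wd_rep G F n) : wd_rep G E n :=
  WDRep (fun s => map_mx f (wd_r D s)) (map_mx f (wd_N D)).

Definition wd_iso (G : Type) (F : fieldType) n n' (D : wd_rep G F n)
    (D' : wd_rep G F n') : Prop :=
  exists (P : 'M[F]_(n', n)) (Q : 'M[F]_(n, n')),
    [/\ P *m Q = 1%:M, Q *m P = 1%:M,
        forall s, P *m wd_r D s = wd_r D' s *m P & P *m wd_N D = wd_N D' *m P].

Definition wd_sum (G : Type) (F : fieldType) m (n : 'I_m -> nat)
  (D : forall i, wd_rep G F (n i)) : wd_rep G F (\sum_i n i) :=
  WDRep (fun s => \mxdiag_(i < m) wd_r (D i) s) (\mxdiag_(i < m) wd_N (D i)).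

Section WeilDeligne.
Variables (p l : nat) (pP : prime p) (lP : prime l) (S : weil_setup pP lP).

Local Notation I := (fun s : S => inertia (weil_val s)).
Local Notation v := (@ws_v _ _ _ _ S).
Local Notation q := (ws_q S).
Local Notation phi := (ws_phi S : S).

Definition weil_expz (s : S) (k : int) : S :=
  match k with Posz m => s ^+ m | Negz m => s ^- m.+1 end%g.

(* The inertia subgroup of a finite extension of K inside [Kbar]. *)
Definition inertia_of (L : fieldExtType (ws_K S)) (j : {rmorphism L -> ws_Kbar S})
  (s : S) : Prop := I s /\ forall y, weil_val s (j y) = j y.

Section OverField.
Variable F : fieldType.

Definition finite_inertia (A : nzRingType) n (r : S -> 'M[A]_n) : Prop :=
  exists e : seq 'M[A]_n, forall s, I s -> r s \in e.

Definition is_wd n (D : wd_rep S F n) : Prop :=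
  [/\ is_rep (wd_r D), finite_inertia (wd_r D), nilpotent_mx (wd_N D)
    & forall s, wd_r D s *m wd_N D *m wd_r D s^-1%g
        = q%:R ^ (- v s) *: wd_N D].

Definition frob_ss n (D : wd_rep S F n) : wd_rep S F n :=
  WDRep (fun s => wd_r D s *m mx_expz (unipotent_part (wd_r D phi)) (- v s))
        (wd_N D).

(* The block of index i is the summand r |Art_K^-1|^i. *)
Definition wd_sp (t d : nat) (r : S -> 'M[F]_d) : wd_rep S F (\sum_(i < t) d) :=
  WDRep (fun s => \mxdiag_(i < t) (q%:R ^ (- (v s * i%:Z)) *: r s))
        (\mxblock_(i < t, j < t) ((i == j.+1 :> nat)%:R%:M : 'M[F]_d)).

Definition irr_frob_ss n (r : S -> 'M[F]_n) : Prop :=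
  [/\ is_rep r, irreducible_rep r, semisimple_mx (r phi) & finite_inertia r].

Definition euler_space n (D : wd_rep S F n) : 'M[F]_n := xget 0
  [set U : 'M[F]_n | forall x : 'rV[F]_n, (x <= U)%MS <->
     x *m (wd_N D)^T = 0 /\ forall s, I s -> x *m (wd_r D s)^T = x]%classic.

(* The polynomial Eul(D, X)^-1. *)
Definition wd_euler_inv n (D : wd_rep S F n) : {poly F} :=
  rev_char_poly_on (euler_space D) (wd_r D phi).

Definition wd_pure (Rr : realType) (w : int) n (D : wd_rep S F n) : Prop :=
  exists2 M, monodromy_filtration (wd_N D) M
    & forall i a, gr_eigenvalue M (wd_r D phi) i a -> weil_number Rr q (w + i) a.

Variable z : padic_int pP -> F.

Definition monodromic_with n (rho : S -> 'M[F]_n) (N : 'M[F]_n) : Prop :=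
  nilpotent_mx N /\
  exists (L : fieldExtType (ws_K S)) (j : {rmorphism L -> ws_Kbar S}),
    (forall x, j x%:A = acl_emb (ws_Kbar S) x) /\
    forall s, inertia_of j s -> rho s = exp_mx (z (ws_t s) *: N).

Definition monodromic n (rho : S -> 'M[F]_n) : Prop :=
  exists N, monodromic_with rho N.

(* There is at most one monodromy, as [ws_t S] is onto on the inertia group. *)
Definition monodromy n (rho : S -> 'M[F]_n) : 'M[F]_n :=
  xget 0 [set N | monodromic_with rho N]%classic.

Definition wd_of n (rho : S -> 'M[F]_n) : wd_rep S F n :=
  let N := monodromy rho in
  WDRep (fun s =>
    rho s *m exp_mx (- (z (ws_t (weil_expz phi (- v s) * s)%g) *: N))) N.

Definition pure_rep (Rr : realType) n (rho : S -> 'M[F]_n) : Prop :=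
  monodromic rho /\ exists w : int, wd_pure Rr w (frob_ss (wd_of rho)).

End OverField.
End WeilDeligne.

Section IntegralExtension.
Variables (p : nat) (R : idomainType) (Om : alg_closure {fraction R}).

Definition frac_emb : R -> Om := acl_emb Om \o @tofrac R.
HB.instance Definition _ := GRing.RMorphism.on frac_emb.

Definition Rp := locp p (@tofrac R).
Definition intal := intcl frac_emb.
Definition intalp := locp p (\val : intal -> Om).
HB.instance Definition _ := GRing.ComNzRing.on Rp.
HB.instance Definition _ := GRing.ComNzRing.on intal.
HB.instance Definition _ := GRing.ComNzRing.on intalp.

(* As the codomain [E] is an algebraically closed field, it is its own
   integral closure in an algebraic closure. *)
Record intal_ext (E : closedFieldType) (f : R -> E) := IntalExt {
  ie_Rp : {rmorphism Rp -> E};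
  ie_int : {rmorphism intal -> E};
  ie_intp : {rmorphism intalp -> E};
  ie_RpP : forall a : R, ie_Rp (locp_of p (@tofrac R) a) = f a;
  ie_intP : forall a : R, ie_int (intcl_of frac_emb a) = f a;
  ie_intpP : forall x : intal,
    ie_intp (locp_of p (\val : intal -> Om) x) = ie_int x }.

End IntegralExtension.

Section Langlands.
Variables (p l : nat) (pP : prime p) (lP : prime l) (S : weil_setup pP lP).
Variables (C : closedFieldType) (n : nat).

Local Notation K := (ws_K S).

Record gl_rep := GLRep {
  gl_space :> lmodType C;
  gl_act : 'M[K]_n -> gl_space -> gl_space }.

(* The principal congruence subgroups form a basis of neighbourhoods of 1 made
   of compact open subgroups of GL_n(K). *)
Definition congruence_subgroup (k : nat) (g : 'M[K]_n) : Prop :=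
  forall i j, exists2 c, is_integral (padic_in_K K) c
    & (g - 1%:M) i j = l%:R ^+ k.+1 * c.

Definition fixed_by_congruence (pi : gl_rep) (k : nat) (x : pi) : Prop :=
  forall g, congruence_subgroup k g -> gl_act g x = x.

Definition irr_admissible (pi : gl_rep) : Prop :=
  [/\ [/\ forall g, g \in unitmx -> linear (@gl_act pi g),
          forall x : pi, gl_act 1%:M x = x
        & forall g h (x : pi), g \in unitmx -> h \in unitmx ->
            gl_act (g *m h) x = gl_act g (gl_act h x)],
      forall x : pi, exists k, fixed_by_congruence k x,
      forall k, exists m (b : 'I_m -> pi), forall x, fixed_by_congruence k x ->
        exists c : 'I_m -> C, x = \sum_(i < m) c i *: b i,
      exists x : pi, x != 0
    & forall P : pi -> Prop,
        (forall a x y, P x -> P y -> P (a *: x + y)) ->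
        (forall g x, g \in unitmx -> P x -> P (gl_act g x)) ->
        (exists2 x, x != 0 & P x) -> forall x, P x].

Definition gl_iso (pi pi' : gl_rep) : Prop :=
  exists2 f : {linear pi -> pi'}, bijective f
    & forall g x, g \in unitmx -> f (gl_act g x) = gl_act g (f x).

(* Complex Weil-Deligne representations are required to be smooth, i.e. trivial
   on the inertia group of a finite extension of K. *)
Definition frob_ss_wd (D : wd_rep S C n) : Prop :=
  [/\ is_wd D, semisimple_mx (wd_r D (ws_phi S))
    & exists (L : fieldExtType K) (j : {rmorphism L -> ws_Kbar S}),
        (forall x, j x%:A = acl_emb (ws_Kbar S) x) /\
        forall s, inertia_of j s -> wd_r D s = 1%:M].

(* A bijection between isomorphism classes, such as the local Langlands
   correspondence. *)
Definition langlands_bijection (rec : wd_rep S C n -> gl_rep) : Prop :=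
  [/\ forall D, frob_ss_wd D -> irr_admissible (rec D),
      forall D D', frob_ss_wd D -> frob_ss_wd D' ->
        (gl_iso (rec D) (rec D') <-> wd_iso D D')
    & forall pi, irr_admissible pi ->
        exists2 D, frob_ss_wd D & gl_iso (rec D) pi].

(* Unordered tuples are represented by sequences up to permutation. *)
Definition automorphic_type (rec : wd_rep S C n -> gl_rep) (pi : gl_rep)
    (tau : seq (nat * nat)) : Prop :=
  exists D, [/\ frob_ss_wd D, gl_iso (rec D) pi
    & exists k (d t : 'I_k -> nat) (s : forall i, S -> 'M[C]_(d i)),
        [/\ forall i, irr_frob_ss (s i), forall i, (0 < t i)%N,
            wd_iso D (wd_sum (fun i => wd_sp (t i) (s i)))
          & perm_eq tau [seq (d i, t i) | i <- enum 'I_k]]].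

End Langlands.

Definition padic_emb (p : nat) (pP : prime p) (Qpbar : alg_closure (padic pP)) :
    padic_int pP -> Qpbar :=
  fun z => acl_emb Qpbar (tofrac z).

Definition finite_image (G : Type) (A : nzRingType) n (r : G -> 'M[A]_n) : Prop :=
  exists e : seq 'M[A]_n, forall s, r s \in e.

Section Twist.
Variables (p l : nat) (pP : prime p) (lP : prime l) (S : weil_setup pP lP).
Variables (R : idomainType) (Om : alg_closure {fraction R}).

Definition unramified_char (chi : S -> intal Om) : Prop :=
  [/\ chi 1%g = 1, {morph chi : s t / (s * t)%g >-> s * t},
      forall s, exists x, x * chi s = 1
    & forall s : S, inertia (weil_val s) -> chi s = 1].

Definition twist (chi : S -> intal Om) n (r : S -> 'M[intalp p Om]_n) (s : S) :
    'M[intalp p Om]_n :=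
  locp_of p (\val : intal Om -> Om) (chi s) *: r s.

End Twist.

(* Main.v *)
Require Import Defs.
From HB Require Import structures.
From mathcomp Require Import all_boot all_order all_algebra all_fingroup all_field.
From mathcomp Require Import boolp classical_sets reals complex.
From mathcomp Require Import ring zify.

Set Implicit Arguments.
Unset Strict Implicit.
Unset Printing Implicit Defensive.

Import Order.TTheory GRing.Theory Num.Theory.
Local Open Scope ring_scope.

(** A Frobenius-semisimple Weil-Deligne representation is determined by the traces
    of the Weil group on the images of the powers [N^j] of the monodromy
    ([wd_iso_of_image_traces]).  Indeed, up to twists, these traces give by
    differences the characters of the graded pieces of [ker N] for the filtration
    by the images of the [N^j], and in characteristic 0 a representation with
    finite inertia and diagonalizable Frobenius is determined by its character
    ([brauer_nesbitt]).  When [N^j B N^j = N^j], the trace of [s] on the image of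
    [N^j] is [tr (s N^j B)].

    A specialization is a place of [Om], whose domain contains the integral
    closure of [R].  The rank of [N^j] can only drop under a place, and where it
    does not, one invertible minor yields a generalized inverse [B] that
    specializes ([mpl_ginv]).  The traces above then specialize, for the given
    representation as for the sum of the [Sp_t]; as the unipotent part of
    Frobenius does not affect them ([frob_ss_trace]), the decomposition
    specializes as soon as the ranks of the [N^j] are preserved
    ([specialize_decomp]).

    Purity preserves the ranks ([specialize_rank]).  The character of the whole
    representation always specializes, so the Frobenius eigenvalues of [V_lam] come
    in the strings [a, a / q, ..., a / q^(t - 1)] of the generic decomposition,
    along which the weight decreases by 2.  In a pure representation the weight of
    an eigenvector, relative to [w], is its place in the monodromy filtration; so
    the rank of [N^j] is at least the number of eigenvalues whose weight is outside
    the interval [(-j, j]].  At least [t - j] members of a string of length [t] have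
    such a weight, and the generic rank of [N^j] is the sum of these [t - j].

    For [mu], the rank of [mu(N)^j] lies between those of [lam(N)^j] and [N^j].  The
    inverse Euler factor is [det (1 - X phi pi)], where the projector [pi] onto the
    invariants of the inertia killed by [N] is built from an average over the
    inertia and a generalized inverse of [N], so that it specializes
    ([euler_specialize]); its coefficients are integral because its inverse roots
    are eigenvalues of [rho phi].  By Schur's lemma the averages of the elementary
    matrices over the image of [rho_i] are rational multiples of the identity;
    this passes to the specializations, which are thus irreducible
    ([specialize_irreducible]).  The automorphic type is therefore read off the
    generic decomposition. *)

(** * Nilpotent and idempotent matrices *)

Lemma pigeonhole (T : eqType) (f : nat -> T) (e : seq T) : (forall k, f k \in e) ->
  exists a b, (a < b)%N /\ f a = f b.
Proof.
move=> fe; apply: contrapT => nof.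
have uf : uniq [seq f k | k <- iota 0 (size e).+1].
  rewrite map_inj_in_uniq ?iota_uniq // => a b _ _ fab; apply/eqP.
  case: ltngtP => // lt; case: nof; first by exists a, b.
  by exists b, a.
have sub : {subset [seq f k | k <- iota 0 (size e).+1] <= e} by move=> _ /mapP[k _ ->].
by have := uniq_leq_size uf sub; rewrite size_map size_iota ltnn.
Qed.

Lemma char0_natf_inj (F : fieldType) : [pchar F] =i pred0 ->
  injective (fun k => k%:R : F).
Proof.
move=> F0 a b /eqP; rewrite -subr_eq0; case: (leqP b a) => [le_ba | /ltnW le_ab].
  by rewrite -natrB // ((pcharf0P F).1 F0) subn_eq0 => ?; apply/eqP; rewrite eqn_leq le_ba andbT.
rewrite -opprB oppr_eq0 -natrB // ((pcharf0P F).1 F0) subn_eq0 => ?.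
by apply/eqP; rewrite eqn_leq le_ab.
Qed.

Section NilpotentIdempotent.
Variable F : fieldType.

Lemma unitX_mx n (A : 'M[F]_n) k : A \in unitmx -> A ^+ k \in unitmx.
Proof.
by move=> uA; elim: k => [|k IHk]; rewrite ?expr0 ?unitmx1 // exprS -mulmxE unitmx_mul uA.
Qed.

Lemma intertwineX m n (A : 'M[F]_m) (B : 'M[F]_n) (P : 'M_(n, m)) k :
  P *m A = B *m P -> P *m A ^+ k = B ^+ k *m P.
Proof.
move=> PA; elim: k => [|k IHk]; first by rewrite !expr0 mulmx1 mul1mx.
by rewrite !exprS -!mulmxE mulmxA PA -mulmxA IHk mulmxA.
Qed.

Lemma expmx_swap m n (C : 'M[F]_(m, n)) (D : 'M[F]_(n, m)) k :
  (C *m D) ^+ k.+1 = C *m (D *m C) ^+ k *m D.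
Proof.
elim: k => [|k IHk]; first by rewrite expr1 expr0 mulmx1.
by rewrite exprS IHk -mulmxE exprS -mulmxE !mulmxA.
Qed.

Lemma nilpotent_swap m n (C : 'M[F]_(m, n)) (D : 'M[F]_(n, m)) :
  nilpotent_mx (C *m D) -> nilpotent_mx (D *m C).
Proof.
by case=> k Ck0; exists k.+1; rewrite expmx_swap Ck0 mulmx0 mul0mx.
Qed.

Lemma nilpotent_rank n (N : 'M[F]_n) : nilpotent_mx N -> (0 < n)%N ->
  (\rank N < n)%N.
Proof.
case=> k Nk0 n_gt0; rewrite ltn_neqAle rank_leq_row andbT; apply/negP => rN.
have uN : N \in unitmx by rewrite -row_free_unit.
have := unitX_mx k uN.
by rewrite Nk0 -row_full_unit /row_full mxrank0 eq_sym -leqn0 leqNgt n_gt0.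
Qed.

(** Writing [N = C R] through its image, [R C] is nilpotent of smaller size, so
    both facts follow by induction on the size. *)
Lemma nilpotent_facts n (N : 'M[F]_n) : nilpotent_mx N -> N ^+ n = 0 /\ \tr N = 0.
Proof.
elim/ltn_ind: n N => n IHn N nilN; have [n0|n_gt0] := posnP n.
  by subst n; split; [exact: flatmx0 | rewrite (flatmx0 N) mxtrace0].
have rN := nilpotent_rank nilN n_gt0.
have := nilN; rewrite -{1}(mulmx_base N) => /nilpotent_swap nilD.
have [D0 tD] := IHn _ rN _ nilD; split; last first.
  by rewrite -(mulmx_base N) mxtrace_mulC.
have -> : N ^+ n = N ^+ (n - (\rank N).+1) * N ^+ (\rank N).+1.
  by rewrite -exprD subnK.
by rewrite -[X in _ * X ^+ _](mulmx_base N) expmx_swap D0 mulmx0 mul0mx mulr0.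
Qed.

Lemma nilpotentXn n (N : 'M[F]_n) : nilpotent_mx N -> N ^+ n = 0.
Proof. by case/nilpotent_facts. Qed.

Lemma trace_nilpotent n (N : 'M[F]_n) : nilpotent_mx N -> \tr N = 0.
Proof. by case/nilpotent_facts. Qed.

Lemma trace_idempotent n (e : 'M[F]_n) : e *m e = e -> \tr e = (\rank e)%:R.
Proof.
move=> ee; have : row_base e *m col_base e = 1%:M.
  move: (row_base_free e) (col_base_full e) (mulmx_base e).
  move: (row_base e) (col_base e) => D C freeD fullC CD.
  apply: (row_free_inj freeD); apply: (row_full_inj fullC).
  by rewrite /= mul1mx !mulmxA CD -mulmxA CD ee.
by move=> re; rewrite -[in LHS](mulmx_base e) mxtrace_mulC re mxtrace1.
Qed.

Lemma nilpotent_comm n (A B : 'M[F]_n) : A *m B = B *m A ->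
  nilpotent_mx A -> nilpotent_mx (A *m B).
Proof.
by move=> cAB [k Ak]; exists k; rewrite mulmxE exprMn_comm ?Ak ?mul0r.
Qed.

Lemma nilpotentD n (A B : 'M[F]_n) : A *m B = B *m A ->
  nilpotent_mx A -> nilpotent_mx B -> nilpotent_mx (A + B).
Proof.
move=> cAB [k Ak] [h Bh]; exists (k + h)%N; rewrite exprDn_comm //.
apply: big1 => i _; have [le_hi|lt_ih] := leqP h i.
  by rewrite -(subnK le_hi) [B ^+ _]exprD Bh !mulr0 mul0rn.
have le_k : (k <= k + h - i)%N by rewrite -addnBA ?leq_addr // ltnW.
by rewrite -(subnK le_k) exprD Ak mulr0 mul0r mul0rn.
Qed.

Lemma nilpotentN n (A : 'M[F]_n) : nilpotent_mx A -> nilpotent_mx (- A).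
Proof. by case=> k Ak; exists k; rewrite exprNn Ak mulr0. Qed.

Lemma exprZmx n a (A : 'M[F]_n) k : (a *: A) ^+ k = a ^+ k *: A ^+ k.
Proof.
elim: k => [|k IHk]; first by rewrite !expr0 scale1r.
by rewrite !exprS IHk -!mulmxE -scalemxAl -scalemxAr scalerA.
Qed.

Lemma nilpotentZ n a (A : 'M[F]_n) : nilpotent_mx A -> nilpotent_mx (a *: A).
Proof. by case=> k Ak; exists k; rewrite exprZmx Ak scaler0. Qed.

Lemma nilpotent_conj n (P A : 'M[F]_n) : P \in unitmx ->
  nilpotent_mx A -> nilpotent_mx (P *m A *m invmx P).
Proof.
move=> uP [k Ak]; exists k.+1.
by rewrite -mulmxA expmx_swap -!mulmxA mulVmx // mulmx1 Ak mul0mx mulmx0.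
Qed.

End NilpotentIdempotent.

(** * The exponential of a nilpotent matrix *)

Section Exponential.
Variables (F : fieldType) (F0 : [pchar F] =i pred0).

Lemma factf_neq0 k : (k`!%:R : F) != 0.
Proof. by rewrite ((pcharf0P F).1 F0) -lt0n fact_gt0. Qed.

Let expp n (a : F) : {poly F} := \poly_(k < n) (a ^+ k / k`!%:R).

Let exp_horner n (N : 'M[F]_n.+1) a :
  exp_mx (a *: N) = horner_mx N (expp n.+1 a).
Proof.
rewrite /exp_mx /expp poly_def rmorph_sum; apply: eq_bigr => k _ /=.
by rewrite horner_mxZ rmorphXn /= horner_mx_X exprZmx scalerA mulrC.
Qed.

Let exppD n a b : take_poly n (expp n a * expp n b) = expp n (a + b).
Proof.
apply/polyP => k; rewrite coef_take_poly coef_poly; case: ltnP => // lt_kn.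
rewrite coefM addrC exprDn mulr_suml.
apply: eq_bigr => -[i /=]; rewrite ltnS => le_ik _.
rewrite !coef_poly (leq_ltn_trans le_ik) // (leq_ltn_trans (leq_subr _ _)) //.
have -> : k`!%:R = 'C(k, i)%:R * (i`!%:R * (k - i)`!%:R) :> F.
  by rewrite -!natrM bin_fact.
have C0 : 'C(k, i)%:R != 0 :> F.
  by rewrite ((pcharf0P F).1 F0) -lt0n bin_gt0.
rewrite mulrACA -invfM [a ^+ i * _]mulrC -[_ *+ 'C(k, i)]mulr_natr.
by rewrite [('C(k, i)%:R * _)^-1]invfM [RHS]mulrA mulfK.
Qed.

Lemma exp_mxD n (N : 'M[F]_n) a b : nilpotent_mx N ->
  exp_mx (a *: N) *m exp_mx (b *: N) = exp_mx ((a + b) *: N).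
Proof.
case: n N => [|n] N nilN; first by rewrite [LHS]flatmx0 [RHS]flatmx0.
rewrite !exp_horner mulmxE -rmorphM /=.
rewrite -[X in horner_mx N X](poly_take_drop n.+1) rmorphD rmorphM /=.
by rewrite rmorphXn /= horner_mx_X nilpotentXn // mulr0 addr0 exppD.
Qed.

Lemma exp_mx0 n : exp_mx (0 : 'M[F]_n) = 1%:M.
Proof.
case: n => [|n]; first by rewrite [LHS]flatmx0 [RHS]flatmx0.
rewrite /exp_mx big_ord_recl fact0 invr1 expr0 scale1r big1 ?addr0 // => i _.
by rewrite expr0n scaler0.
Qed.

Lemma exp_mx_nat n (N : 'M[F]_n) m : nilpotent_mx N ->
  exp_mx (m%:R *: N) = exp_mx N ^+ m.
Proof.
move=> nilN; elim: m => [|m IHm]; first by rewrite scale0r exp_mx0 expr0.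
by rewrite exprS -IHm -natr1 addrC -{2}[N]scale1r -mulmxE exp_mxD.
Qed.

Lemma exp_mx_intertwine n (N N' A : 'M[F]_n) : A *m N = N' *m A ->
  A *m exp_mx N = exp_mx N' *m A.
Proof.
move=> cAN; rewrite /exp_mx mulmx_sumr mulmx_suml; apply: eq_bigr => k _.
by rewrite -scalemxAr -scalemxAl (intertwineX k cAN).
Qed.

(** The powers [exp(N)^m = exp(m N)] are values at the integers [m] of a
    polynomial with matrix coefficients; its linear coefficient is [N]. *)
Lemma exp_mx_inj n (N N' : 'M[F]_n) : nilpotent_mx N -> nilpotent_mx N' ->
  exp_mx N = exp_mx N' -> N = N'.
Proof.
case: n N N' => [|n] N N' nilN nilN' eqE; first by rewrite [LHS]flatmx0 [RHS]flatmx0.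
have [n0|n_gt0] := posnP n.
  by subst n; rewrite -[N]expr1 -[N' in RHS]expr1 !nilpotentXn.
apply/matrixP => i j.
pose P := \poly_(k < n.+1) (k`!%:R^-1 * ((N ^+ k) i j - (N' ^+ k) i j)).
have P0 : P = 0.
  apply: (@roots_geq_poly_eq0 _ _ [seq m%:R | m <- iota 0 n.+1]).
  - apply/allP => _ /mapP[m _ ->]; apply/rootP.
    have := congr1 (fun A : 'M_n.+1 => (A ^+ m) i j) eqE.
    rewrite -!exp_mx_nat // /exp_mx !summxE => /eqP; rewrite -subr_eq0 => /eqP eq0.
    rewrite -[RHS]eq0 horner_poly -sumrB; apply: eq_bigr => k _.
    by rewrite !exprZmx !mxE -!mulrBr -mulrA [(_ - _) * _]mulrC.
  - by rewrite map_inj_uniq ?iota_uniq //; exact: char0_natf_inj.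
  - by rewrite size_map size_iota size_poly.
have := congr1 (fun p : {poly F} => p`_1) P0.
rewrite coef_poly coef0 ltnS n_gt0 factS fact0 muln1 invr1 mul1r !expr1 => /eqP.
by rewrite subr_eq0 => /eqP.
Qed.

End Exponential.

(** * Diagonalizable matrices and the Jordan decomposition *)

Definition diagable (F : fieldType) n (A : 'M[F]_n) : Prop :=
  exists (P : 'M[F]_n) (D : 'rV[F]_n), P \in unitmx /\ P *m A = diag_mx D *m P.

Section Diagonalizable.
Variable F : fieldType.

Lemma diagable_size0 (A : 'M[F]_0) : diagable A.
Proof. by exists 1%:M, 0; split; rewrite ?unitmx1 // [LHS]flatmx0 [RHS]flatmx0. Qed.

Lemma diagable_diagonalizable n (A : 'M[F]_n) : diagable A <-> diagonalizable A.
Proof.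
split=> [[P [D [uP PA]]]|[P uP /diagonalizable_forPex[D /(simmxP uP) PA]]].
  by exists P => //; apply/diagonalizable_forPex; exists D; apply/(simmxP uP).
by exists P, D.
Qed.

Lemma diagable_root n (A : 'M[F]_n.+1) (rs : seq F) : uniq rs ->
  horner_mx A (\prod_(a <- rs) ('X - a%:P)) = 0 -> diagable A.
Proof.
move=> urs A0; apply/diagable_diagonalizable/diagonalizableP.
by exists rs => //; apply: mxminpoly_min.
Qed.

Lemma diag_mxX n (D : 'rV[F]_n) k : diag_mx D ^+ k = diag_mx (\row_i D 0 i ^+ k).
Proof.
elim: k => [|k IHk].
  by rewrite expr0 -[1]/(1%:M) -diag_const_mx; congr diag_mx; apply/rowP => i; rewrite !mxE expr0.
rewrite exprS IHk -mulmxE mulmx_diag; congr diag_mx.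
by apply/rowP => i; rewrite !mxE exprS.
Qed.

Lemma diagable_tr n (A : 'M[F]_n) : diagable A -> diagable A^T.
Proof.
case=> P [D [uP PA]]; exists (invmx P)^T, D; split.
  by rewrite unitmx_tr unitmx_inv.
rewrite -[diag_mx D]tr_diag_mx -!trmx_mul; congr _^T.
by rewrite -[LHS](mulKmx uP) [P *m _]mulmxA PA mulmxK.
Qed.

Lemma unipotent_unit n (u : 'M[F]_n) : unipotent_mx u -> u \in unitmx.
Proof.
case=> k uk; have := subrX1 (1 - u) k.
have -> : (1 - u) ^+ k = 0 by rewrite -opprB exprNn uk mulr0.
rewrite addrAC subrr !sub0r mulNr => /oppr_inj/esym.
by case/mulmx1_unit.
Qed.

Lemma mx_comm_inv n (A B : 'M[F]_n) :
  A *m B = B *m A -> A *m invmx B = invmx B *m A.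
Proof.
have [uB cAB|nuB] := boolP (B \in unitmx); last by rewrite invmx_out.
by rewrite -[LHS](mulKmx uB) [B *m (_ *m _)]mulmxA -cAB mulmxK.
Qed.

(** The Chinese remainder theorem. *)
Lemma crt_polyC (rs : seq F) m : uniq rs ->
  exists P : {poly F}, forall a, a \in rs -> ('X - a%:P) ^+ m %| P - a%:P.
Proof.
elim: rs => [|b rs IHrs] /=; first by exists 0.
case/andP=> b_rs /IHrs[P PP]; pose Q := \prod_(a <- rs) ('X - a%:P) ^+ m.
have /Bezout_eq1_coprimepP[[u w] /= uw1] : coprimep Q (('X - b%:P) ^+ m).
  rewrite /Q big_seq; elim/big_ind: _ => [|q q' cq cq'|a a_rs].
  - exact: coprime1p.
  - by rewrite coprimepMl cq.
  - rewrite coprimep_expl // coprimep_expr // coprimep_XsubC root_XsubC.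
    by apply: contraNneq b_rs => ->.
exists (P + u * Q * (b%:P - P)) => a; rewrite inE => /predU1P[-> | a_rs].
  have -> : P + u * Q * (b%:P - P) - b%:P = (P - b%:P) * (1 - u * Q).
    by ring.
  by rewrite -uw1 addrAC subrr add0r mulrA dvdp_mull.
rewrite addrAC dvdp_add ?PP // mulrAC dvdp_mull //.
by rewrite /Q (big_rem a) //= dvdp_mulr.
Qed.

End Diagonalizable.

Section JordanChevalley.
Variable F : closedFieldType.

(** The multiplicative Jordan decomposition.  Diagonalizability replaces
    semisimplicity, to which it is equivalent here, because it is visibly
    compatible with powers and block sums. *)
Definition jordan_pair n (g s u : 'M[F]_n) : Prop :=
  [/\ diagable s, unipotent_mx u, s *m u = g & u *m s = g].

Let prod_dvd_exp (r : seq F) (Q : {poly F}) :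
  (forall a, a \in r -> 'X - a%:P %| Q) -> \prod_(a <- r) ('X - a%:P) %| Q ^+ size r.
Proof.
elim: r => [|a r IHr] rQ; first by rewrite big_nil dvd1p.
rewrite big_cons exprS dvdp_mul ?rQ ?mem_head // IHr // => b br.
by rewrite rQ // inE br orbT.
Qed.

(** With [P = a] modulo a high power of [X - a] for each eigenvalue [a], the
    semisimple factor is [P(g)]. *)
Lemma jordan_exists n (g : 'M[F]_n) : g \in unitmx ->
  exists s u, jordan_pair g s u /\ forall A, A *m g = g *m A -> A *m s = s *m A.
Proof.
case: n g => [|n] g ug.
  exists 1%:M, 1%:M; split; last by move=> A _; rewrite mulmx1 mul1mx.
  split; first exact: diagable_size0.
  - by exists 1%N; rewrite subrr expr1.
  - by rewrite [LHS]flatmx0 [RHS]flatmx0.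
  - by rewrite [LHS]flatmx0 [RHS]flatmx0.
have [r] := closed_field_poly_normal (char_poly g).
rewrite (monicP (char_poly_monic g)) scale1r => chi.
pose m := size r; pose rs := undup r; have urs : uniq rs by exact: undup_uniq.
have m_gt0 : (0 < m)%N.
  rewrite lt0n; apply/eqP => /size0nil r0; have := size_char_poly g.
  by rewrite chi r0 big_nil size_poly1.
have [P PP] := crt_polyC m urs; pose s := horner_mx g P.
pose Q : {poly F} := \prod_(a <- rs) ('X - a%:P).
have chiQ : char_poly g %| Q ^+ m.
  rewrite chi; apply: prod_dvd_exp => a ar.
  by rewrite /Q (big_rem a) ?mem_undup //= dvdp_mulr.
have hg0 p : Q ^+ m %| p -> horner_mx g p = 0.
  move=> Qp; have /dvdpP[q ->] := dvdp_trans chiQ Qp.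
  by rewrite rmorphM /= Cayley_Hamilton mulr0.
have ds : diagable s.
  apply: (diagable_root urs); rewrite rmorph_prod /=.
  transitivity (horner_mx g (\prod_(a <- rs) (P - a%:P))).
    rewrite rmorph_prod; apply: eq_bigr => a _.
    by rewrite !rmorphB /= horner_mx_X !horner_mx_C.
  apply: hg0; rewrite /Q -prodrXl big_seq [X in _ %| X]big_seq.
  by elim/big_ind2: _ => // p1 q1 p2 q2; exact: dvdp_mul.
have nil : nilpotent_mx (g - s).
  exists m; rewrite -[g in g - s]horner_mx_X -rmorphB -rmorphXn /=; apply: hg0.
  apply: dvdp_exp2r; rewrite /Q; apply: uniq_roots_dvdp; last by rewrite uniq_rootsE.
  apply/allP => a ars; have := PP a ars; rewrite -(prednK m_gt0) exprS.
  move/(dvdp_trans (dvdp_mulr _ (dvdpp _))); rewrite -root_factor_theorem => /rootP.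
  by rewrite !hornerE => Pa; apply/rootP; rewrite !hornerE -opprB Pa oppr0.
have comm A : A *m g = g *m A -> A *m s = s *m A.
  by move=> Ag; exact/esym/comm_horner_mx/esym.
have cs : g *m s = s *m g by exact: comm.
have us : s \in unitmx.
  have -> : s = g *m (invmx g *m s) by rewrite mulKVmx.
  rewrite unitmx_mul ug; apply: unipotent_unit.
  rewrite /unipotent_mx; have -> : invmx g *m s - 1%:M = - (g - s) *m invmx g.
    by rewrite opprB mulmxBl mulmxV // (mx_comm_inv (esym cs)).
  apply: nilpotent_comm; last exact: nilpotentN.
  by rewrite mulNmx mulmxN mulmxBl mulmxBr mulmxV // mulVmx // (mx_comm_inv (esym cs)).
exists s, (invmx s *m g); split=> //; split=> //.
- rewrite /unipotent_mx; have -> : invmx s *m g - 1%:M = (g - s) *m invmx s.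
    by rewrite mulmxBl mulmxV // (mx_comm_inv cs).
  apply: nilpotent_comm => //.
  by rewrite mulmxBl mulmxBr mulmxV // mulVmx // (mx_comm_inv cs).
- by rewrite mulKVmx.
- by rewrite -mulmxA cs mulKmx.
Qed.

Lemma diagable_comm_eq n (s t : 'M[F]_n) : diagable s -> diagable t ->
  s *m t = t *m s -> nilpotent_mx (s - t) -> s = t.
Proof.
move=> /diagable_diagonalizable ds /diagable_diagonalizable dt cst [k nil].
have [|P uP] := (codiagonalizableP [:: s; t]).1.
  split=> [A B|A]; rewrite !inE.
    by move=> /orP[]/eqP-> /orP[]/eqP->.
  by move=> /orP[]/eqP->.
case/and3P=> /diagonalizable_forPex[D /(simmxP uP) PD].
case/diagonalizable_forPex=> D' /(simmxP uP) PD' _.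
suff DD' : D = D'.
  by apply: (can_inj (mulKmx uP)); rewrite PD PD' DD'.
have PDD' : P *m (s - t) *m invmx P = diag_mx (D - D').
  by rewrite mulmxBr PD PD' -mulmxBl mulmxK // linearB.
have [h] := nilpotent_conj uP (ex_intro _ k nil).
rewrite PDD' diag_mxX => /matrixP nilD; apply/rowP => i; apply/eqP.
have := nilD i i; rewrite !mxE eqxx mulr1n => /eqP.
by rewrite expf_eq0 subr_eq0 => /andP[].
Qed.

(** Both decompositions are compared with the one of [jordan_exists], whose factors
    commute with everything that commutes with [g]. *)
Lemma jordan_unique n (g s u s' u' : 'M[F]_n) : g \in unitmx ->
  jordan_pair g s u -> jordan_pair g s' u' -> s = s' /\ u = u'.
Proof.
move=> ug; have [s0 [u0 [j0 comm]]] := jordan_exists ug.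
suff uniq0 t w : jordan_pair g t w -> t = s0 /\ w = u0.
  by move=> /uniq0[-> ->] /uniq0[-> ->].
case: j0 => ds0 nu0 su0 us0 [dt nw tw wt].
have us : s0 \in unitmx by move: ug; rewrite -su0 unitmx_mul => /andP[].
have cg : t *m g = g *m t by rewrite -[in LHS]wt mulmxA tw.
have cs : t *m s0 = s0 *m t by exact: comm.
have nil1 : nilpotent_mx (s0 - g).
  have -> : s0 - g = - (u0 - 1%:M) *m s0 by rewrite mulNmx mulmxBl mul1mx us0 opprB.
  apply: nilpotent_comm; last exact: nilpotentN.
  by rewrite mulNmx mulmxN mulmxBl mulmxBr su0 us0 mul1mx mulmx1.
have nil2 : nilpotent_mx (g - t).
  have -> : g - t = (w - 1%:M) *m t by rewrite mulmxBl mul1mx wt.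
  by apply: nilpotent_comm => //; rewrite mulmxBl mulmxBr tw wt mul1mx mulmx1.
have est : s0 = t.
  apply: diagable_comm_eq => //.
  rewrite -[s0 - t](subrKA g); apply: nilpotentD => //.
  have c0g : s0 *m g = g *m s0 by rewrite -[in LHS]us0 mulmxA su0.
  rewrite -[LHS]/((s0 - g) * (g - t)) -[RHS]/((g - t) * (s0 - g)).
  by apply: commrB; apply: commr_sym; apply: commrB.
split=> //; apply: (can_inj (mulKmx us)).
by rewrite su0 est tw.
Qed.

End JordanChevalley.

Section Eigenvectors.
Variable F : closedFieldType.

Lemma stable_eigenvector m n (V : 'M[F]_(m, n)) (h : 'M[F]_n) :
  stablemx V h -> V != 0 ->
  exists (x : 'rV[F]_n) a, [/\ x != 0, (x <= V)%MS & x *m h = a *: x].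
Proof.
move=> stV V0; pose B := conjmx (row_base V) h.
have rB : row_base V *m h = B *m row_base V.
  by apply: simmxPp; [rewrite stablemx_row_base | exact: eqxx].
have [a ra] : exists a, root (char_poly B) a.
  by apply/closed_rootP; rewrite size_char_poly eqSS mxrank_eq0.
have : eigenvalue B a by rewrite eigenvalue_root_char.
case/eigenvalueP=> v vB v0; exists (v *m row_base V), a; split.
- apply: contra_neq v0 => v0; apply: (row_free_inj (row_base_free V)).
  by rewrite /= mul0mx.
- by rewrite -(eq_row_base V) submxMl.
- by rewrite -mulmxA rB mulmxA vB scalemxAl.
Qed.

(** A complement of the sum of the eigenspaces contains no eigenvector. *)
Lemma semisimple_diagable n (g : 'M[F]_n) : semisimple_mx g -> diagable g.
Proof.
move=> ssg; rewrite -[g]trmxK; apply: diagable_tr; apply/diagable_diagonalizable.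
apply/diagonalizablePeigen; set h := g^T.
have [r] := closed_field_poly_normal (char_poly h).
rewrite (monicP (char_poly_monic h)) scale1r => chi.
exists (undup r); first exact: undup_uniq.
set U := (\sum_(a <- _) _)%MS.
have eigU a : (eigenspace h a <= U)%MS.
  have [ar|nar] := boolP (a \in r).
    by rewrite /U (big_rem a) ?mem_undup //= addsmxSl.
  suff -> : eigenspace h a = 0 by rewrite sub0mx.
  apply/eqP; apply: contraNT nar.
  by rewrite -[_ != 0]/(eigenvalue h a) eigenvalue_root_char chi root_prod_XsubC.
have stU : stablemx U h.
  rewrite /U; elim/big_ind: _ => [|A B sA sB|a _].
  - by rewrite stable0mx.
  - exact: stableDmx.
  - exact: comm_mx_stable_eigenspace.
have [V [stV UV0 fUV]] := ssg U stU.
have V0 : V = 0.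
  apply/eqP/negPn/negP => /(stable_eigenvector stV)[x [a [x0 xV xh]]].
  case/negP: x0; rewrite -submx0 -UV0 sub_capmx xV andbT.
  by apply: submx_trans (eigU a); apply/eigenspaceP.
apply/eqmxP; rewrite submx1 sub1mx.
by move: fUV; rewrite V0 /row_full addsmx0.
Qed.

End Eigenvectors.

Section AdjointProjection.
Variable F : fieldType.

(** The map [T |-> B T A^-1] is diagonalizable with eigenvalues the ratios
    [beta / alpha]; a polynomial in it projects onto the eigenvalue 1. *)
Lemma ad_projection n1 n2 (A : 'M[F]_n1) (B : 'M[F]_n2) :
  A \in unitmx -> diagable A -> diagable B ->
  exists Q : {poly F}, Q.[1] = 1 /\ forall T : 'M[F]_(n2, n1),
    let T' := \sum_(k < size Q) Q`_k *: (B ^+ k *m T *m invmx A ^+ k) in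
    B *m T' = T' *m A.
Proof.
move=> uA [X [al [uX XA]]] [Y [be [uY YB]]].
have uD : diag_mx al \in unitmx.
  by rewrite -[diag_mx al](mulmxK uX) -XA !unitmx_mul uX uA unitmx_inv.
have al0 i : al 0 i != 0.
  by move: uD; rewrite unitmxE det_diag unitfE => /prodf_neq0 ->.
pose gam := undup [seq be 0 ji.1 / al 0 ji.2 | ji <- enum {: 'I_n2 * 'I_n1}].
pose Q := \prod_(c <- gam | c != 1) ((1 - c)^-1 *: ('X - c%:P)).
have Q1 : Q.[1] = 1.
  rewrite horner_prod big1 // => c c1.
  by rewrite !hornerE mulVf // subr_eq0 eq_sym.
have Qg j i : Q.[be 0 j / al 0 i] * (be 0 j - al 0 i) = 0.
  set c := be 0 j / al 0 i.
  have cgam : c \in gam by rewrite mem_undup; apply/mapP; exists (j, i); rewrite ?mem_enum.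
  have [c1|c1] := eqVneq c 1.
    apply/eqP; rewrite mulf_eq0 subr_eq0 orbC; apply/orP; left; apply/eqP.
    by rewrite -[LHS](mulfVK (al0 i)) -/c c1 mul1r.
  rewrite /Q (big_rem c) //= c1 hornerM !hornerE subrr.
  by rewrite !(mulr0, mul0r).
exists Q; split=> // T T'; pose T0 := Y *m T *m invmx X.
have YBk k := intertwineX k YB.
have AX : invmx A *m invmx X = invmx X *m diag_mx (\row_i (al 0 i)^-1).
  apply: (can_inj (mulKmx uX)); rewrite mulKVmx // mulmxA.
  have -> : X *m invmx A = invmx (diag_mx al) *m X.
    by apply: (can_inj (mulKmx uD)); rewrite mulKVmx // mulmxA -XA mulmxK.
  rewrite mulmxK //; apply: (can_inj (mulKmx uD)).
  rewrite mulmxV // mulmx_diag -diag_const_mx; congr diag_mx.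
  by apply/rowP => i; rewrite !mxE divff.
have AXk k := esym (intertwineX k (esym AX)).
have T'E : Y *m T' *m invmx X = \matrix_(j, i) (T0 j i * Q.[be 0 j / al 0 i]).
  rewrite /T' mulmx_sumr mulmx_suml; apply/matrixP => j i.
  rewrite summxE mxE horner_coef mulr_sumr; apply: eq_bigr => k _.
  rewrite -scalemxAr -scalemxAl mxE -!mulmxA AXk !mulmxA YBk.
  rewrite -!mulmxA [T *m _]mulmxA [Y *m _]mulmxA -/T0 [Y *m (_ *m _)]mulmxA -/T0.
  rewrite !diag_mxX mul_diag_mx mul_mx_diag !mxE exprMn exprVn.
  by rewrite [RHS]mulrCA; congr (_ * _); rewrite mulrCA.
have uX' : invmx X \in unitmx by rewrite unitmx_inv.
apply: (can_inj (mulKmx uY)); apply: (can_inj (mulmxK uX')).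
rewrite !mulmxA YB -!mulmxA.
have -> : A *m invmx X = invmx X *m diag_mx al.
  by rewrite -[LHS](mulKmx uX) [X *m _]mulmxA XA mulmxK.
rewrite [Y *m (T' *m _)]mulmxA [T' *m (_ *m _)]mulmxA [Y *m (_ *m _)]mulmxA.
rewrite [Y *m (T' *m _)]mulmxA T'E mul_diag_mx mul_mx_diag.
apply/matrixP => j i; rewrite !mxE; apply/eqP; rewrite -subr_eq0 mulrC -mulrBr.
by rewrite -mulrA Qg mulr0.
Qed.

End AdjointProjection.

Section Semisimple.
Variable F : fieldType.

Lemma invmxX n (A : 'M[F]_n) k : A \in unitmx ->
  invmx A ^+ k = invmx (A ^+ k).
Proof.
move=> uA; have uAk := unitX_mx k uA; apply: (can_inj (mulKmx uAk)).
rewrite mulmxV //; elim: k {uAk} => [|k IHk]; first by rewrite !expr0 mulmx1.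
by rewrite exprSr exprS -!mulmxE -mulmxA [A *m (_ *m _)]mulmxA mulmxV // mul1mx.
Qed.

Lemma stablemx_inv n (U h : 'M[F]_n) : h \in unitmx -> stablemx U h -> stablemx U (invmx h).
Proof.
move=> uh sU; have /eqmxP eU : (U *m h == U)%MS.
  by rewrite -(geq_leqif (mxrank_leqif_eq sU)) mxrankMfree // row_free_unit.
by rewrite -(eqmxMr (invmx h) eU) mulmxK.
Qed.

Lemma stablemxX n (U h : 'M[F]_n) k : stablemx U h -> stablemx U (h ^+ k).
Proof.
move=> sU; elim: k => [|k IHk]; first by rewrite expr0 mulmx1.
by rewrite exprS -mulmxE; exact: stablemxM.
Qed.

(** A linear projection onto a stable subspace is made to commute with [g] by
    [ad_projection]; its kernel is the complement. *)
Lemma diagable_semisimple n (g : 'M[F]_n) : g \in unitmx -> diagable g ->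
  semisimple_mx g.
Proof.
move=> ug dg U sU; set h := g^T; have uh : h \in unitmx by rewrite unitmx_tr.
have [Q [Q1 QP]] := ad_projection uh (diagable_tr dg) (diagable_tr dg).
have [p [pU idU]] : exists p : 'M_n, (forall m (x : 'M_(m, n)), (x *m p <= U)%MS) /\
    (forall m (x : 'M_(m, n)), (x <= U)%MS -> x *m p = x).
  exists (proj_mx <<U>>%MS (<<U>>^C)%MS); split=> m x.
    by apply: submx_trans (proj_mx_sub _ _ _) _; rewrite genmxE.
  by move=> xU; apply: proj_mx_id; rewrite ?capmx_compl ?genmxE.
pose p' := \sum_(k < size Q) Q`_k *: (h ^+ k *m p *m invmx h ^+ k).
have p'U m (x : 'M_(m, n)) : (x *m p' <= U)%MS.
  rewrite mulmx_sumr; apply: summx_sub => k _; rewrite -scalemxAr scalemx_sub //.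
  rewrite !mulmxA; apply: submx_trans (submxMr _ (pU _ _)) _.
  exact: stablemxX (stablemx_inv uh sU).
have p'id m (x : 'M_(m, n)) : (x <= U)%MS -> x *m p' = x.
  move=> xU; rewrite mulmx_sumr -[RHS]scale1r -Q1 horner_coef scaler_suml.
  apply: eq_bigr => k _; rewrite -scalemxAr expr1n mulr1 !mulmxA idU; last first.
    exact: submx_trans (submxMr _ xU) (stablemxX k sU).
  by rewrite invmxX // mulmxK // unitX_mx.
have p'p' : p' *m p' = p' by apply: p'id; rewrite -[X in (X <= _)%MS]mul1mx.
exists (1%:M - p'); split.
- apply: comm_mx_stable; rewrite /comm_mx mulmxBl mulmxBr mul1mx mulmx1.
  by congr (_ - _); rewrite [RHS](QP p).
- apply/eqP; rewrite -submx0; apply/rV_subP => x; rewrite sub_capmx.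
  case/andP=> xU /submxP[y xy]; rewrite submx0 -(p'id _ _ xU) xy.
  by rewrite -mulmxA mulmxBl mul1mx p'p' subrr mulmx0.
- rewrite -sub1mx -[X in (X <= _)%MS](subrK p') addrC; apply: addmx_sub_adds => //.
  by rewrite -[X in (X <= _)%MS]mul1mx.
Qed.

End Semisimple.

Section UnipotentPart.
Variable F : closedFieldType.

Lemma jordan_semisimple n (g s u : 'M[F]_n) : g \in unitmx ->
  jordan_pair g s u -> s \in unitmx /\ semisimple_mx s.
Proof.
move=> ug [ds _ su _]; have us : s \in unitmx.
  by move: ug; rewrite -su unitmx_mul => /andP[].
by split=> //; exact: diagable_semisimple.
Qed.

Lemma unipotent_partP n (g : 'M[F]_n) : g \in unitmx ->
  exists s, jordan_pair g s (unipotent_part g).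
Proof.
move=> ug; rewrite /unipotent_part; case: xgetP => [u -> [nu [s [ss su us]]]|no].
  by exists s; split=> //; exact: semisimple_diagable.
have [s [u [jsu _]]] := jordan_exists ug; have [_ ss] := jordan_semisimple ug jsu.
case: jsu => _ nu su us; case: (no u); split=> //.
by exists s.
Qed.

Lemma jordan_comm n (g s u A : 'M[F]_n) : g \in unitmx -> jordan_pair g s u ->
  A *m g = g *m A -> A *m s = s *m A /\ A *m u = u *m A.
Proof.
move=> ug jsu Ag; have [s' [u' [jsu' comm]]] := jordan_exists ug.
have [es eu] := jordan_unique ug jsu jsu'; subst s' u'.
have As := comm _ Ag; split=> //.
have [us _] := jordan_semisimple ug jsu; case: jsu => _ _ su us'.
apply: (can_inj (mulKmx us)).
by rewrite !mulmxA su -As -mulmxA su.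
Qed.

Lemma block_diag_unit n1 n2 (A : 'M[F]_n1) (B : 'M[F]_n2) :
  A \in unitmx -> B \in unitmx -> block_mx A 0 0 B \in unitmx.
Proof. by move=> uA uB; rewrite unitmxE det_ublock unitrM -!unitmxE uA. Qed.

Lemma diagable_block n1 n2 (A : 'M[F]_n1) (B : 'M[F]_n2) :
  diagable A -> diagable B -> diagable (block_mx A 0 0 B).
Proof.
move=> [P [D [uP PA]]] [P' [D' [uP' PB]]].
exists (block_mx P 0 0 P'), (row_mx D D'); split; first exact: block_diag_unit.
by rewrite diag_mx_row !mulmx_block !(mul0mx, mulmx0, addr0, add0r) PA PB.
Qed.

Lemma block_diagX n1 n2 (A : 'M[F]_n1) (B : 'M[F]_n2) k :
  block_mx A 0 0 B ^+ k = block_mx (A ^+ k) 0 0 (B ^+ k).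
Proof.
elim: k => [|k IHk]; first by rewrite !expr0 -[1]/(1%:M) (scalar_mx_block _ _ 1).
by rewrite !exprS IHk -!mulmxE mulmx_block !(mul0mx, mulmx0, addr0, add0r).
Qed.

Lemma jordan_block n1 n2 (g s u : 'M[F]_n1) (g' s' u' : 'M[F]_n2) :
  jordan_pair g s u -> jordan_pair g' s' u' ->
  jordan_pair (block_mx g 0 0 g') (block_mx s 0 0 s') (block_mx u 0 0 u').
Proof.
move=> [ds nu su us] [ds' nu' su' us']; split.
- exact: diagable_block.
- rewrite /unipotent_mx; have -> : block_mx u 0 0 u' - 1%:M = block_mx (u - 1%:M) 0 0 (u' - 1%:M).
    by rewrite scalar_mx_block opp_block_mx add_block_mx !oppr0 !addr0.
  case: nu nu' => k nu [k' nu']; exists (k + k')%N.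
  rewrite block_diagX exprD nu mul0r exprD nu' mulr0.
  by apply/matrixP => i j; rewrite !mxE; case: split => ?; rewrite !mxE; case: split => ?; rewrite !mxE.
- by rewrite mulmx_block !(mul0mx, mulmx0, addr0, add0r) su su'.
- by rewrite mulmx_block !(mul0mx, mulmx0, addr0, add0r) us us'.
Qed.

(** The off-diagonal block [A] commutes with the block sum of [g] and [g']. *)
Lemma jordan_intertwine n1 n2 (g s u : 'M[F]_n1) (g' s' u' : 'M[F]_n2)
    (A : 'M[F]_(n2, n1)) :
  g \in unitmx -> g' \in unitmx -> jordan_pair g s u -> jordan_pair g' s' u' ->
  A *m g = g' *m A -> A *m s = s' *m A /\ A *m u = u' *m A.
Proof.
move=> ug ug' jg jg' Ag; have jb := jordan_block jg jg'.
have ub := block_diag_unit ug ug'.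
have /(jordan_comm ub jb)[] : block_mx 0 0 A 0 *m block_mx g 0 0 g' =
    block_mx g 0 0 g' *m block_mx 0 0 A 0.
  by rewrite !mulmx_block !(mul0mx, mulmx0, addr0, add0r) Ag.
rewrite !mulmx_block !(mul0mx, mulmx0, addr0, add0r).
by move=> /eq_block_mx[_ _ -> _] /eq_block_mx[_ _ -> _].
Qed.

Lemma jordanZ n (g s u : 'M[F]_n) c : c != 0 -> jordan_pair g s u ->
  jordan_pair (c *: g) (c *: s) u.
Proof.
move=> c0 [[P [D [uP PD]]] nu su us]; split=> //.
- by exists P, (c *: D); rewrite -scalemxAr PD scalemxAl -linearZ.
- by rewrite -scalemxAl su.
- by rewrite -scalemxAr us.
Qed.

Lemma diagableX n (s : 'M[F]_n) k : diagable s -> diagable (s ^+ k).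
Proof.
case=> P [D [uP PD]]; exists P, (\row_i D 0 i ^+ k); split=> //.
by rewrite -diag_mxX; exact: intertwineX.
Qed.

Lemma unipotentM n (u u' : 'M[F]_n) : u *m u' = u' *m u ->
  unipotent_mx u -> unipotent_mx u' -> unipotent_mx (u *m u').
Proof.
move=> cu nu nu'; have uu' := unipotent_unit nu'.
rewrite /unipotent_mx.
have -> : u *m u' - 1%:M = (u - 1%:M) *m u' + (u' - 1%:M).
  by rewrite mulmxBl mul1mx addrA subrK.
have c1 : (u - 1%:M) *m u' = u' *m (u - 1%:M).
  by rewrite mulmxBl mulmxBr mul1mx mulmx1 cu.
apply: nilpotentD => //; last exact: nilpotent_comm.
move: (u - 1%:M) c1 => w c1; rewrite mulmxBr mulmxBl mul1mx mulmx1.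
by rewrite [u' *m (w *m _)]mulmxA -c1.
Qed.

Lemma unipotentX n (u : 'M[F]_n) k : unipotent_mx u -> unipotent_mx (u ^+ k).
Proof.
move=> nu; elim: k => [|k IHk].
  by exists 1%N; rewrite expr0 subrr expr1.
by rewrite exprS -mulmxE; apply: unipotentM => //; rewrite mulmxE -exprS exprSr.
Qed.

Lemma unipotentV n (u : 'M[F]_n) : unipotent_mx u -> unipotent_mx (invmx u).
Proof.
move=> nu; have uu := unipotent_unit nu; rewrite /unipotent_mx.
have -> : invmx u - 1%:M = - (u - 1%:M) *m invmx u.
  by rewrite mulNmx mulmxBl mulmxV // mul1mx opprB.
apply: nilpotent_comm; last exact: nilpotentN.
by rewrite mulNmx mulmxN mulmxBl mulmxBr mulmxV // mulVmx // mulmx1 mul1mx.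
Qed.

Lemma jordanX n (g s u : 'M[F]_n) k : jordan_pair g s u ->
  jordan_pair (g ^+ k) (s ^+ k) (u ^+ k).
Proof.
move=> [ds nu su us]; have csu : s * u = u * s by rewrite -mulmxE su us.
split; [exact: diagableX | exact: unipotentX | |].
- by rewrite mulmxE -exprMn_comm // -mulmxE su.
- by rewrite mulmxE -exprMn_comm // -mulmxE us.
Qed.

End UnipotentPart.

Section UnipotentRoot.
Variable F : closedFieldType.
Hypothesis F0 : [pchar F] =i pred0.

(** Hensel's lemma: [X] is a polynomial in [X^M] modulo each power of [X - 1], as the
    derivative [M] of [X^M] at 1 is invertible. *)
Lemma poly_root_powers M k : (0 < M)%N ->
  exists p : {poly F}, ('X - 1) ^+ k %| 'X - (p \Po 'X^M).
Proof.
move=> M_gt0; elim: k => [|k [p /dvdpP[g def_g]]].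
  by exists 0; rewrite expr0 dvd1p.
have /factor_theorem[h def_h] : root ('X^M - 1 : {poly F}) 1.
  by rewrite rootE !hornerE expr1n subrr.
have h1 : h.[1] = M%:R.
  have := congr1 (fun q : {poly F} => q^`().[1]) def_h.
  rewrite derivB derivXn derivC derivM derivXsubC !hornerE subrr mulr0 add0r.
  by rewrite subr0 hornerMn hornerXn expr1n => <-.
exists (p + (g.[1] / M%:R ^+ k) *: ('X - 1) ^+ k).
rewrite comp_polyD comp_polyZ rmorphXn /= comp_polyB comp_polyX comp_polyC.
rewrite opprD addrA def_g def_h exprMn -mul_polyC mulrA -mulrBl exprS.
rewrite dvdp_mul // -[1 in X in X %| _]/(1%:P) dvdp_XsubCl rootE !hornerE h1 divfK ?subrr //.
by rewrite expf_neq0 // ((pcharf0P F).1 F0) -lt0n.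
Qed.

(** A unipotent matrix is a polynomial in each of its powers. *)
Lemma unipotent_comm_root n (u A : 'M[F]_n) M : (0 < M)%N -> unipotent_mx u ->
  A *m u ^+ M = u ^+ M *m A -> A *m u = u *m A.
Proof.
case: n u A => [|n] u A M_gt0 nu cA; first by rewrite [LHS]flatmx0 [RHS]flatmx0.
have [p /dvdpP[q def_q]] := poly_root_powers n.+1 M_gt0.
have : horner_mx u ('X - (p \Po 'X^M)) = 0.
  rewrite def_q rmorphM rmorphXn rmorphB /= horner_mx_X rmorph1.
  by rewrite (nilpotentXn nu) mulr0.
rewrite rmorphB /= horner_mx_X => /eqP; rewrite subr_eq0 => /eqP->.
rewrite comp_polyE rmorph_sum /= mulmx_sumr mulmx_suml; apply: eq_bigr => i _.
rewrite horner_mxZ -exprM rmorphXn /= horner_mx_X -scalemxAr -scalemxAl exprM.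
by congr (_ *: _); rewrite !mulmxE; apply: commrX; rewrite /GRing.comm -!mulmxE.
Qed.

Lemma diagable_finite_order n (s : 'M[F]_n) M c : (0 < M)%N -> c != 0 ->
  s ^+ M = c%:M -> diagable s.
Proof.
case: n s => [|n] s M_gt0 c0 sM; first exact: diagable_size0.
have [r] := closed_field_poly_normal ('X^M - c%:P : {poly F}).
have mon : 'X^M - c%:P \is @monic F by rewrite monicXnsubC.
rewrite (monicP mon) scale1r => def_r.
apply: (@diagable_root _ _ _ r); last first.
  by rewrite -def_r rmorphB rmorphXn /= horner_mx_X horner_mx_C sM subrr.
rewrite -separable_prod_XsubC -def_r unlock.
apply/Bezout_eq1_coprimepP; exists (- c^-1%:P, (c^-1 / M%:R) *: 'X) => /=.
have M0 : M%:R != 0 :> F by rewrite ((pcharf0P F).1 F0) -lt0n.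
have MM : M%:R^-1%:P * M%:R = 1 :> {poly F}.
  by rewrite -polyC_natr -polyCM mulVf.
have cc : c^-1%:P * c%:P = 1 :> {poly F} by rewrite -polyCM mulVf.
rewrite derivB derivXn derivC subr0 -['X^_ *+ M]mulr_natr -mul_polyC rmorphM /=.
have -> : 'X^M = 'X * 'X^(M.-1) :> {poly F} by rewrite -exprS prednK.
transitivity ((c^-1%:P * c%:P
    + c^-1%:P * ('X * 'X^(M.-1)) * (M%:R^-1%:P * M%:R - 1))%R : {poly F}).
  by ring.
by rewrite MM cc subrr mulr0 addr0.
Qed.

End UnipotentRoot.

(** * Averaging over representations with finite inertia *)

(** The group is generated by the element [phi] and the normal subgroup [I];
    generation is stated as an induction principle. *)
Record frobenius_generated (G : groupType) (I : G -> Prop) (phi : G) : Prop := {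
  frob_in1 : I 1%g;
  frob_inM : forall s t, I s -> I t -> I (s * t)%g;
  frob_inV : forall s, I s -> I s^-1%g;
  frob_inJ : forall s i, I i -> I (s * i * s^-1)%g;
  frob_ind : forall P : G -> Prop, P phi -> (forall i, I i -> P i) ->
    (forall s t, P s -> P t -> P (s * t)%g) -> (forall s, P s -> P s^-1%g) ->
    forall s, P s }.

Section Reps.
Variables (G : groupType) (F : fieldType).

Lemma rep_inv n (r : G -> 'M[F]_n) s : is_rep r -> r s *m r s^-1%g = 1%:M.
Proof. by case=> r1 rM; rewrite -rM mulgV. Qed.

Lemma rep_invV n (r : G -> 'M[F]_n) s : is_rep r -> r s^-1%g *m r s = 1%:M.
Proof. by case=> r1 rM; rewrite -rM mulVg. Qed.

Lemma rep_unit n (r : G -> 'M[F]_n) s : is_rep r -> r s \in unitmx.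
Proof. by move=> rr; case/mulmx1_unit: (rep_inv s rr). Qed.

Lemma repV n (r : G -> 'M[F]_n) s : is_rep r -> r s^-1%g = invmx (r s).
Proof.
move=> rr; apply: (can_inj (mulKmx (rep_unit s rr))).
by rewrite rep_inv // mulmxV // rep_unit.
Qed.

Lemma repX n (r : G -> 'M[F]_n) s k : is_rep r -> r (s ^+ k)%g = r s ^+ k.
Proof.
move=> [r1 rM]; elim: k => [|k IHk]; first by rewrite expg0 r1 expr0.
by rewrite expgS rM IHk exprS.
Qed.

Definition dsum n1 n2 (r1 : G -> 'M[F]_n1) (r2 : G -> 'M[F]_n2) s : 'M_(n1 + n2) :=
  block_mx (r1 s) 0 0 (r2 s).

Lemma dsum_rep n1 n2 (r1 : G -> 'M[F]_n1) (r2 : G -> 'M[F]_n2) :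
  is_rep r1 -> is_rep r2 -> is_rep (dsum r1 r2).
Proof.
move=> [r11 r1M] [r21 r2M]; split; first by rewrite /dsum r11 r21 -scalar_mx_block.
move=> s t; rewrite /dsum mulmx_block r1M r2M.
by rewrite !(mulmx0, mul0mx, addr0, add0r).
Qed.

Lemma mul_deltaE m n p k (A : 'M[F]_(m, n)) (B : 'M_(p, k)) i b a j :
  (A *m delta_mx b a *m B) i j = A i b * B a j.
Proof.
rewrite !mxE (bigD1 a) //= big1 ?addr0 => [|c ca].
  rewrite !mxE (bigD1 b) //= big1 ?addr0 => [|d db]; last first.
    by rewrite !mxE (negPf db) mulr0.
  by rewrite !mxE !eqxx mulr1.
rewrite !mxE big1 ?mul0r // => d _.
by rewrite !mxE (negPf ca) andbF mulr0.
Qed.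

Lemma trace_vec_op n (Phi : 'M[F]_(n * n)) :
  \tr Phi = \sum_a \sum_b (vec_mx (mxvec (delta_mx a b) *m Phi)) a b.
Proof.
rewrite pair_big /= /mxtrace (reindex _ (curry_mxvec_bij n n)) /=.
by apply: eq_bigr => -[a b] _ /=; rewrite mxE mxvec_delta -rowE !mxE.
Qed.

End Reps.

Lemma finite_transversal (G : groupType) (I : G -> Prop) (phi : G) (F : fieldType) n
    (r : G -> 'M[F]_n) : frobenius_generated I phi -> is_rep r ->
  (exists e : seq 'M[F]_n, forall s, I s -> r s \in e) ->
  exists L : seq G, [/\ (0 < size L)%N, forall h, h \in L -> I h &
    forall i, I i -> perm_eq [seq r i *m r h | h <- L] [seq r h | h <- L]].
Proof.
move=> genG rr [e re]; pose im h := `[< exists2 i, I i & r i = h >].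
pose H := undup [seq h <- e | im h].
have HP h : h \in H <-> exists2 i, I i & r i = h.
  rewrite mem_undup mem_filter; split=> [/andP[/asboolP]//|ih].
  by case: (ih) => i Ii ri; rewrite -ri re // andbT; apply/asboolP; exists i.
have /choice[g gP] : forall h, exists i, h \in H -> I i /\ r i = h.
  move=> h; have [/HP[i Ii ri]|nh] := boolP (h \in H); first by exists i.
  by exists 1%g.
have H1 : 1%:M \in H by apply/HP; exists 1%g; [exact: frob_in1 genG | case: rr].
exists [seq g h | h <- H]; split; first by rewrite size_map; case: H H1 {HP gP}.
  by move=> _ /mapP[h /gP[Ih _] ->].
move=> i Ii; rewrite -!map_comp.
have -> : [seq ([eta r] \o g) h | h <- H] = H.
  by rewrite -[RHS]map_id; apply/eq_in_map => h /gP[].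
have -> : [seq ((fun h => r i *m r h) \o g) h | h <- H] = [seq r i *m h | h <- H].
  by apply/eq_in_map => h /gP[_ rh] /=; rewrite rh.
have uH : uniq H by exact: undup_uniq.
have u2 : uniq [seq r i *m h | h <- H].
  by rewrite map_inj_uniq //; exact: can_inj (mulKmx (rep_unit i rr)).
have sub : {subset [seq r i *m h | h <- H] <= H}.
  move=> _ /mapP[h /HP[j Ij <-] ->]; apply/HP; exists (i * j)%g.
    exact: (frob_inM genG).
  by case: rr.
have [_ eqH] := uniq_min_size u2 sub (eq_leq (esym (size_map _ _))).
by apply: uniq_perm.
Qed.

Section Averaging.
Variables (G : groupType) (I : G -> Prop) (phi : G) (F : closedFieldType).
Hypothesis genG : frobenius_generated I phi.
Hypothesis F0 : [pchar F] =i pred0.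

Definition good_rep n (r : G -> 'M[F]_n) : Prop :=
  [/\ is_rep r, exists e : seq 'M[F]_n, forall s, I s -> r s \in e
    & diagable (r phi)].

Definition inter n1 n2 (r1 : G -> 'M[F]_n1) (r2 : G -> 'M[F]_n2) (T : 'M_(n2, n1)) :=
  forall s, r2 s *m T = T *m r1 s.

Lemma inter_gen n1 n2 (r1 : G -> 'M[F]_n1) (r2 : G -> 'M[F]_n2) T :
  is_rep r1 -> is_rep r2 -> r2 phi *m T = T *m r1 phi ->
  (forall i, I i -> r2 i *m T = T *m r1 i) -> inter r1 r2 T.
Proof.
move=> R1 R2 Tphi TI; apply: (frob_ind genG) => // [s t sT tT|s sT].
  by case: R1 R2 => _ -> [_ ->]; rewrite -mulmxA tT mulmxA sT mulmxA.
rewrite !repV //; apply: (can_inj (mulKmx (rep_unit s R2))).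
rewrite mulKVmx ?rep_unit // mulmxA sT mulmxK ?rep_unit //.
Qed.

Definition avg (L : seq (F * G)) n1 n2 (r1 : G -> 'M[F]_n1) (r2 : G -> 'M[F]_n2)
    (T : 'M_(n2, n1)) : 'M_(n2, n1) :=
  \sum_(x <- L) x.1 *: (r2 x.2 *m T *m r1 x.2^-1%g).

(** The inertia acts through a finite group, over which one averages; the result
    is then projected onto the commutant of [r phi] by a polynomial in the
    adjoint action of [r phi], which preserves the commutant of the inertia. *)
Lemma reynolds n (r : G -> 'M[F]_n) : good_rep r ->
  exists L : seq (F * G), \sum_(x <- L) x.1 = 1 /\ forall T, inter r r (avg L r r T).
Proof.
move=> [rr fr dr]; have [H [H0 _ perm_H]] := finite_transversal genG rr fr.
have sH : (size H)%:R != 0 :> F by rewrite ((pcharf0P F).1 F0) -lt0n.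
pose LI : seq (F * G) := [seq ((size H)%:R^-1, h) | h <- H].
have LI1 : \sum_(x <- LI) x.1 = 1.
  by rewrite big_map /= big_const_seq count_predT iter_addr_0 -[LHS]mulr_natr mulVf.
have LIE T : avg LI r r T =
    \sum_(h <- [seq r h | h <- H]) (size H)%:R^-1 *: (h *m T *m invmx h).
  by rewrite /avg !big_map; apply: eq_bigr => h _ /=; rewrite repV.
have AI T i : I i -> r i *m avg LI r r T *m r i^-1%g = avg LI r r T.
  move=> Ii; rewrite LIE mulmx_sumr mulmx_suml -[RHS](perm_big _ (perm_H i Ii)).
  rewrite !big_map; apply: eq_bigr => h _.
  rewrite -scalemxAr -scalemxAl; congr (_ *: _).
  by case: (rr) => _ rM; rewrite -rM -!repV // invgM !rM !mulmxA.
have [Q [Q1 QP]] := ad_projection (rep_unit phi rr) dr dr.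
pose L : seq (F * G) :=
  [seq (Q`_k * x.1, (phi ^+ k * x.2)%g) | k <- iota 0 (size Q), x <- LI].
have LE T : avg L r r T = \sum_(k < size Q)
    Q`_k *: (r phi ^+ k *m avg LI r r T *m invmx (r phi) ^+ k).
  rewrite /avg big_allpairs_dep /= -[RHS](big_mkord xpredT (fun k =>
    Q`_k *: (r phi ^+ k *m avg LI r r T *m invmx (r phi) ^+ k))).
  rewrite /index_iota subn0; apply: eq_bigr => k _.
  rewrite /avg mulmx_sumr mulmx_suml scaler_sumr; apply: eq_bigr => x _ /=.
  rewrite -scalemxAr -scalemxAl scalerA invgM; case: (rr) => _ rM.
  by rewrite !rM !repV // repX // invmxX ?rep_unit // !mulmxA.
exists L; split.
  rewrite big_allpairs_dep /= -[RHS]Q1 horner_coef -[RHS](big_mkord xpredT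
    (fun k => Q`_k * 1 ^+ k)) /index_iota subn0; apply: eq_bigr => k _.
  by rewrite -mulr_sumr LI1 expr1n.
move=> T; apply: inter_gen => // [|i Ii]; first by rewrite LE QP.
apply: (can_inj (mulmxK (rep_unit i^-1%g rr))).
rewrite -[RHS]mulmxA rep_inv // mulmx1 LE mulmx_sumr mulmx_suml.
apply: eq_bigr => k _; rewrite -scalemxAr -scalemxAl; congr (_ *: _).
rewrite -repX // invmxX ?rep_unit // -repX // -repV // !mulmxA.
pose j := ((phi ^+ k)^-1 * i * (phi ^+ k)^-1^-1)%g.
have Ij : I j by exact: (frob_inJ genG).
have ijl : r i *m r (phi ^+ k)%g = r (phi ^+ k)%g *m r j.
  by case: (rr) => _ rM; rewrite -!rM /j invgK !mulgA mulgV mul1g.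
have ijr : r (phi ^+ k)^-1%g *m r i^-1%g = r j^-1%g *m r (phi ^+ k)^-1%g.
  by case: (rr) => _ rM; rewrite -!rM /j !invgM !invgK !mulgA mulgK.
by rewrite ijl -[LHS]mulmxA ijr -[in RHS](AI T j Ij) !mulmxA.
Qed.

End Averaging.

(** * Equivalent idempotents of commutants *)

Section BrauerNesbitt.
Variables (G : groupType) (I : G -> Prop) (phi : G) (F : closedFieldType).
Hypothesis genG : frobenius_generated I phi.
Hypothesis F0 : [pchar F] =i pred0.

Local Notation good := (good_rep I phi).

Lemma good_dsum n1 n2 (r1 : G -> 'M[F]_n1) (r2 : G -> 'M[F]_n2) :
  good r1 -> good r2 -> good (dsum r1 r2).
Proof.
move=> [R1 [e1 H1] d1] [R2 [e2 H2] d2]; split.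
- exact: dsum_rep.
- exists [seq block_mx x 0 0 y | x <- e1, y <- e2] => s Is.
  by apply: allpairs_f; [exact: H1 | exact: H2].
- exact: diagable_block.
Qed.

(** One weighted list of group elements serves all four pairs of source and
    target; this is what allows traces on different representations to be
    compared. *)
Lemma reynolds2 n1 n2 (r1 : G -> 'M[F]_n1) (r2 : G -> 'M[F]_n2) :
  good r1 -> good r2 -> exists L : seq (F * G),
  [/\ \sum_(x <- L) x.1 = 1, forall T, inter r1 r1 (avg L r1 r1 T),
      forall T, inter r1 r2 (avg L r1 r2 T) & forall T, inter r2 r1 (avg L r2 r1 T)].
Proof.
move=> g1 g2; have [L [L1 LP]] := reynolds genG F0 (good_dsum g1 g2).
have avgE A B C D : avg L (dsum r1 r2) (dsum r1 r2) (block_mx A B C D) =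
  block_mx (avg L r1 r1 A) (avg L r2 r1 B) (avg L r1 r2 C) (avg L r2 r2 D).
  rewrite /avg; elim: L {L1 LP} => [|x L IHL]; first by rewrite !big_nil block_mx_const.
  rewrite !big_cons IHL /dsum !mulmx_block !(mulmx0, mul0mx, addr0, add0r).
  by rewrite scale_block_mx add_block_mx.
have av0 (f1 f2 : nat) (g1' : G -> 'M[F]_f1) (g2' : G -> 'M[F]_f2) : avg L g1' g2' 0 = 0.
  by rewrite /avg big1 // => x _; rewrite mulmx0 mul0mx scaler0.
exists L; split=> // T s;
  [have := LP (block_mx T 0 0 0) s | have := LP (block_mx 0 0 T 0) s
    | have := LP (block_mx 0 T 0 0) s];
  rewrite avgE /dsum !mulmx_block !av0 !(mulmx0, mul0mx, addr0, add0r);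
  by case/eq_block_mx.
Qed.

Lemma inter_comp n1 n2 n3 (r1 : G -> 'M[F]_n1) (r2 : G -> 'M[F]_n2)
    (r3 : G -> 'M[F]_n3) (A : 'M_(n2, n1)) (B : 'M_(n3, n2)) :
  inter r1 r2 A -> inter r2 r3 B -> inter r1 r3 (B *m A).
Proof. by move=> iA iB s; rewrite mulmxA iB -mulmxA iA mulmxA. Qed.

Lemma interB n1 n2 (r1 : G -> 'M[F]_n1) (r2 : G -> 'M[F]_n2) (A B : 'M_(n2, n1)) :
  inter r1 r2 A -> inter r1 r2 B -> inter r1 r2 (A - B).
Proof. by move=> iA iB s; rewrite mulmxBr mulmxBl iA iB. Qed.

Lemma interD n1 n2 (r1 : G -> 'M[F]_n1) (r2 : G -> 'M[F]_n2) (A B : 'M_(n2, n1)) :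
  inter r1 r2 A -> inter r1 r2 B -> inter r1 r2 (A + B).
Proof. by move=> iA iB s; rewrite mulmxDr mulmxDl iA iB. Qed.

Lemma avg_fixed L n1 n2 (r1 : G -> 'M[F]_n1) (r2 : G -> 'M[F]_n2) T :
  is_rep r1 -> \sum_(x <- L) x.1 = 1 -> inter r1 r2 T -> avg L r1 r2 T = T.
Proof.
move=> R1 L1 iT; rewrite -[RHS]scale1r -L1 scaler_suml; apply: eq_bigr => x _.
by rewrite iT -mulmxA rep_inv // mulmx1.
Qed.

Lemma mul_avg L n1 n2 n3 n4 (r1 : G -> 'M[F]_n1) (r2 : G -> 'M[F]_n2)
   (r3 : G -> 'M[F]_n3) (r4 : G -> 'M[F]_n4) (A : 'M_(n3, n2)) T (B : 'M_(n1, n4)) :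
  inter r2 r3 A -> inter r4 r1 B ->
  A *m avg L r1 r2 T *m B = avg L r4 r3 (A *m T *m B).
Proof.
move=> iA iB; rewrite /avg mulmx_sumr mulmx_suml; apply: eq_bigr => x _.
by rewrite -scalemxAr -scalemxAl !mulmxA iA -!mulmxA iB.
Qed.

Lemma ginv_exists n1 n2 (T : 'M[F]_(n1, n2)) : exists S, T *m S *m T = T.
Proof. by exists (pinvmx T); rewrite mulmxKpV. Qed.

(** Averaging any generalized inverse of an intertwiner. *)
Lemma inter_regular n1 n2 (r1 : G -> 'M[F]_n1) (r2 : G -> 'M[F]_n2) T :
  good r1 -> good r2 -> inter r1 r2 T ->
  exists S, [/\ inter r2 r1 S, T *m S *m T = T & S *m T *m S = S].
Proof.
move=> g1 g2 iT; have [L [L1 _ _ LP]] := reynolds2 g1 g2.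
have [S0 TS0] := ginv_exists T; pose S := avg L r2 r1 S0.
have iS : inter r2 r1 S by exact: LP.
have TST : T *m S *m T = T.
  by rewrite (mul_avg L S0 iT iT) TS0 avg_fixed //; case: g1.
exists (S *m T *m S); split.
- exact: inter_comp iS (inter_comp iT iS).
- by rewrite !mulmxA TST TST.
- have -> : S *m T *m S *m T *m (S *m T *m S) = S *m (T *m S *m T *m S *m T) *m S.
    by rewrite !mulmxA.
  by rewrite !TST.
Qed.

(** If [c2 T c1 = 0] for every intertwiner, averaging the elementary matrices
    gives [0 = sum_x x.1 tr(c2 r2 x.2) tr(r1 x.2^-1 c1)].  As [c1] and [c2] have
    the same character, this is the trace of the idempotent operator
    [T |-> c1 (avg T) c1], which fixes [c1]. *)
Lemma nonzero_inter n1 n2 (r1 : G -> 'M[F]_n1) (r2 : G -> 'M[F]_n2) c1 c2 :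
  good r1 -> good r2 -> inter r1 r1 c1 -> c1 *m c1 = c1 ->
  (forall s, \tr (c1 *m r1 s) = \tr (c2 *m r2 s)) -> c1 != 0 ->
  exists2 T, inter r1 r2 T & c2 *m T *m c1 != 0.
Proof.
move=> g1 g2 ic1 c1c1 eqtr c10; have R1 : is_rep r1 by case: g1.
have [L [L1 L11 L12 _]] := reynolds2 g1 g2.
apply: contrapT => noT.
have T0 T : c2 *m avg L r1 r2 T *m c1 = 0.
  by apply: contrapT => /eqP T0; apply: noT; exists (avg L r1 r2 T).
pose f T := c1 *m avg L r1 r1 T *m c1.
pose Phi : 'M[F]_(n1 * n1) := \sum_(x <- L)
  x.1 *: (lin_mulmx (c1 *m r1 x.2) *m lin_mulmxr (r1 x.2^-1%g *m c1)).
have PhiE T : mxvec T *m Phi = mxvec (f T).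
  rewrite /Phi /f /avg !mulmx_sumr mulmx_suml linear_sum; apply: eq_bigr => x _ /=.
  rewrite -!scalemxAr -scalemxAl linearZ /=; congr (_ *: _).
  by rewrite mulmxA !mul_vec_lin /= !mulmxA.
have ff T : f (f T) = f T.
  have ifT : inter r1 r1 (f T).
    by apply: inter_comp => //; apply: inter_comp.
  by rewrite {1}/f avg_fixed // /f !mulmxA c1c1 -!mulmxA c1c1.
have PhiPhi : Phi *m Phi = Phi.
  apply/row_matrixP => k; rewrite !rowE mulmxA -[delta_mx 0 k]vec_mxK.
  by rewrite !PhiE ff.
have trPhi : \tr Phi = 0.
  transitivity (\sum_(x <- L) x.1 * (\tr (c1 *m r1 x.2) * \tr (r1 x.2^-1%g *m c1))).
    rewrite trace_vec_op; under eq_bigr => a _.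
      under eq_bigr => b _ do rewrite PhiE mxvecK /f /avg mulmx_sumr mulmx_suml summxE.
      rewrite exchange_big /=; over.
    rewrite exchange_big /=; apply: eq_bigr => x _.
    rewrite mulr_suml mulr_sumr; apply: eq_bigr => a _.
    rewrite !mulr_sumr; apply: eq_bigr => b _.
    by rewrite -scalemxAr -scalemxAl [LHS]mxE !mulmxA -[_ *m r1 _ *m c1]mulmxA mul_deltaE.
  transitivity (\sum_b \sum_a (c2 *m avg L r1 r2 (delta_mx b a) *m c1) b a).
    under [RHS]eq_bigr => b _.
      under eq_bigr => a _ do rewrite /avg mulmx_sumr mulmx_suml summxE.
      rewrite exchange_big /=; over.
    rewrite exchange_big /=; apply: eq_bigr => x _; rewrite eqtr.
    rewrite mulr_suml mulr_sumr; apply: eq_bigr => b _.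
    rewrite !mulr_sumr; apply: eq_bigr => a _.
    by rewrite -scalemxAr -scalemxAl [RHS]mxE !mulmxA -[_ *m r1 _ *m c1]mulmxA mul_deltaE.
  by rewrite big1 // => b _; rewrite big1 // => a _; rewrite T0 mxE.
have Phi0 : Phi = 0.
  apply/eqP; rewrite -mxrank_eq0 -((pcharf0P F).1 F0) -trace_idempotent //.
  by rewrite trPhi.
case/eqP: c10; have := PhiE c1.
rewrite Phi0 mulmx0 => /eqP; rewrite eq_sym mxvec_eq0 /f avg_fixed // c1c1 c1c1.
by move/eqP.
Qed.

Lemma idempotentB n (c e : 'M[F]_n) : c *m c = c -> e *m e = e ->
  c *m e = e -> e *m c = e -> (c - e) *m (c - e) = c - e.
Proof.
by move=> cc ee ce ec; rewrite mulmxBl !mulmxBr cc ce ec ee subrr subr0.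
Qed.

(** Two idempotents of the commutants with equal characters are equivalent.
    A nonzero intertwiner between their images and its averaged inverse split off
    isomorphic summands, which are removed. *)
Lemma brauer_nesbitt n1 n2 (r1 : G -> 'M[F]_n1) (r2 : G -> 'M[F]_n2) c1 c2 :
  good r1 -> good r2 -> inter r1 r1 c1 -> inter r2 r2 c2 ->
  c1 *m c1 = c1 -> c2 *m c2 = c2 ->
  (forall s, \tr (c1 *m r1 s) = \tr (c2 *m r2 s)) ->
  exists a b, [/\ inter r1 r2 a, inter r2 r1 b, a *m b = c2, b *m a = c1
    & c2 *m a = a /\ a *m c1 = a /\ c1 *m b = b /\ b *m c2 = b].
Proof.
move=> g1 g2; have [k] := ubnP (\rank c1).
elim: k c1 c2 => // k IHk c1 c2 rk ic1 ic2 cc1 cc2 eqtr.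
have [c10|c10] := eqVneq c1 0.
  have c20 : c2 = 0.
    apply/eqP; rewrite -mxrank_eq0 -((pcharf0P F).1 F0) -trace_idempotent //.
    have := eqtr 1%g; case: g1 g2 => [[-> _] _ _] [[-> _] _ _].
    by rewrite !mulmx1 => <-; rewrite c10 mxtrace0.
  exists 0, 0; rewrite c10 c20 !mulmx0.
  by split=> //; try move=> s; rewrite ?mulmx0 ?mul0mx.
have [T [iT c2T Tc1 T0]] : exists T, [/\ inter r1 r2 T, c2 *m T = T, T *m c1 = T & T != 0].
  have [T0 iT0 T00] := nonzero_inter g1 g2 ic1 cc1 eqtr c10.
  exists (c2 *m T0 *m c1); split=> //; last by rewrite -!mulmxA cc1.
    by apply: inter_comp => //; apply: inter_comp.
  by rewrite !mulmxA cc2.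
have [S0 [iS0 TST STS0]] := inter_regular g1 g2 iT.
have [S [iS c1S Sc2 TST' STS]] : exists S,
    [/\ inter r2 r1 S, c1 *m S = S, S *m c2 = S, T *m S *m T = T & S *m T *m S = S].
  exists (c1 *m S0 *m c2); split.
  - by apply: inter_comp => //; apply: inter_comp.
  - by rewrite !mulmxA cc1.
  - by rewrite -!mulmxA cc2.
  - by rewrite !mulmxA Tc1 -mulmxA c2T TST.
  - rewrite -!mulmxA (mulmxA c2) c2T !mulmxA -(mulmxA _ T c1) Tc1.
    by rewrite -!(mulmxA c1) STS0.
pose e1 := S *m T; pose e2 := T *m S.
have ee1 : e1 *m e1 = e1 by rewrite /e1 mulmxA STS.
have ee2 : e2 *m e2 = e2 by rewrite /e2 mulmxA TST'.
have c1e1 : c1 *m e1 = e1 by rewrite /e1 mulmxA c1S.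
have e1c1 : e1 *m c1 = e1 by rewrite /e1 -mulmxA Tc1.
have c2e2 : c2 *m e2 = e2 by rewrite /e2 mulmxA c2T.
have e2c2 : e2 *m c2 = e2 by rewrite /e2 -mulmxA Sc2.
have ie1 : inter r1 r1 e1 by exact: inter_comp iT iS.
have ie2 : inter r2 r2 e2 by exact: inter_comp iS iT.
have d1 : (c1 - e1) *m (c1 - e1) = c1 - e1 by exact: idempotentB.
have d2 : (c2 - e2) *m (c2 - e2) = c2 - e2 by exact: idempotentB.
have e1_neq0 : e1 != 0.
  by apply: contra_neq T0 => e10; rewrite -TST' -mulmxA -/e1 e10 mulmx0.
have rk1 : (\rank (c1 - e1)%R < k)%N.
  have rkD : \rank c1 = (\rank (c1 - e1)%R + \rank e1)%N.
    apply: (char0_natf_inj F0); rewrite natrD -!trace_idempotent //.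
    by rewrite -mxtraceD subrK.
  apply: leq_trans (_ : \rank c1 <= k)%N => //.
  by rewrite rkD -[X in (X < _)%N]addn0 ltn_add2l lt0n mxrank_eq0.
have tr12 s : \tr ((c1 - e1) *m r1 s) = \tr ((c2 - e2) *m r2 s).
  rewrite !mulmxBl !linearB /= eqtr; congr (_ - _).
  by rewrite /e1 /e2 -mulmxA -iT mulmxA mxtrace_mulC mulmxA.
have [a [b [ia ib ab ba [c2a [ac1 [c1b bc2]]]]]] := IHk _ _ rk1
  (interB ic1 ie1) (interB ic2 ie2) d1 d2 tr12.
have aS : a *m S = 0.
  by rewrite -ac1 -mulmxA mulmxBl c1S /e1 STS subrr mulmx0.
have Tb : T *m b = 0.
  by rewrite -c1b mulmxA mulmxBr Tc1 /e1 mulmxA TST' subrr mul0mx.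
have Sa : S *m a = 0.
  by rewrite -c2a mulmxA mulmxBr Sc2 /e2 mulmxA STS subrr mul0mx.
have bT : b *m T = 0.
  by rewrite -bc2 -mulmxA mulmxBl c2T /e2 TST' subrr mulmx0.
exists (a + T), (b + S); split.
- exact: interD.
- exact: interD.
- by rewrite mulmxDl !mulmxDr ab aS Tb add0r addr0 subrK.
- by rewrite mulmxDl !mulmxDr ba bT Sa add0r addr0 subrK.
- rewrite !mulmxDr !mulmxDl c2T Tc1 c1S Sc2.
  have -> : c2 *m a = a by rewrite -c2a mulmxA mulmxBr cc2 c2e2.
  have -> : a *m c1 = a by rewrite -ac1 -mulmxA mulmxBl cc1 e1c1.
  have -> : c1 *m b = b by rewrite -c1b mulmxA mulmxBr cc1 c1e1.
  by have -> : b *m c2 = b by rewrite -bc2 -mulmxA mulmxBl cc2 e2c2.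
Qed.
End BrauerNesbitt.

(** * Weil-Deligne representations and the characters of the images of N^j *)

Section Monodromy.
Variables (G : groupType) (I : G -> Prop) (phi : G) (F : closedFieldType).
Hypothesis genG : frobenius_generated I phi.
Hypothesis F0 : [pchar F] =i pred0.
Variable kap : G -> F.
Hypothesis kap0 : forall s, kap s != 0.
Hypothesis kap1 : kap 1%g = 1.
Hypothesis kapM : {morph kap : s t / (s * t)%g >-> s * t}.
Hypothesis kapI : forall i, I i -> kap i = 1.

Local Notation good := (good_rep I phi).

(** Intertwiners up to the power [j] of the character [kap]; the monodromy of a
    Weil-Deligne representation is one for [j = 1]. *)
Definition tw (j : int) n1 n2 (r1 : G -> 'M[F]_n1) (r2 : G -> 'M[F]_n2) (T : 'M_(n2, n1)) :=
  forall s, r2 s *m T = kap s ^ j *: (T *m r1 s).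

Lemma tw_comp j k n1 n2 n3 (r1 : G -> 'M[F]_n1) (r2 : G -> 'M[F]_n2)
    (r3 : G -> 'M[F]_n3) (A : 'M_(n2, n1)) (B : 'M_(n3, n2)) :
  tw j r1 r2 A -> tw k r2 r3 B -> tw (k + j) r1 r3 (B *m A).
Proof.
move=> tA tB s; rewrite mulmxA tB -scalemxAl -mulmxA tA -scalemxAr scalerA.
by rewrite expfzDr // mulmxA.
Qed.

Lemma tw0 n1 n2 (r1 : G -> 'M[F]_n1) (r2 : G -> 'M[F]_n2) T :
  tw 0 r1 r2 T <-> inter r1 r2 T.
Proof. by split=> tT s; rewrite tT ?expr0z ?scale1r. Qed.

Lemma twB j n1 n2 (r1 : G -> 'M[F]_n1) (r2 : G -> 'M[F]_n2) A B :
  tw j r1 r2 A -> tw j r1 r2 B -> tw j r1 r2 (A - B).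
Proof. by move=> tA tB s; rewrite mulmxBr mulmxBl tA tB scalerBr. Qed.

Lemma tw_sum j (J : Type) (l : seq J) (P : pred J) n1 n2 (r1 : G -> 'M[F]_n1)
    (r2 : G -> 'M[F]_n2) (A : J -> 'M_(n2, n1)) :
  (forall i, P i -> tw j r1 r2 (A i)) -> tw j r1 r2 (\sum_(i <- l | P i) A i).
Proof.
move=> tA s; rewrite mulmx_sumr mulmx_suml scaler_sumr.
by apply: eq_bigr => i Pi; rewrite tA.
Qed.

Lemma tw_id n (r : G -> 'M[F]_n) : tw 0 r r 1%:M.
Proof. by apply/tw0 => s; rewrite mulmx1 mul1mx. Qed.

Lemma tw_exp n (r : G -> 'M[F]_n) N j : tw 1 r r N -> tw j%:Z r r (N ^+ j).
Proof.
move=> tN; elim: j => [|j IHj]; first by rewrite expr0; exact: tw_id.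
by rewrite exprS intS -mulmxE; exact: tw_comp.
Qed.

Let twist j n (r : G -> 'M[F]_n) s := kap s ^ j *: r s.

Lemma good_twist j n (r : G -> 'M[F]_n) : good r -> good (twist j r).
Proof.
case=> -[r1 rM] [e re] [P [D [uP PD]]]; split.
- split; first by rewrite /twist kap1 exp1rz scale1r.
  by move=> s t; rewrite /twist kapM expfzMl rM -scalemxAl -scalemxAr scalerA.
- by exists e => s Is; rewrite /twist kapI // exp1rz scale1r re.
- exists P, (kap phi ^ j *: D); split=> //.
  by rewrite /twist -scalemxAr PD scalemxAl -linearZ.
Qed.

Lemma tw_regular j n1 n2 (r1 : G -> 'M[F]_n1) (r2 : G -> 'M[F]_n2) T :
  good r1 -> good r2 -> tw j r1 r2 T ->
  exists S, [/\ tw (- j) r2 r1 S, T *m S *m T = T & S *m T *m S = S].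
Proof.
move=> g1 g2 tT; have iT : inter r1 (twist (- j) r2) T.
  by move=> s; rewrite /twist -scalemxAl tT scalerA -expfzDr // addNr expr0z scale1r.
have [S [iS TST STS]] := inter_regular genG F0 g1 (good_twist (- j) g2) iT.
by exists S; split=> // s; rewrite iS /twist -scalemxAr.
Qed.

Definition good_wd n (r : G -> 'M[F]_n) (N : 'M[F]_n) : Prop :=
  [/\ good r, nilpotent_mx N & tw 1 r r N].

(** The trace of [r s] on the image of [A] when [A B A = A], as [A B] is then a
    projector onto this image. *)
Lemma trace_on_image n (r1 A B B' : 'M[F]_n) C : r1 *m A = A *m C ->
  A *m B *m A = A -> A *m B' *m A = A ->
  \tr (r1 *m (A *m B)) = \tr (r1 *m (A *m B')).
Proof.
move=> rA ABA AB'A.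
have -> : r1 *m (A *m B) = (A *m B') *m (r1 *m (A *m B)).
  by rewrite mulmxA rA -!mulmxA !(mulmxA A) !mulmxA AB'A.
rewrite mxtrace_mulC -!mulmxA; congr (\tr (_ *m _)).
by rewrite !mulmxA ABA.
Qed.

(** [c j] is a projector onto a complement of [ker N ∩ im N^(j+1)] in
    [ker N ∩ im N^j] that kills [im N^(j+1)], and [B j] inverts [N^j] on its
    image: the vectors [c j] are the ends of the Jordan strings of length [j+1]. *)
Lemma wd_structure n (r : G -> 'M[F]_n) N : good_wd r N ->
  exists B c : nat -> 'M[F]_n,
  [/\ forall j, tw (- j%:Z) r r (B j) /\ N ^+ j *m B j *m N ^+ j = N ^+ j,
      forall j, [/\ inter r r (c j), c j *m c j = c j, N *m c j = 0,
        c j *m N ^+ j.+1 = 0 & N ^+ j *m B j *m c j = c j],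
      forall j p (X Y : 'M[F]_(n, p)), N *m X = 0 -> X = N ^+ j *m Y -> c j *m X = 0 ->
        exists Z, X = N ^+ j.+1 *m Z
    & let th j s := \tr (r s *m (N ^+ j *m B j)) in
      let si j s := th j s - (kap s)^-1 * th j.+1 s in
      forall j s, \tr (c j *m r s) = si j s - si j.+1 s].
Proof.
case=> gr nilN tN.
have /choice[B BP] : forall j : nat, exists B, tw (- j%:Z) r r B /\
    N ^+ j *m B *m N ^+ j = N ^+ j.
  by move=> j; have [B [tB NBN _]] := tw_regular gr gr (tw_exp j tN); exists B.
have [E ED] : exists E : nat -> 'M_n, forall j, E j = N ^+ j *m B j.
  by exists (fun j => N ^+ j *m B j).
have tE j : tw 0 r r (E j).
  by rewrite ED -(addrN j%:Z); apply: tw_comp (tw_exp j tN); case: (BP j).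
have EE j : E j *m E j = E j by rewrite ED mulmxA; case: (BP j) => _ ->.
have EN j : E j *m N ^+ j = N ^+ j by rewrite ED; case: (BP j).
have NE j : N *m (N ^+ j *m B j.+1) = E j.+1 by rewrite ED mulmxA mulmxE -exprS.
have NNE j : N *m E j = N ^+ j.+1 *m B j by rewrite ED mulmxA mulmxE -exprS.
have [s_ sD] : exists s_ : nat -> 'M_n, forall j,
    s_ j = E j - N ^+ j *m B j.+1 *m (N *m E j).
  by exists (fun j => E j - N ^+ j *m B j.+1 *m (N *m E j)).
have ts j : tw 0 r r (s_ j).
  rewrite sD; apply: twB => //; have tNB : tw (-1) r r (N ^+ j *m B j.+1).
    have -> : (-1)%R = j%:Z + (- j.+1%:Z) :> int by rewrite intS opprD addrCA addrN addr0.
    by apply: tw_comp (tw_exp j tN); case: (BP j.+1).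
  have := tw_comp (tw_comp (tE j) tN) tNB.
  by rewrite addr0 addNr.
have Ns j : N *m s_ j = 0.
  by rewrite sD mulmxBr (mulmxA N (_ *m B _)) NE NNE mulmxA EN subrr.
have s_id j p (X Y : 'M_(n, p)) : N *m X = 0 -> X = N ^+ j *m Y -> s_ j *m X = X.
  move=> NX XY; have EX : E j *m X = X by rewrite XY mulmxA EN.
  by rewrite sD mulmxBl EX -!mulmxA EX NX !mulmx0 subr0.
have s_im j : exists Y, s_ j = N ^+ j *m Y.
  by exists (B j - B j.+1 *m (N *m E j)); rewrite sD ED mulmxBr !mulmxA.
have ss j : s_ j *m s_ j = s_ j by have [Y] := s_im j; apply: s_id.
have [T TD] : exists T : nat -> 'M_n, forall j, T j = (1%:M - E j.+1) *m s_ j.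
  by exists (fun j => (1%:M - E j.+1) *m s_ j).
have t1E j : tw 0 r r (1%:M - E j) by apply: twB => //; exact: tw_id.
have tT j : tw 0 r r (T j) by rewrite TD -[0]addr0; apply: tw_comp.
have Ts j : T j *m s_ j = T j by rewrite TD -mulmxA ss.
have /choice[Z ZP] : forall j, exists Z, [/\ tw 0 r r Z, T j *m Z *m T j = T j
    & Z *m T j *m Z = Z].
  by move=> j; have := tw_regular gr gr (tT j); rewrite oppr0.
have [c cD] : exists c : nat -> 'M_n, forall j, c j = s_ j *m Z j *m (1%:M - E j.+1).
  by exists (fun j => s_ j *m Z j *m (1%:M - E j.+1)).
have ic j : inter r r (c j).
  apply/tw0; rewrite cD; have [tZ _ _] := ZP j.
  by have := tw_comp (tw_comp (t1E j.+1) tZ) (ts j); rewrite !addr0 mulmxA.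
have cs j : c j *m s_ j = s_ j *m Z j *m T j by rewrite cD TD -!mulmxA.
have sc j : s_ j *m c j = c j by rewrite cD !mulmxA ss.
have cc j : c j *m c j = c j.
  have [_ _ ZTZ] := ZP j.
  by rewrite {2}cD !mulmxA cs cD -(mulmxA (s_ j)) -(mulmxA (s_ j)) ZTZ.
have Nc j : N *m c j = 0 by rewrite cD !mulmxA Ns !mul0mx.
have cN j : c j *m N ^+ j.+1 = 0.
  by rewrite cD -mulmxA mulmxBl mul1mx EN subrr mulmx0.
have Ec j : E j *m c j = c j.
  by rewrite cD; have [Y ->] := s_im j; rewrite !mulmxA EN.
have c_ker j p (X Y : 'M_(n, p)) : N *m X = 0 -> X = N ^+ j *m Y -> c j *m X = 0 ->
    exists W, X = N ^+ j.+1 *m W.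
  move=> NX XY cX; exists (B j.+1 *m X); rewrite mulmxA -ED.
  have sX := s_id _ _ _ _ NX XY; apply/eqP; rewrite -subr_eq0; apply/eqP.
  have TX : X - E j.+1 *m X = T j *m X by rewrite TD -mulmxA sX mulmxBl mul1mx.
  have sZTX : s_ j *m Z j *m (T j *m X) = 0.
    by rewrite -cX cD -TX -[X in X - _]mul1mx -mulmxBl mulmxA.
  have [_ TZT _] := ZP j; rewrite TX -TZT.
  have -> : T j *m Z j *m T j *m X = (1%:M - E j.+1) *m (s_ j *m Z j *m (T j *m X)).
    by rewrite {1}TD !mulmxA.
  by rewrite sZTX mulmx0.
exists B, c; split=> //.
- by move=> j; split=> //; rewrite -ED.
- move=> th si j s.
  have trs k : \tr (s_ k *m r s) = si k s.
    rewrite sD mulmxBl linearB /= /si /th; congr (_ - _).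
      by rewrite mxtrace_mulC ED.
    have -> : N ^+ k *m B k.+1 *m (N *m E k) *m r s =
        (kap s)^-1 *: (N ^+ k *m B k.+1 *m (r s *m N *m E k)).
      rewrite -!mulmxA; have /tw0 <- := tE k; rewrite (mulmxA (r s)) tN expr1z.
      by rewrite -!scalemxAl -!scalemxAr scalerA mulVf // scale1r !mulmxA.
    rewrite mxtraceZ; congr (_ * _); rewrite mxtrace_mulC -!mulmxA; congr (\tr (_ *m _)).
    by rewrite (mulmxA (E k)) EN NE ED.
  have id_s k : c k *m s_ k *m (c k *m s_ k) = c k *m s_ k.
    by rewrite -mulmxA (mulmxA (s_ k)) sc mulmxA cc.
  have e1 : s_ j.+1 *m (s_ j - c j *m s_ j) = s_ j - c j *m s_ j.
    pose X := s_ j - c j *m s_ j.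
    have [W XW] : exists W, X = N ^+ j.+1 *m W.
      have [Y sY] := s_im j; have [Y' cY'] : exists Y', c j = N ^+ j *m Y'.
        by exists (Y *m (Z j *m (1%:M - E j.+1))); rewrite cD sY !mulmxA.
      apply: (@c_ker j _ X (Y - Y' *m s_ j)).
      - by rewrite mulmxBr Ns mulmxA Nc mul0mx subrr.
      - by rewrite mulmxBr -sY mulmxA -cY'.
      - by rewrite mulmxBr mulmxA cc subrr.
    by apply: s_id XW; rewrite mulmxBr Ns mulmxA Nc mul0mx subrr.
  have e2 : (s_ j - c j *m s_ j) *m s_ j.+1 = s_ j.+1.
    have [Y sY] := s_im j.+1.
    have s1 : s_ j *m s_ j.+1 = s_ j.+1.
      by apply: (@s_id _ _ _ (N *m Y)) => //; rewrite sY mulmxA mulmxE -exprSr.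
    by rewrite mulmxBl -mulmxA s1 sY mulmxA cN mul0mx subr0.
  rewrite -!trs; apply/eqP; rewrite eq_sym subr_eq addrC -subr_eq; apply/eqP.
  have <- : \tr (c j *m s_ j *m r s) = \tr (c j *m r s).
    have /tw0 iss := ts j.
    by rewrite -mulmxA -iss mulmxA mxtrace_mulC mulmxA sc.
  rewrite -linearB -mulmxBl /= -e1 -mulmxA mxtrace_mulC -mulmxA.
  by have /tw0 -> := ts j.+1; rewrite mulmxA e2.
Qed.
(** Each pair of equivalent idempotents [c1 j], [c2 j], of characters prescribed by
    those of the images of the powers of [N], gives [a j].  The sum [Fm] of the
    Jordan strings that it generates is injective: a kernel vector killed by [N1]
    is successively seen to lie in the image of every power of [N1]. *)
Theorem wd_iso_of_image_traces n1 n2 (r1 : G -> 'M[F]_n1) (r2 : G -> 'M[F]_n2) N1 N2 :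
  good_wd r1 N1 -> good_wd r2 N2 ->
  (forall j s, exists B1 B2, [/\ N1 ^+ j *m B1 *m N1 ^+ j = N1 ^+ j,
     N2 ^+ j *m B2 *m N2 ^+ j = N2 ^+ j &
     \tr (r1 s *m (N1 ^+ j *m B1)) = \tr (r2 s *m (N2 ^+ j *m B2))]) ->
  exists P Q, [/\ P *m Q = 1%:M, Q *m P = 1%:M, inter r1 r2 P & P *m N1 = N2 *m P].
Proof.
move=> gw1 gw2 eqth; have [[g1 nil1 tN1] [g2 nil2 tN2]] := (gw1, gw2).
have n12 : n1 = n2.
  have [B1 [B2 []]] := eqth 0 1%g; rewrite !expr0 !mulmx1 !mul1mx => -> ->.
  case: g1 g2 => -[-> _] _ _ [[-> _] _ _]; rewrite !mul1mx !mxtrace1.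
  exact: char0_natf_inj.
have th j s B1 B2 : N1 ^+ j *m B1 *m N1 ^+ j = N1 ^+ j ->
    N2 ^+ j *m B2 *m N2 ^+ j = N2 ^+ j ->
    \tr (r1 s *m (N1 ^+ j *m B1)) = \tr (r2 s *m (N2 ^+ j *m B2)).
  have [C1 [C2 [C1P C2P eqC]]] := eqth j s => B1P B2P.
  have im n (r : G -> 'M[F]_n) N : tw 1 r r N ->
      r s *m N ^+ j = N ^+ j *m (kap s ^ j%:Z *: r s).
    by move=> tN; rewrite (tw_exp j tN) scalemxAr.
  by rewrite (trace_on_image (im _ _ _ tN1) B1P C1P) eqC
    (trace_on_image (im _ _ _ tN2) C2P B2P).
have [B1 [c1 [B1P c1P ker1 tr1]]] := wd_structure gw1.
have [B2 [c2 [B2P c2P ker2 tr2]]] := wd_structure gw2.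
have /choice[ab abP] : forall j, exists ab : 'M_(n2, n1) * 'M_(n1, n2),
    [/\ inter r1 r2 ab.1, ab.2 *m ab.1 = c1 j, c2 j *m ab.1 = ab.1 & ab.1 *m c1 j = ab.1].
  move=> j; have [ic1 cc1 _ _ _] := c1P j; have [ic2 cc2 _ _ _] := c2P j.
  have [s|a [b [ia _ _ ba [c2a [ac1 _]]]]] :=
    brauer_nesbitt genG F0 g1 g2 ic1 ic2 cc1 cc2; last by exists (a, b).
  have thB k : \tr (r1 s *m (N1 ^+ k *m B1 k)) = \tr (r2 s *m (N2 ^+ k *m B2 k)).
    by apply: th; [case: (B1P k) | case: (B2P k)].
  by rewrite tr1 tr2 !thB.
pose a j := (ab j).1.
have ia j : inter r1 r2 (a j) by case: (abP j).
have c2a j : c2 j *m a j = a j by case: (abP j).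
have ac1 j : a j *m c1 j = a j by case: (abP j).
have NBa j : N2 ^+ j *m (B2 j *m a j) = a j.
  by rewrite -(c2a j) !mulmxA; case: (c2P j) => _ _ _ _ ->.
have N2a j : N2 *m a j = 0.
  by rewrite -(c2a j) mulmxA; case: (c2P j) => _ _ -> _ _; rewrite mul0mx.
have aN j : a j *m N1 ^+ j.+1 = 0.
  by rewrite -(ac1 j) -mulmxA; case: (c1P j) => _ _ _ -> _; rewrite mulmx0.
pose Fm := \sum_(j < n1) \sum_(i < j.+1) N2 ^+ i *m (B2 j *m a j) *m N1 ^+ (j - i).
have iF : inter r1 r2 Fm.
  apply/tw0; apply: tw_sum => j _; apply: tw_sum => i _.
  have eij : 0%R = (i%:Z + (- (j : nat)%:Z + 0%R)) + (j - i)%N%:Z.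
    by rewrite -subzn -1?ltnS // addr0 [RHS]addrC addrA subrK subrr.
  rewrite eij.
  apply: tw_comp (tw_exp _ tN1) _; apply: tw_comp (tw_exp _ tN2).
  by apply: tw_comp; [exact/tw0 | case: (B2P j)].
have NF : Fm *m N1 = N2 *m Fm.
  rewrite /Fm mulmx_sumr mulmx_suml; apply: eq_bigr => j _.
  rewrite mulmx_sumr mulmx_suml big_ord_recl big_ord_recr /=.
  have -> : N2 ^+ 0 *m (B2 j *m a j) *m N1 ^+ (j - 0) *m N1 = 0.
    rewrite expr0 mul1mx subn0 -(mulmxA _ (N1 ^+ j)) mulmxE -exprSr.
    by rewrite -mulmxA aN mulmx0.
  have -> : N2 *m (N2 ^+ j *m (B2 j *m a j) *m N1 ^+ (j - j)) = 0.
    by rewrite NBa mulmxA N2a mul0mx.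
  rewrite add0r addr0; apply: eq_bigr => i _.
  rewrite /bump leq0n add1n -mulmxA mulmxE -exprSr subnSK // !mulmxA.
  by rewrite -[N2 *m N2 ^+ i]/(N2 * N2 ^+ i) -exprS.
have inj1 p (X : 'M_(n1, p)) : Fm *m X = 0 -> N1 *m X = 0 -> X = 0.
  move=> FX NX.
  have sumX : \sum_(j < n1) a j *m X = 0.
    rewrite -[RHS]FX /Fm mulmx_suml; apply: eq_bigr => j _.
    rewrite mulmx_suml big_ord_recr /= subnn expr0 mulmx1 NBa big1 ?add0r // => i _.
    by rewrite -mulmxA -(subnSK (ltn_ord i)) exprSr -mulmxE -(mulmxA _ N1) NX !mulmx0.
  have imX j : (j <= n1)%N -> exists Y, X = N1 ^+ j *m Y.
    elim: j => [|j IHj] lt_jn; first by exists X; rewrite expr0 mul1mx.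
    have [Y XY] := IHj (ltnW lt_jn); apply: (ker1 _ _ _ _ NX XY).
    have aX : a j *m X = 0.
      have := congr1 (mulmx (c2 j)) sumX; rewrite mulmx0 mulmx_sumr.
      rewrite (bigD1 (Ordinal lt_jn)) //= mulmxA c2a big1 ?addr0 // => k neq_kj.
      have [lt_kj|lt_jk|eq_kj] := ltngtP k j.
      - rewrite XY (mulmxA (a k)) -(subnKC lt_kj) exprD -mulmxE (mulmxA (a k)) aN.
        by rewrite !mul0mx mulmx0.
      - rewrite -(NBa k) -(subnKC lt_jk) exprD -mulmxE !mulmxA.
        by case: (c2P j) => _ _ _ -> _; rewrite !mul0mx.
      - by case/eqP: neq_kj; apply: val_inj.
    by case: (abP j) => _ <- _ _; rewrite -mulmxA -/(a j) aX mulmx0.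
  have [Y ->] := imX _ (leqnn n1).
  by rewrite nilpotentXn // mul0mx.
have injk k p (X : 'M_(n1, p)) : N1 ^+ k *m X = 0 -> Fm *m X = 0 -> X = 0.
  elim: k X => [|k IHk] X; first by rewrite expr0 mul1mx.
  rewrite exprSr -mulmxE -mulmxA => NX FX; apply: inj1 => //; apply: IHk => //.
  by rewrite mulmxA NF -mulmxA FX mulmx0.
have inj p (X : 'M_(n1, p)) : Fm *m X = 0 -> X = 0.
  by apply: (injk n1); rewrite nilpotentXn // mul0mx.
have uF : row_free Fm^T.
  rewrite -kermx_eq0; apply/eqP/trmx_inj; rewrite trmx0; apply: inj.
  by apply: trmx_inj; rewrite trmx_mul trmxK mulmx_ker trmx0.
exists Fm; subst n2; rewrite row_free_unit unitmx_tr in uF.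
by exists (invmx Fm); split; rewrite ?mulmxV ?mulVmx.
Qed.

End Monodromy.

(** * Places *)

(** The graph of a ring homomorphism to [E] from a subring of [K] in which every
    element of nonzero residue is invertible. *)
Record place (K E : fieldType) : Type := Place {
  place_rel :> K -> E -> Prop;
  pl1 : place_rel 1 1;
  plB : forall x y e f, place_rel x e -> place_rel y f -> place_rel (x - y) (e - f);
  plM : forall x y e f, place_rel x e -> place_rel y f -> place_rel (x * y) (e * f);
  plV : forall x e, place_rel x e -> e != 0 -> place_rel x^-1 e^-1;
  pl0_eq0 : forall e, place_rel 0 e -> e = 0 }.

Section PlaceOfGraph.
Variables (K E : fieldType) (D : K -> E -> Prop).
Hypothesis D1 : D 1 1.
Hypothesis DB : forall x y e f, D x e -> D y f -> D (x - y) (e - f).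
Hypothesis DM : forall x y e f, D x e -> D y f -> D (x * y) (e * f).
Hypothesis D0 : forall e, D 0 e -> e = 0.

Definition loc_graph x e := exists a a' b b',
  [/\ D a a', D b b', b' != 0, x * b = a & e * b' = a'].

Lemma graph_neq0 b b' : D b b' -> b' != 0 -> b != 0.
Proof. by move=> Db; apply: contra_neq => b0; apply: D0; rewrite -b0. Qed.

Lemma place_of_graph : exists P : place K E, forall x e, D x e -> P x e.
Proof.
have g1 : loc_graph 1 1 by exists 1, 1, 1, 1; split; rewrite ?mulr1 ?oner_neq0.
have gB x y e f : loc_graph x e -> loc_graph y f -> loc_graph (x - y) (e - f).
  move=> [a [a' [b [b' [Da Db b0 xb eb]]]]] [c [c' [d [d' [Dc Dd d0 yd fd]]]]].
  exists (a * d - c * b), (a' * d' - c' * b'), (b * d), (b' * d'); split.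
  - by apply: DB; exact: DM.
  - exact: DM.
  - by rewrite mulf_neq0.
  - by rewrite -xb -yd; ring.
  - by rewrite -eb -fd; ring.
have gM x y e f : loc_graph x e -> loc_graph y f -> loc_graph (x * y) (e * f).
  move=> [a [a' [b [b' [Da Db b0 xb eb]]]]] [c [c' [d [d' [Dc Dd d0 yd fd]]]]].
  exists (a * c), (a' * c'), (b * d), (b' * d'); split; try exact: DM.
  - by rewrite mulf_neq0.
  - by rewrite -xb -yd; ring.
  - by rewrite -eb -fd; ring.
have gV x e : loc_graph x e -> e != 0 -> loc_graph x^-1 e^-1.
  move=> [a [a' [b [b' [Da Db b0 xb eb]]]]] e0.
  have a'0 : a' != 0 by rewrite -eb mulf_neq0.
  have := graph_neq0 Da a'0; rewrite -xb mulf_eq0 negb_or => /andP[x0 _].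
  exists b, b', a, a'; split=> //; first by rewrite -xb mulKf.
  by rewrite -eb mulKf.
have g0 e : loc_graph 0 e -> e = 0.
  move=> [a [a' [b [b' [Da Db b0 xb eb]]]]].
  have a'0 : a' = 0 by apply: D0; rewrite mul0r in xb; rewrite xb.
  by move/eqP: eb; rewrite a'0 mulf_eq0 (negPf b0) orbF => /eqP.
exists (Place g1 gB gM gV g0) => x e Dx /=.
by exists x, e, 1, 1; split; rewrite ?mulr1 ?oner_neq0.
Qed.

End PlaceOfGraph.

Lemma place_of_rmorph (R : nzRingType) (K E : fieldType) (i : {rmorphism R -> K})
    (f : {rmorphism R -> E}) : (forall a, i a = 0 -> f a = 0) ->
  exists P : place K E, forall a, P (i a) (f a).
Proof.
move=> if0.
have [|||e|P PD] := @place_of_graph K E (fun x e => exists a, x = i a /\ e = f a).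
- by exists 1; rewrite !rmorph1.
- by move=> _ _ _ _ [a [-> ->]] [b [-> ->]]; exists (a - b); rewrite !rmorphB.
- by move=> _ _ _ _ [a [-> ->]] [b [-> ->]]; exists (a * b); rewrite !rmorphM.
- by case=> a [/esym/if0 fa0 ->].
- by exists P => a; apply: PD; exists a.
Qed.

Section Places.
Variables (K E : fieldType) (P : place K E).

Lemma pl0 : P 0 0. Proof. by rewrite -(subrr 1) -(subrr (1 : E)); apply: plB; exact: pl1. Qed.

Lemma plN x e : P x e -> P (- x) (- e).
Proof. by move=> Px; rewrite -sub0r -[- e]sub0r; apply: plB => //; exact: pl0. Qed.

Lemma plD x y e f : P x e -> P y f -> P (x + y) (e + f).
Proof. by move=> Px Py; rewrite -[y]opprK -[f]opprK; apply: plB => //; exact: plN. Qed.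

Lemma pl_fun x e f : P x e -> P x f -> e = f.
Proof.
move=> Pe Pf; apply/eqP; rewrite -subr_eq0; apply/eqP; apply: (pl0_eq0 (p := P)).
by rewrite -(subrr x); exact: plB.
Qed.

Lemma pl_neq0 x e : P x e -> e != 0 -> x != 0.
Proof. by move=> Pe; apply: contra_neq => x0; apply: (pl0_eq0 (p := P)); rewrite -x0. Qed.

Lemma pl_sum (J : Type) (s : seq J) (Q : pred J) f g :
  (forall i, Q i -> P (f i) (g i)) -> P (\sum_(i <- s | Q i) f i) (\sum_(i <- s | Q i) g i).
Proof. by move=> fg; elim/big_ind2: _ => //; [exact: pl0 | move=> *; exact: plD]. Qed.

Lemma pl_prod (J : Type) (s : seq J) (Q : pred J) f g :
  (forall i, Q i -> P (f i) (g i)) -> P (\prod_(i <- s | Q i) f i) (\prod_(i <- s | Q i) g i).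
Proof. by move=> fg; elim/big_ind2: _ => //; [exact: pl1 | move=> *; exact: plM]. Qed.

Lemma plX x e k : P x e -> P (x ^+ k) (e ^+ k).
Proof.
by move=> Px; elim: k => [|k IHk]; rewrite ?expr0 ?exprS; [exact: pl1 | exact: plM].
Qed.

Lemma pl_nat k : P k%:R k%:R.
Proof.
by elim: k => [|k IHk]; rewrite ?mulr0n ?mulrS; [exact: pl0 | apply: plD => //; exact: pl1].
Qed.

Lemma pl_expz x e (k : int) : P x e -> e != 0 -> P (x ^ k) (e ^ k).
Proof.
by move=> Px e0; case: k => k; [exact: plX | apply: plV; rewrite ?expf_neq0 //; exact: plX].
Qed.

Definition mpl m n (A : 'M[K]_(m, n)) (A' : 'M[E]_(m, n)) := forall i j, P (A i j) (A' i j).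

Lemma mpl_fun m n (A : 'M[K]_(m, n)) (B C : 'M[E]_(m, n)) : mpl A B -> mpl A C -> B = C.
Proof. by move=> AB AC; apply/matrixP => i j; exact: pl_fun (AB i j) (AC i j). Qed.

Lemma mplM m n p (A : 'M[K]_(m, n)) A' (B : 'M[K]_(n, p)) B' :
  mpl A A' -> mpl B B' -> mpl (A *m B) (A' *m B').
Proof. by move=> PA PB i j; rewrite !mxE; apply: pl_sum => k _; exact: plM. Qed.

Lemma mplD m n (A B : 'M[K]_(m, n)) A' B' : mpl A A' -> mpl B B' -> mpl (A + B) (A' + B').
Proof. by move=> PA PB i j; rewrite !mxE; exact: plD. Qed.

Lemma mplN m n (A : 'M[K]_(m, n)) A' : mpl A A' -> mpl (- A) (- A').
Proof. by move=> PA i j; rewrite !mxE; exact: plN. Qed.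

Lemma mplB m n (A B : 'M[K]_(m, n)) A' B' : mpl A A' -> mpl B B' -> mpl (A - B) (A' - B').
Proof. by move=> PA PB; apply: mplD => //; exact: mplN. Qed.

Lemma mplZ m n a b (A : 'M[K]_(m, n)) A' : P a b -> mpl A A' -> mpl (a *: A) (b *: A').
Proof. by move=> Pa PA i j; rewrite !mxE; exact: plM. Qed.

Lemma mpl_scalar n a b : P a b -> mpl (a%:M : 'M[K]_n) b%:M.
Proof.
by move=> Pa i j; rewrite !mxE; case: eqP => _; rewrite ?mulr1n ?mulr0n //; exact: pl0.
Qed.

Lemma mpl_sum m n (J : Type) (s : seq J) (Q : pred J) (A : J -> 'M[K]_(m, n)) A' :
  (forall i, Q i -> mpl (A i) (A' i)) ->
  mpl (\sum_(i <- s | Q i) A i) (\sum_(i <- s | Q i) A' i).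
Proof. by move=> PA i j; rewrite !summxE; apply: pl_sum => k Qk; exact: PA. Qed.

Lemma mplX n (A : 'M[K]_n) A' k : mpl A A' -> mpl (A ^+ k) (A' ^+ k).
Proof.
move=> PA; elim: k => [|k IHk]; first by rewrite !expr0; apply: mpl_scalar; exact: pl1.
by rewrite !exprS; exact: mplM.
Qed.

Lemma mpl_sub m n m' n' (f : 'I_m' -> 'I_m) (g : 'I_n' -> 'I_n) (A : 'M[K]_(m, n)) A' :
  mpl A A' -> mpl (mxsub f g A) (mxsub f g A').
Proof. by move=> PA i j; rewrite !mxE. Qed.

Lemma pl_trace n (A : 'M[K]_n) A' : mpl A A' -> P (\tr A) (\tr A').
Proof. by move=> PA; apply: pl_sum => i _. Qed.

Lemma pl_det n (A : 'M[K]_n) A' : mpl A A' -> P (\det A) (\det A').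
Proof.
move=> PA; apply: pl_sum => s _; apply: plM; last by apply: pl_prod => i _.
by apply: plX; apply: plN; exact: pl1.
Qed.

Lemma mpl_inv n (A : 'M[K]_n) A' : mpl A A' -> A' \in unitmx ->
  A \in unitmx /\ mpl (invmx A) (invmx A').
Proof.
move=> PA uA'; have d0 : \det A' != 0 by rewrite -unitfE -unitmxE.
have uA : A \in unitmx by rewrite unitmxE unitfE (pl_neq0 (pl_det PA)).
split=> //; rewrite /invmx uA uA'; apply: mplZ; first by apply: plV => //; exact: pl_det.
move=> i j; rewrite !mxE /cofactor; apply: plM.
  by apply: plX; apply: plN; exact: pl1.
by apply: pl_det => k h; rewrite !mxE.
Qed.

Lemma mpl_exp_mx n (A : 'M[K]_n) A' : [pchar E] =i pred0 -> mpl A A' ->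
  mpl (exp_mx A) (exp_mx A').
Proof.
move=> E0 PA; apply: mpl_sum => k _; apply: mplZ; last exact: mplX.
by apply: plV; [exact: pl_nat | exact: factf_neq0].
Qed.

End Places.

Section Minors.
Variable F : fieldType.

Lemma mxsubE m n m' n' (f : 'I_m' -> 'I_m) (g : 'I_n' -> 'I_n) (A : 'M[F]_(m, n)) :
  mxsub f g A = rowsub f 1%:M *m A *m colsub g 1%:M.
Proof. by rewrite mul_rowsub_mx mul1mx -mxsub_mul mulmx1. Qed.

Lemma exists_minor m n (A : 'M[F]_(m, n)) :
  exists (f : 'I_(\rank A) -> 'I_m) (g : 'I_(\rank A) -> 'I_n), mxsub f g A \in unitmx.
Proof.
pose R := rowsub (maxrankfun A) A.
have fullR : row_full R^T by rewrite /row_full mxrank_tr; exact: maxrowsub_free.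
exists (maxrankfun A), (fullrankfun fullR).
have := fullrowsub_unit fullR; rewrite -unitmx_tr trmx_mxsub trmxK.
by rewrite /R -mxsub_comp.
Qed.

Lemma minor_rank m n k (f : 'I_k -> 'I_m) (g : 'I_k -> 'I_n) (A : 'M[F]_(m, n)) :
  mxsub f g A \in unitmx -> (k <= \rank A)%N.
Proof.
rewrite -row_free_unit => /eqP {1}<-; rewrite mxsubE.
by apply: leq_trans (mxrankM_maxl _ _) (mxrankM_maxr _ _).
Qed.

(** An invertible minor of maximal size yields a generalized inverse. *)
Lemma minor_ginv m n (A : 'M[F]_(m, n)) k (f : 'I_k -> 'I_m) (g : 'I_k -> 'I_n) :
  \rank A = k -> mxsub f g A \in unitmx ->
  A *m (colsub g 1%:M *m invmx (mxsub f g A) *m rowsub f 1%:M) *m A = A.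
Proof.
move=> rA uA; set Y := rowsub f _; set X := colsub g _.
have [D AD] : exists D, A = D *m (Y *m A).
  apply/submxP; rewrite -(geq_leqif (mxrank_leqif_sup (submxMl Y A))) rA.
  move: uA; rewrite -row_free_unit => /eqP {1}<-; rewrite mxsubE.
  exact: mxrankM_maxl.
have -> : A *m (X *m invmx (mxsub f g A) *m Y) =
    D *m (Y *m A *m X *m invmx (mxsub f g A)) *m Y.
  by rewrite !mulmxA -(mulmxA D Y A) -AD.
by rewrite -mxsubE mulmxV // mulmx1 -mulmxA -AD.
Qed.

End Minors.

Section PlaceRank.
Variables (K E : fieldType) (P : place K E).

Lemma mpl_rank m n (A : 'M[K]_(m, n)) A' : mpl P A A' -> (\rank A' <= \rank A)%N.
Proof.
move=> PA; have [f [g uA']] := exists_minor A'.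
by have [uA _] := mpl_inv (mpl_sub f g PA) uA'; exact: minor_rank uA.
Qed.

(** If the rank does not drop, the same minor serves on both sides. *)
Lemma mpl_ginv m n (A : 'M[K]_(m, n)) A' : mpl P A A' -> \rank A = \rank A' ->
  exists B B', [/\ mpl P B B', A *m B *m A = A & A' *m B' *m A' = A'].
Proof.
move=> PA rA; have [f [g uA']] := exists_minor A'.
have [uA Pinv] := mpl_inv (mpl_sub f g PA) uA'.
exists (colsub g 1%:M *m invmx (mxsub f g A) *m rowsub f 1%:M).
exists (colsub g 1%:M *m invmx (mxsub f g A') *m rowsub f 1%:M); split.
- by apply: mplM; first apply: mplM => //; apply: mpl_sub; apply: mpl_scalar; exact: pl1.
- exact: minor_ginv.
- exact: minor_ginv.
Qed.

End PlaceRank.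

Section PolynomialPlaces.
Variables (K E : fieldType) (P : place K E).

Definition ppl (p : {poly K}) (q : {poly E}) := forall i, P p`_i q`_i.

Lemma pplB p p' q q' : ppl p p' -> ppl q q' -> ppl (p - q) (p' - q').
Proof. by move=> Pp Pq i; rewrite !coefB; exact: plB. Qed.

Lemma pplM p p' q q' : ppl p p' -> ppl q q' -> ppl (p * q) (p' * q').
Proof.
move=> Pp Pq i; rewrite !coefM; apply: pl_sum => j _; exact: plM.
Qed.

Lemma pplC a b : P a b -> ppl a%:P b%:P.
Proof. by move=> Pa i; rewrite !coefC; case: eqP => // _; exact: pl0. Qed.

Lemma pplXn k : ppl 'X^k 'X^k.
Proof. by move=> i; rewrite !coefXn; case: eqP => _; [exact: pl1 | exact: pl0]. Qed.

Lemma pplX : ppl 'X 'X. Proof. exact: (pplXn 1). Qed.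

End PolynomialPlaces.

Section PlaceExtension.
Variables (K : fieldType) (E : closedFieldType) (P : place K E).
Local Notation ppl := (ppl P).

Variables (x : K) (p : {poly K}) (p' : {poly E}).
Hypotheses (pp' : ppl p p') (mon : p \is monic) (px : p.[x] = 0).

Let J q' := exists q, ppl q q' /\ q.[x] = 0.

(** By the determinant trick: if [1] were a combination of powers of the integral
    element [x] with coefficients of residue 0, the matrix [1 - M] that expresses
    this for each power would have residue 1 and kill a nonzero vector. *)
Lemma not_const c : J c%:P -> c = 0.
Proof.
case=> q [Pq qx]; apply/eqP/negPn/negP => c0.
pose d := (size p).-1; have pd1 : p`_d = 1 by exact/eqP.
have d_gt0 : (0 < d)%N.
  rewrite lt0n; apply/eqP => d0; have : size p = 1%N.
    by move: (size_poly_gt0 p); rewrite monic_neq0 // -/d; rewrite /d in d0; case: (size p) d0 => [|[]].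
  move=> sp; have /size_poly1P[a _ pa] : size p == 1%N by rewrite sp.
  have := px; rewrite pa hornerC => a0; move: mon; rewrite pa a0.
  by rewrite monicE lead_coef0 eq_sym oner_eq0.
pose small y := exists m : 'I_d -> K, (forall i, P (m i) 0) /\ y = \sum_i m i * x ^+ i.
have smallD y z : small y -> small z -> small (y + z).
  move=> [m [Pm ->]] [m' [Pm' ->]]; exists (fun i => m i + m' i); split.
    by move=> i; rewrite -[0]addr0; exact: plD.
  by rewrite -big_split; apply: eq_bigr => i _; rewrite mulrDl.
have small0 : small 0.
  by exists (fun=> 0); split=> [i|]; [exact: pl0 | rewrite big1 // => i _; rewrite mul0r].
have smallZ a b y : P a b -> small y -> small (a * y).
  move=> Pa [m [Pm ->]]; exists (fun i => a * m i); split.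
    by move=> i; rewrite -(mulr0 b); exact: plM.
  by rewrite mulr_sumr; apply: eq_bigr => i _; rewrite mulrA.
have smallS (s : nat -> K) N : (forall i, small (s i)) -> small (\sum_(i < N) s i).
  by move=> Ss; elim/big_ind: _ => // i _.
have xd : x ^+ d = - \sum_(i < d) p`_i * x ^+ i.
  have := px; rewrite horner_coef.
  have -> : size p = d.+1 by rewrite prednK // size_poly_gt0 monic_neq0.
  by rewrite big_ord_recr /= pd1 mul1r addrC => /eqP; rewrite addr_eq0 => /eqP.
have small_mono m k : P m 0 -> (k < d)%N -> small (m * x ^+ k).
  move=> Pm lt_kd; exists (fun i => if i == Ordinal lt_kd then m else 0); split.
    by move=> i; case: eqP => // _; exact: pl0.
  rewrite (bigD1 (Ordinal lt_kd)) //= eqxx big1 ?addr0 // => i /negPf ->.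
  by rewrite mul0r.
have smallX y : small y -> small (x * y).
  move=> [m [Pm ->]]; rewrite mulr_sumr.
  have : small (\sum_i x * (m i * x ^+ i)).
    elim/big_ind: _ => // i _; rewrite mulrCA -exprS.
    have [lt_id|ge_id] := ltnP i.+1 d; first exact: small_mono.
    have -> : i.+1 = d by apply/eqP; rewrite eqn_leq ge_id ltn_ord.
    rewrite xd mulrN -mulNr mulr_sumr; elim/big_ind: _ => // k _.
    rewrite mulrA; apply: small_mono => //.
    have := plM (plN (Pm i)) (pp' k); rewrite oppr0 mul0r.
    by [].
  by [].
have small_all m k : P m 0 -> small (m * x ^+ k).
  move=> Pm; elim: k => [|k IHk]; first exact: small_mono.
  by rewrite exprS mulrCA; exact: smallX.
have Pq0 : P q`_0 c by have := Pq 0; rewrite coefC.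
have q0 : q`_0 != 0 := pl_neq0 Pq0 c0.
have small1 : small 1.
  have -> : 1 = \sum_(i < (size q).-1) - (q`_0)^-1 * (q`_i.+1 * x ^+ i.+1).
    have sq : (0 < size q)%N.
      by rewrite lt0n; apply: contra q0 => /eqP sq; rewrite nth_default ?sq.
    rewrite -mulr_sumr; apply: (mulfI q0); rewrite mulNr mulrN mulVKf // mulr1.
    apply/eqP; rewrite -subr_eq0 opprK -[X in _ == X]qx horner_coef -(prednK sq).
    by rewrite big_ord_recl expr0 mulr1 eqxx.
  apply: (smallS (fun i => - (q`_0)^-1 * (q`_i.+1 * x ^+ i.+1))) => i.
  apply: (smallZ _ (- c^-1)); first by apply: plN; exact: plV.
  by apply: small_all; have := Pq i.+1; rewrite coefC.
have smallxk k : small (x ^+ k).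
  by elim: k => [|k IHk]; rewrite ?expr0 // exprS; exact: smallX.
have /choice[M MP] := fun k : 'I_d => smallxk k.
pose A : 'M_d := 1%:M - \matrix_(i, j) M i j.
pose v : 'cV_d := \col_i x ^+ i.
have Av : A *m v = 0.
  rewrite mulmxBl mul1mx; apply/eqP; rewrite subr_eq0; apply/eqP/matrixP => i j.
  rewrite !mxE; have [_ ->] := MP i.
  by apply: eq_bigr => k _; rewrite !mxE.
have v0 : v != 0.
  apply/eqP => /matrixP/(_ (Ordinal d_gt0) 0); rewrite !mxE expr0 => /eqP.
  by rewrite oner_eq0.
have detA : \det A = 0.
  apply/eqP; apply: contraNT v0; rewrite -unitfE -unitmxE => uA.
  by rewrite -[v](mulKmx uA) Av mulmx0.
have : P (\det A) 1.
  rewrite -(det1 _ d) -[1%:M]subr0; apply: pl_det; apply: mplB.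
    by apply: mpl_scalar; exact: pl1.
  by move=> i j; rewrite !mxE; case: (MP i).
by rewrite detA => /(pl0_eq0 (p := P))/eqP; rewrite oner_eq0.
Qed.

Lemma p'_monic : p' \is monic /\ size p' = size p.
Proof.
have sp : (0 < size p)%N by rewrite size_poly_gt0 monic_neq0.
have lp : p'`_(size p).-1 = 1.
  have := pp' (size p).-1; rewrite -[p`_ _]/(lead_coef p) (monicP mon) => P1.
  exact: pl_fun P1 (pl1 P).
have sp' : size p' = size p.
  apply/eqP; rewrite eqn_leq; apply/andP; split.
    apply/leq_sizeP => j le_j; have := pp' j; rewrite nth_default //.
    exact: pl0_eq0.
  rewrite -(prednK sp) ltnNge; apply/negP => /leq_sizeP/(_ _ (leqnn _)).
  by rewrite lp => /eqP; rewrite oner_eq0.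
by split=> //; rewrite monicE /lead_coef sp' lp.
Qed.

(** The specializations of the polynomials vanishing at [x] form an ideal, which is
    proper by [not_const]; a root of its generator is a common root. *)
Lemma common_root : exists c, forall q', J q' -> q'.[c] = 0.
Proof.
have [mon' sp'] := p'_monic.
pose Q k := `[< exists q', [/\ J q', q' != 0 & size q' = k] >].
have exQ : exists k, Q k.
  by exists (size p'); apply/asboolP; exists p'; split=> //; [exists p | exact: monic_neq0].
have [_ /asboolP[d [[d0 [Pd dx]] dn0 <-]] minQ] := ex_minnP exQ.
have [c rc] : exists c, root d c.
  apply/closed_rootP; apply/eqP => /eqP/size_poly1P[a a0 da].
  by case/eqP: a0; apply: not_const; exists d0; rewrite -da.
exists c => q'; have [k] := ubnP (size q').
elim: k q' => // k IHk q' le_qk Jq'; have [->|qn0] := eqVneq q' 0; first exact: horner0.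
have le_dq : (size d <= size q')%N by apply: minQ; apply/asboolP; exists q'.
pose a := lead_coef q' / lead_coef d; pose h := a%:P * 'X^(size q' - size d) : {poly E}.
have ld0 : lead_coef d != 0 by rewrite lead_coef_eq0.
have sh : size (h * d) = size q'.
  have a0 : a != 0 by rewrite mulf_neq0 ?invr_eq0 ?lead_coef_eq0.
  rewrite /h -mulrA mul_polyC size_scale // mulrC size_mulXn // subnK //.
have lt_size : (size (q' - h * d)%R < size q')%N.
  have sq : (0 < size q')%N by rewrite size_poly_gt0.
  rewrite -(prednK sq) ltnS; apply/leq_sizeP => j le_j; rewrite coefB.
  have [lt_j|] := ltnP (size q').-1 j.
    by rewrite !nth_default ?subrr // ?sh -(prednK sq).
  move=> ge_j; have -> : j = (size q').-1 by apply/eqP; rewrite eqn_leq le_j ge_j.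
  rewrite -[q'`_ _]/(lead_coef q') -sh -[(h * d)`_ _]/(lead_coef (h * d)).
  rewrite lead_coefM /h lead_coefM lead_coefC lead_coefXn mulr1 /a divfK ?subrr //.
have [q [Pq qx]] := Jq'.
have Jr : J (q' - h * d).
  have := Pq (size q').-1; rewrite -[q'`_ _]/(lead_coef q') => Plq.
  have := Pd (size d).-1; rewrite -[d`_ _]/(lead_coef d) => Pld.
  pose b := q`_(size q').-1 / d0`_(size d).-1.
  have Pb : P b a by apply: plM => //; exact: plV.
  exists (q - b%:P * 'X^(size q' - size d) * d0); split.
    by apply: pplB => //; apply: pplM => //; apply: pplM; [exact: pplC | exact: pplXn].
  by rewrite hornerD hornerN hornerM qx dx mulr0 subr0.
have := IHk _ (leq_trans lt_size le_qk) Jr.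
by rewrite hornerD hornerN hornerM (rootP rc) mulr0 subr0.
Qed.

(** A common zero [c] of the specializations of all the polynomials that vanish at
    [x] is a value for [x]. *)
Theorem place_extend : exists P' : place K E,
  (forall y e, P y e -> P' y e) /\ exists e, P' x e.
Proof.
have [c cP] := common_root.
have [|||e|P' P'D] := @place_of_graph K E
  (fun y e => exists q q', [/\ ppl q q', y = q.[x] & e = q'.[c]]).
- by exists 1, 1; rewrite -!polyC1 !hornerC; split=> //; apply: pplC; exact: pl1.
- move=> _ _ _ _ [q [q' [Pq -> ->]]] [h [h' [Ph -> ->]]]; exists (q - h), (q' - h').
  by rewrite !hornerD !hornerN; split=> //; exact: pplB.
- move=> _ _ _ _ [q [q' [Pq -> ->]]] [h [h' [Ph -> ->]]]; exists (q * h), (q' * h').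
  by rewrite !hornerM; split=> //; exact: pplM.
- by move=> [q [q' [Pq /esym qx ->]]]; apply: cP; exists q.
- exists P'; split.
    by move=> y e Py; apply: P'D; exists y%:P, e%:P; rewrite !hornerC; split=> //; exact: pplC.
  by exists c; apply: P'D; exists 'X, 'X; rewrite !hornerX; split=> //; exact: pplX.
Qed.

End PlaceExtension.

(** * The Weil group *)

Section PadicNumbers.
Variables (p : nat) (pP : prime p).

Lemma padic_addE (x y : padic_int pP) n : ((x + y)%R n = (x n + y n) %% (p ^ n)%N)%Z.
Proof. by []. Qed.

Lemma padic_mulE (x y : padic_int pP) n : ((x * y)%R n = (x n * y n) %% (p ^ n)%N)%Z.
Proof. by []. Qed.

Lemma padic_oneE n : ((1%R : padic_int pP) n = 1%:Z %% (p ^ n)%N)%Z.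
Proof. by []. Qed.

Lemma padic_zeroE n : (0 : padic_int pP) n = 0.
Proof. by rewrite -[LHS]/(0%:Z %% _)%Z mod0z. Qed.

Lemma padic_natE k n : ((k%:R%R : padic_int pP) n = k%:Z %% (p ^ n)%N)%Z.
Proof.
elim: k => [|k IHk]; first by rewrite padic_zeroE mod0z.
by rewrite mulrS padic_addE IHk padic_oneE modzDm -PoszD add1n.
Qed.

Lemma padic_char0 : [pchar (padic_int pP)] =i pred0.
Proof.
apply/pcharf0P => k; apply/eqP/eqP => [k0|->//].
have := congr1 (fun x : padic_int pP => x k) k0.
rewrite padic_natE padic_zeroE modz_small; first by case.
by rewrite ltz_nat /= ltn_expl ?prime_gt1.
Qed.

Lemma padic_p_nonunit (z : padic_int pP) : p%:R * z <> 1.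
Proof.
move/(congr1 (fun x : padic_int pP => x 1%N)).
rewrite padic_mulE padic_natE padic_oneE expn1 modzz mul0r mod0z modz_small //.
by rewrite ltz_nat /= prime_gt1.
Qed.

(** Multiplied by a power of [p], an integral equation for [1 / p] shows that [p] is
    a unit of the [p]-adic integers. *)
Lemma inv_p_not_integral (F : fieldType) (j : {rmorphism padic_int pP -> F}) :
  injective j -> ~ integralOver j (p%:R^-1).
Proof.
move=> j_inj [P mon /rootP]; rewrite horner_coef size_map_poly_id0 => [P0|]; last first.
  by rewrite (monicP mon) rmorph1 oner_neq0.
have p0 : p%:R != 0 :> F.
  rewrite -(rmorph_nat j) -(rmorph0 j) (inj_eq j_inj) ((pcharf0P _).1 padic_char0).
  by rewrite -lt0n prime_gt0.
have sP : (0 < size P)%N by rewrite size_poly_gt0 monic_neq0.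
pose d := (size P).-1.
have : p%:R ^+ d * \sum_(i < size P) (map_poly j P)`_i * p%:R^-1 ^+ i = 0.
  by rewrite P0 mulr0.
rewrite mulr_sumr -(prednK sP) -/d big_ord_recr /= coef_map.
have -> : P`_d = 1 by exact: monicP.
rewrite [X in _ * (X * _)](rmorph1 j) mul1r -exprMn mulfV // expr1n.
have -> : \sum_(i < d) p%:R ^+ d * ((map_poly j P)`_i * p%:R^-1 ^+ i) =
    j (p%:R * \sum_(i < d) P`_i * p%:R ^+ (d - i.+1)).
  rewrite mulr_sumr rmorph_sum; apply: eq_bigr => i _.
  rewrite coef_map !rmorphM rmorphXn rmorph_nat /= mulrCA [RHS]mulrCA; congr (_ * _).
  rewrite -exprS subnSK // -{1}(subnK (ltnW (ltn_ord i))) exprD -mulrA -exprMn.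
  by rewrite mulfV // expr1n mulr1.
rewrite -(rmorph1 j) -rmorphD -[RHS](rmorph0 j) => /j_inj/eqP.
rewrite addr_eq0 => /eqP eqN; apply: (padic_p_nonunit (z := - \sum_(i < d) P`_i * p%:R ^+ (d - i.+1))).
by rewrite mulrN eqN opprK.
Qed.

End PadicNumbers.

Section GaloisFacts.
Variables (K : fieldType) (Kbar : alg_closure K).

Lemma gal_rmorph (s : galois_aut Kbar) : exists f : {rmorphism Kbar -> Kbar}, s =1 f.
Proof.
case: s => s [sB sM sb sK] /=.
pose B := GRing.isZmodMorphism.Build _ _ s sB.
pose M := GRing.isMonoidMorphism.Build _ _ s sM.
by exists (HB.pack s B M : {rmorphism Kbar -> Kbar}).
Qed.

Lemma gal_invE (s : galois_aut Kbar) x : s (s^-1%g x) = x.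
Proof. exact: (galois_invK s).2. Qed.

Lemma gal_fix (s : galois_aut Kbar) x : s (acl_emb Kbar x) = acl_emb Kbar x.
Proof. by case: s => s [_ _ _ sK] /=. Qed.

(** The conjugates of [z] are among the roots of one polynomial. *)
Lemma gal_conj_roots (z : Kbar) : exists rs : seq Kbar,
  forall s : galois_aut Kbar, s z \in rs.
Proof.
have [P mon Pz] := acl_alg z.
have [rs rsP] := closed_field_poly_normal (map_poly (acl_emb Kbar) P).
exists rs => s; rewrite -root_prod_XsubC.
have := rsP; rewrite (monicP _) ?map_monic // scale1r => <-.
have [f sf] := gal_rmorph s; rewrite sf.
have -> : map_poly (acl_emb Kbar) P = map_poly (f \o acl_emb Kbar) P.
  by apply: eq_map_poly => c /=; rewrite -sf gal_fix.
by rewrite map_poly_comp rmorph_root.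
Qed.

End GaloisFacts.

Section WeilFacts.
Variables (p l : nat) (pP : prime p) (lP : prime l) (S : weil_setup pP lP).

Local Notation I := (fun s : S => inertia (weil_val s)).
Local Notation v := (@ws_v _ _ _ _ S).
Local Notation q := (ws_q S).
Local Notation phi := (ws_phi S : S).
Local Notation Kbar := (ws_Kbar S).
Local Notation intK := (is_integral (padic_in_Kbar Kbar)).
Local Notation maxK := (in_max_ideal (padic_in_Kbar Kbar)).

Lemma weil_mulE (s t : S) x : weil_val (s * t)%g x = weil_val s (weil_val t x).
Proof. by []. Qed.

Lemma weil_invE (s : S) x : weil_val s (weil_val s^-1%g x) = x.
Proof. exact: gal_invE. Qed.

Lemma weil_invVE (s : S) x : weil_val s^-1%g (weil_val s x) = x.
Proof. by rewrite -weil_mulE mulVg. Qed.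

Lemma gal_int (s : galois_aut Kbar) x : intK x -> intK (s x).
Proof. exact: intK_gal. Qed.

Lemma gal_max (s : galois_aut Kbar) x : maxK x -> maxK (s x).
Proof.
have [f sf] := gal_rmorph s; case=> k ik; exists k.
by rewrite sf -rmorphXn -(rmorph_nat f) -fmorph_div -sf; exact: gal_int.
Qed.

Lemma galB (s : galois_aut Kbar) x y : s (x - y) = s x - s y.
Proof. by have [f sf] := gal_rmorph s; rewrite !sf rmorphB. Qed.

Lemma galD (s : galois_aut Kbar) x y : s (x + y) = s x + s y.
Proof. by have [f sf] := gal_rmorph s; rewrite !sf rmorphD. Qed.

Lemma inertia_gen_in1 : I 1%g.
Proof.
by move=> x _ /=; exists 0%N; rewrite subrr expr1 mul0r; exact: integral0.
Qed.

Lemma inertiaM (s t : S) : I s -> I t -> I (s * t)%g.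
Proof.
move=> Is It x ix; rewrite weil_mulE.
have ixt := gal_int t ix.
exact: maxK_trans (gal_int s ixt) ixt ix (Is _ ixt) (It _ ix).
Qed.

Lemma inertiaV (s : S) : I s -> I s^-1%g.
Proof.
move=> Is x ix; apply: maxK_sym; rewrite -{1}(weil_invE s x).
by apply: Is; exact: gal_int.
Qed.

Lemma inertiaJ (s i : S) : I i -> I (s * i * s^-1)%g.
Proof.
move=> Ii x ix; rewrite !weil_mulE -{2}(weil_invE s x) -galB.
by apply: gal_max; apply: Ii; exact: gal_int.
Qed.

Lemma padic_in_K_inj : injective (padic_in_K (ws_K S)).
Proof.
move=> x y; rewrite /padic_in_K => /(fmorph_inj (in_alg (ws_K S))).
by move/eqP; rewrite tofrac_eq => /eqP.
Qed.

(** Otherwise 1 would be in the maximal ideal, and [1 / l] integral. *)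
Lemma residue_card_gt1 : (1 < q)%N.
Proof.
have [r [ir rP]] := ws_qP S.
have i1 : is_integral (padic_in_K (ws_K S)) 1 by exact: integral1.
have i0 : is_integral (padic_in_K (ws_K S)) 0 by exact: integral0.
have [a [ma _]] := rP 1 i1; have [b [mb _]] := rP 0 i0.
rewrite ltnNge; apply/negP => q_le1.
have ab : a = b.
  apply/val_inj; move: (ltn_ord a) (ltn_ord b) => /=.
  by case: q a b q_le1 {r ir rP ma mb} => [|[|]] // [[|]] // ? [[|]].
have : in_max_ideal (padic_in_K (ws_K S)) 1.
  have -> : 1 = (1 - r a) + (0 - r a) * -1 :> ws_K S by rewrite sub0r mulrNN mulr1 subrK.
  have iN1 : is_integral (padic_in_K (ws_K S)) (-1).
    by apply: integral_opp; exact: integral1.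
  apply: in_max_idealD.
  - exact: integral_sub i1 (ir a).
  - exact: integral_mul (integral_sub i0 (ir a)) iN1.
  - exact: ma.
  - by apply: in_max_idealM => //; rewrite ab.
case=> k; rewrite expr1n mul1r => il.
exact: inv_p_not_integral padic_in_K_inj il.
Qed.

Lemma phi_max x : intK x -> maxK (weil_val phi x ^+ q - x).
Proof. exact: ws_phiP. Qed.

Lemma max_root x k : (0 < k)%N -> maxK (x ^+ k) -> maxK x.
Proof.
move=> k_gt0 [h ih]; exists (k * h.+1).-1.
by rewrite prednK ?muln_gt0 ?k_gt0 // exprM.
Qed.

(** The [q]-th power map is additive on the residue field, since its inverse is
    induced by the field automorphism [phi]; hence it is injective. *)
Lemma frobenius_additive x y : intK x -> intK y ->
  maxK ((x + y) ^+ q - (x ^+ q + y ^+ q)).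
Proof.
move=> ix iy; pose x' := weil_val phi^-1%g x; pose y' := weil_val phi^-1%g y.
have [ix' iy'] : intK x' /\ intK y' by split; exact: gal_int.
have ixy' : intK (x' + y') by exact: integral_add.
have ixq := is_integralX q ix; have iyq := is_integralX q iy.
have m1 : maxK ((x + y) ^+ q - (x' + y')).
  by rewrite -{1}(weil_invE phi x) -{1}(weil_invE phi y) -galD; exact: phi_max.
have m2 : maxK (x' + y' - (x ^+ q + y ^+ q)).
  rewrite opprD addrACA; apply: in_max_idealD.
  - exact: integral_sub.
  - exact: integral_sub.
  - by apply: maxK_sym; rewrite -{1}(weil_invE phi x); exact: phi_max.
  - by apply: maxK_sym; rewrite -{1}(weil_invE phi y); exact: phi_max.
apply: maxK_trans ixy' _ m1 m2; last exact: integral_add.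
by apply: is_integralX; exact: integral_add.
Qed.

Lemma frobenius_inj x y : intK x -> intK y -> maxK (x ^+ q - y ^+ q) -> maxK (x - y).
Proof.
move=> ix iy mxy; apply: (@max_root _ q); first exact: ltnW residue_card_gt1.
have ixy : intK (x - y) by exact: integral_sub.
have := frobenius_additive ixy iy; rewrite subrK => madd.
have -> : (x - y) ^+ q = (x ^+ q - y ^+ q) - (x ^+ q - ((x - y) ^+ q + y ^+ q)).
  by ring.
have m1 : is_integral (padic_in_Kbar Kbar) (-1).
  by apply: integral_opp; exact: integral1.
rewrite -[- (x ^+ q - _)]mulrN1; apply: in_max_idealD => //.
- by apply: integral_sub; exact: is_integralX.
- apply: integral_mul => //; apply: integral_sub; first exact: is_integralX.
  by apply: integral_add; exact: is_integralX.
- exact: in_max_idealM.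
Qed.

Lemma frobenius_iter_inj k x y : intK x -> intK y ->
  maxK (x ^+ (q ^ k) - y ^+ (q ^ k)) -> maxK (x - y).
Proof.
elim: k x y => [|k IHk] x y ix iy; first by rewrite expn0 !expr1.
by rewrite expnS !exprM => /IHk/frobenius_inj; apply=> //; exact: is_integralX.
Qed.

Lemma phi_iter k x : intK x -> maxK (weil_val (phi ^+ k)%g x ^+ (q ^ k) - x).
Proof.
move=> ix; elim: k => [|k IHk].
  by rewrite expn0 expr1 /= subrr; exists 0%N; rewrite expr1 mul0r; exact: integral0.
have ik : intK (weil_val (phi ^+ k)%g x) by exact: gal_int.
rewrite expgS weil_mulE expnS exprM.
apply: (maxK_trans _ _ ix _ IHk); try by do ?apply: is_integralX; do ?exact: gal_int.
by apply: maxK_exp; [apply: is_integralX; exact: gal_int | | exact: phi_max].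
Qed.

(** An element that acts on the residue field as the power [b - a] of the arithmetic
    Frobenius agrees there with [phi^(a - b)], as the [q^a]-th power map can be
    cancelled. *)
Lemma weil_inertia (s : S) : exists k : nat, I (s * phi ^+ k)%g \/ I (s * phi ^- k)%g.
Proof.
have /asboolP[a [b sab]] : weil_pred q (weil_val s) by case: s.
have [le_ab|/ltnW le_ba] := leqP a b.
  exists (b - a)%N; left => x ix; rewrite weil_mulE.
  set y := weil_val (phi ^+ (b - a))%g x; have iy : intK y by exact: gal_int.
  apply: (@frobenius_iter_inj a) => //; first exact: gal_int.
  apply: (maxK_trans _ _ _ (sab y iy)); try by do ?apply: is_integralX; do ?exact: gal_int.
  rewrite -{1}(subnK le_ab) expnD exprM.
  by apply: maxK_exp => //; [exact: is_integralX | exact: phi_iter].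
exists (a - b)%N; right => x ix; rewrite weil_mulE.
set y := weil_val (phi ^- (a - b))%g x; have iy : intK y by exact: gal_int.
apply: (@frobenius_iter_inj a) => //; first exact: gal_int.
apply: (maxK_trans _ _ _ (sab y iy)); try by do ?apply: is_integralX; do ?exact: gal_int.
rewrite -(subnK le_ba) expnD exprM.
apply: maxK_exp; [done | exact: is_integralX |]; apply: maxK_sym.
by rewrite -{1}(weil_invE (phi ^+ (a - b))%g x); exact: phi_iter.
Qed.

Lemma weil_expzN (s : S) k : weil_expz s (- k) = (weil_expz s k)^-1%g.
Proof. by case: k => [[|k]|k] /=; rewrite ?invg1 ?invgK //. Qed.

Lemma weil_vM : {morph v : s t / (s * t)%g >-> s + t}.
Proof. by case: (ws_vP S). Qed.

Lemma weil_v1 : v 1%g = 0.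
Proof. by apply: (addrI (v 1%g)); rewrite -weil_vM mul1g addr0. Qed.

Lemma weil_vV s : v s^-1%g = - v s.
Proof. by apply/eqP; rewrite -addr_eq0 -weil_vM mulVg weil_v1. Qed.

Lemma weil_vI s : I s -> v s = 0.
Proof. by case: (ws_vP S) => _ vI _; exact: vI. Qed.

Lemma weil_vphi : v phi = 1.
Proof. by case: (ws_vP S). Qed.

Lemma weil_vphiX k : v (phi ^+ k)%g = k%:Z.
Proof.
elim: k => [|k IHk]; first exact: weil_v1.
by rewrite expgS weil_vM IHk weil_vphi intS.
Qed.

Lemma weil_decomp (s : S) : I (weil_expz phi (- v s) * s)%g.
Proof.
have conj (t u : S) : I (t * u)%g -> I (u * t)%g.
  by move=> /(inertiaJ u); rewrite !mulgA mulgK.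
have [k [Ik|Ik]] := weil_inertia s.
  have -> : v s = - k%:Z.
    by apply/eqP; rewrite -addr_eq0 -weil_vphiX -weil_vM weil_vI.
  by rewrite opprK; exact: conj.
have -> : v s = k%:Z.
  by apply/eqP; rewrite -subr_eq0 -weil_vphiX -weil_vV -weil_vM weil_vI.
by rewrite weil_expzN; exact: conj.
Qed.

Lemma weil_frobenius_generated : frobenius_generated I phi.
Proof.
split.
- exact: inertia_gen_in1.
- exact: inertiaM.
- exact: inertiaV.
- exact: inertiaJ.
- move=> Q Qphi QI QM QV s.
  have -> : s = (weil_expz phi (v s) * (weil_expz phi (- v s) * s))%g.
    by rewrite weil_expzN mulgA mulgV mul1g.
  have Qk k : Q (phi ^+ k)%g.
    elim: k => [|k IHk]; first by apply: QI; exact: inertia_gen_in1.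
    by rewrite expgS; exact: QM.
  apply: QM; last by apply: QI; exact: weil_decomp.
  by case: (v s) => k /=; [exact: Qk | apply: QV; exact: Qk].
Qed.

Section FiniteExtension.
Variables (L : fieldExtType (ws_K S)) (j : {rmorphism L -> Kbar}).
Hypothesis jK : forall x, j x%:A = acl_emb Kbar x.

Local Notation IL := (inertia_of j).

Lemma inertia_of_gen1 : IL 1%g.
Proof. by split=> //; exact: inertia_gen_in1. Qed.

Lemma inertia_ofX s k : IL s -> IL (s ^+ k)%g.
Proof.
move=> [Is sj]; elim: k => [|k [Ik kj]]; first exact: inertia_of_gen1.
split; first by rewrite expgS; exact: inertiaM.
by move=> y; rewrite expgS weil_mulE kj sj.
Qed.

Let basis_image (s : S) := [seq weil_val s (j y) | y <- vbasis {:L}].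

Let basis_image_eq s t : basis_image s = basis_image t ->
  forall y, weil_val s (j y) = weil_val t (j y).
Proof.
move=> eq_st y; have [fs sf] := gal_rmorph s; have [ft tf] := gal_rmorph t.
rewrite (coord_vbasis (memvf y)) !rmorph_sum sf tf !rmorph_sum; apply: eq_bigr => i _ /=.
rewrite -mulr_algl !rmorphM jK -sf -tf !gal_fix; congr (_ * _).
have := congr1 (fun u => nth 0 u i) eq_st.
by rewrite !(nth_map 0) ?size_tuple // sf tf.
Qed.

Let finite_products (T : eqType) (rs : seq (seq T)) :
  exists e : seq (seq T), forall u, all2 (fun x r => x \in r) u rs -> u \in e.
Proof.
elim: rs => [|r rs [e eP]]; first by exists [:: [::]] => -[].
exists [seq x :: u | x <- r, u <- e] => -[|x u] //= /andP[xr /eP ue].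
by apply/allpairsP; exists (x, u).
Qed.

Let finite_basis_image : exists e : seq (seq Kbar), forall s, basis_image s \in e.
Proof.
have /choice[rs rsP] : forall y : L, exists rs : seq Kbar, forall s : galois_aut Kbar,
  s (j y) \in rs by move=> y; exact: gal_conj_roots.
have [e eP] := finite_products [seq rs y | y <- vbasis {:L}].
exists e => s; apply: eP; rewrite /basis_image; elim: (tval _) => //= y b ->.
by rewrite rsP.
Qed.

(** Two powers of [s] agree on a basis of [L], whose conjugates are finitely many. *)
Lemma inertia_of_power s : I s -> exists2 k, (0 < k)%N & IL (s ^+ k)%g.
Proof.
move=> Is; have [e eP] := finite_basis_image.
pose f k := basis_image (s ^+ k)%g.
have [a [b [lt_ab fab]]] := pigeonhole (fun k => eP (s ^+ k)%g : f k \in e).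
exists (b - a)%N; first by rewrite subn_gt0.
split.
  by elim: (b - a)%N => [|k IHk]; [exact: inertia_gen_in1 | rewrite expgS; exact: inertiaM].
move=> y; have eqs : weil_val (s ^+ a)%g (j y) =
    weil_val (s ^+ a)%g (weil_val (s ^+ (b - a))%g (j y)).
  by rewrite -weil_mulE -expgnDr (subnKC (ltnW lt_ab)); exact: basis_image_eq.
by rewrite -[LHS](weil_invVE (s ^+ a)%g) -eqs weil_invVE.
Qed.

(** The cosets of the inertia of [L] correspond to the images of a basis of [L]. *)
Lemma inertia_of_index : exists2 H : seq S, (forall h, h \in H -> I h) &
  forall i, I i -> exists2 h, h \in H & IL (h^-1 * i)%g.
Proof.
have [e eP] := finite_basis_image.
have /choice[g gP] : forall u, exists h, I h /\
    ((exists2 i, I i & basis_image i = u) -> basis_image h = u).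
  move=> u; have [[i Ii iu]|no] := pselect (exists2 i, I i & basis_image i = u).
    by exists i.
  by exists 1%g; split=> //; exact: inertia_gen_in1.
exists [seq g u | u <- e] => [_ /mapP[u _ ->]|i Ii]; first by case: (gP u).
exists (g (basis_image i)); first by rewrite map_f ?eP.
have [Ig gi] := gP (basis_image i); split.
  by apply: inertiaM => //; exact: inertiaV.
move=> y; rewrite weil_mulE -(basis_image_eq (gi _) y) ?weil_invVE //.
by exists i.
Qed.

End FiniteExtension.

Lemma tame_add (s t : S) : I s -> I t -> ws_t (s * t)%g = ws_t s + ws_t t.
Proof. by case: (ws_tP S) => _ tM _; exact: tM. Qed.

Lemma tame_onto z : exists2 s : S, I s & ws_t s = z.
Proof. by case: (ws_tP S) => _ _ tO; exact: tO. Qed.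

Lemma tame1 : ws_t (1%g : S) = 0.
Proof.
apply: (addrI (ws_t (1%g : S))); rewrite -tame_add ?mul1g ?addr0 //;
  exact: inertia_gen_in1.
Qed.

Lemma inertiaX (s : S) k : I s -> I (s ^+ k)%g.
Proof.
by move=> Is; elim: k => [|k IHk]; [exact: inertia_gen_in1 | rewrite expgS; exact: inertiaM].
Qed.

Lemma tameX (s : S) k : I s -> ws_t (s ^+ k)%g = k%:R * ws_t s.
Proof.
move=> Is; elim: k => [|k IHk]; first by rewrite tame1 mul0r.
by rewrite expgS tame_add ?IHk ?mulrS ?mulrDl ?mul1r //; exact: inertiaX.
Qed.

End WeilFacts.

(** * The Weil-Deligne representation of a monodromic representation *)

Section UnipotentTwist.
Variables (p l : nat) (pP : prime p) (lP : prime l) (S : weil_setup pP lP).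
Variables (F : closedFieldType) (n : nat) (u : 'M[F]_n) (nilu : unipotent_mx u).

Let uu : u \in unitmx := unipotent_unit nilu.

Lemma expz_comm (A : 'M[F]_n) k : A *m u = u *m A ->
  A *m mx_expz u k = mx_expz u k *m A.
Proof.
by move=> Au; case: k => m; apply: intertwineX => //; exact: mx_comm_inv.
Qed.

Lemma mx_expzD a b : mx_expz u a *m mx_expz u b = mx_expz u (a + b).
Proof.
have expS k : mx_expz u (k + 1) = mx_expz u k *m u.
  case: k => [k|[|k]]; first by rewrite /= addn1 exprSr.
    by rewrite /= expr1 mulVmx.
  have -> : Negz k.+1 + 1 = Negz k by rewrite !NegzE intS opprD addrAC addNr add0r.
  by rewrite /= [invmx u ^+ k.+2]exprSr -mulmxE mulmxKV.
elim/int_rec: b => [|b IHb|b IHb]; first by rewrite addr0 /= expr0 mulmx1.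
  by rewrite intS [1 + _]addrC addrA !expS -IHb mulmxA.
apply: (can_inj (mulmxK uu)); rewrite -mulmxA -!expS intS opprD.
by rewrite [-1 - _]addrC addrA !subrK.
Qed.

Lemma unipotent_expz k : unipotent_mx (mx_expz u k).
Proof.
by case: k => m /=; apply: unipotentX => //; exact: unipotentV.
Qed.

Variables (r : S -> 'M[F]_n) (rR : is_rep r).
Hypothesis ur : forall s, u *m r s = r s *m u.

Lemma unipotent_twist_rep : is_rep (fun s => r s *m mx_expz u (- ws_v s)).
Proof.
have [r1 rM] := rR; split; first by rewrite r1 weil_v1 /= expr0 mulmx1.
move=> s s'; rewrite rM weil_vM opprD -mx_expzD -!mulmxA; congr (_ *m _).
by rewrite !mulmxA (expz_comm _ (esym (ur s'))).
Qed.

(** The factor [u^(v s)] is unipotent and commutes with the rest, so it changes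
    the product by a nilpotent matrix. *)
Lemma unipotent_twist_trace s A B C : u *m A = A *m u ->
  r s *m A = A *m C -> A *m B *m A = A ->
  \tr (r s *m mx_expz u (- ws_v s) *m (A *m B)) = \tr (r s *m (A *m B)).
Proof.
move=> uA rA ABA; set e := mx_expz u _.
have eA : A *m e = e *m A by exact: expz_comm.
have re : r s *m e = e *m r s by exact/expz_comm/esym/ur.
pose Y := r s *m (e - 1%:M).
have nilY : nilpotent_mx Y.
  have -> : Y = (e - 1%:M) *m r s by rewrite /Y mulmxBr mulmxBl mulmx1 mul1mx re.
  apply: nilpotent_comm; last exact: unipotent_expz.
  by rewrite mulmxBr mulmxBl mulmx1 mul1mx re.
have YA : Y *m A = A *m (C *m (e - 1%:M)).
  rewrite /Y -mulmxA mulmxBl mul1mx -eA -[X in _ *m (_ - X)]mulmx1 -mulmxBr.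
  by rewrite mulmxA rA -mulmxA.
have im k : exists C', Y ^+ k *m A = A *m C'.
  elim: k => [|k [C' YC']]; first by exists 1%:M; rewrite expr0 mulmx1 mul1mx.
  exists (C *m (e - 1%:M) *m C').
  by rewrite exprS -mulmxE -mulmxA YC' mulmxA YA -mulmxA.
have YX m : (Y *m (A *m B)) ^+ m.+1 = Y ^+ m.+1 *m (A *m B).
  elim: m => [|m IHm]; first by rewrite !expr1.
  rewrite exprS IHm -mulmxE [in RHS]exprS -mulmxE -!mulmxA; congr (_ *m _).
  have [C' YC'] := im m.+1.
  rewrite (mulmxA (Y ^+ m.+1)) YC' -(mulmxA A C').
  by rewrite (mulmxA B A) (mulmxA A (B *m A)) (mulmxA A B A) ABA.
apply/eqP; rewrite -subr_eq0 -linearB /= -mulmxBl.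
rewrite -[X in _ - X]mulmx1 -mulmxBr -/Y trace_nilpotent //.
by have [k Yk] := nilY; exists k.+1; rewrite YX exprSr Yk mul0r mul0mx.
Qed.

End UnipotentTwist.

Section MonodromicReps.
Variables (p l : nat) (pP : prime p) (lP : prime l) (S : weil_setup pP lP).

Local Notation I := (fun s : S => inertia (weil_val s)).
Local Notation v := (@ws_v _ _ _ _ S).
Local Notation q := (ws_q S).
Local Notation phi := (ws_phi S : S).
Local Notation t := (@ws_t _ _ _ _ S).

(** The conjugation formula of the tame character at the geometric Frobenius.  It is
    not assumed: it follows from the existence of a monodromic representation of
    nonzero monodromy whose Frobenius-semisimplification is a sum of special
    representations ([tame_frobenius_of_scale]). *)
Definition tame_frobenius : Prop :=
  forall s : S, I s -> q%:R * t (phi * s * phi^-1)%g = t s.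

Lemma weil_expzS (s : S) k : weil_expz s (k + 1) = (weil_expz s k * s)%g.
Proof.
case: k => [k|[|k]]; first by rewrite /= addn1 expgSr.
  by rewrite /= expg1 mulVg.
have -> : Negz k.+1 + 1 = Negz k by rewrite !NegzE intS opprD addrAC addNr add0r.
by rewrite /= [(s ^+ k.+2)%g]expgS invgM mulgVK.
Qed.

Lemma weil_expzD (s : S) a b : weil_expz s (a + b) = (weil_expz s a * weil_expz s b)%g.
Proof.
elim/int_rec: b => [|b IHb|b IHb]; first by rewrite addr0 mulg1.
  by rewrite intS [1 + _]addrC addrA !weil_expzS IHb mulgA.
apply: (can_inj (mulgK s)); rewrite -mulgA -!weil_expzS intS opprD.
by rewrite [-1 - _]addrC addrA !subrK.
Qed.

Section OverField.
Variables (F : fieldType) (F0 : [pchar F] =i pred0).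
Variables (z : {rmorphism padic_int pP -> F}) (z_inj : injective z).
Variables (n : nat) (rho : S -> 'M[F]_n).

(** The exponential formula is given on the inertia of some finite extension only,
    but a power of each element of the inertia lies there. *)
Lemma monodromic_power N s : monodromic_with z rho N -> I s ->
  exists2 k, (0 < k)%N & forall m,
    rho (s ^+ (k * m))%g = exp_mx ((k * m)%:R *: (z (t s) *: N)).
Proof.
case=> nilN [L [j [jK rhoP]]] Is; have [k k_gt0 ILk] := inertia_of_power jK Is.
exists k => // m; rewrite expgnA rhoP; last exact: inertia_ofX.
by rewrite -expgnA tameX // rmorphM rmorph_nat scalerA.
Qed.

Lemma monodromy_unique N N' : monodromic_with z rho N -> monodromic_with z rho N' ->
  N = N'.
Proof.
move=> mN mN'; have [s Is ts] := tame_onto S 1.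
have [k k_gt0 kP] := monodromic_power mN Is; have [k' k'_gt0 kP'] := monodromic_power mN' Is.
have := kP k'; rewrite mulnC kP' ts rmorph1 !scale1r.
have km0 : (k' * k)%:R != 0 :> F.
  by rewrite ((pcharf0P F).1 F0) muln_eq0 negb_or -!lt0n k'_gt0.
have [nilN nilN'] := (mN.1, mN'.1).
move/(exp_mx_inj F0 (nilpotentZ _ nilN') (nilpotentZ _ nilN)).
by move/(scalerI km0).
Qed.

Lemma monodromyE N : monodromic_with z rho N -> monodromy z rho = N.
Proof.
move=> mN; rewrite /monodromy; case: xgetP => [N' -> mN'|/(_ N) //].
exact: monodromy_unique mN' mN.
Qed.

Hypothesis rhoR : is_rep rho.
Variable N : 'M[F]_n.
Hypothesis mN : monodromic_with z rho N.

Let nilN : nilpotent_mx N := mN.1.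

(** The exponentials of both sides are images of powers of [s i s^-1], which are
    compared by [exp_mx_inj]. *)
Lemma monodromy_conj s i : I i ->
  z (t i) *: (rho s *m N) = z (t (s * i * s^-1)%g) *: (N *m rho s).
Proof.
move=> Ii; have Ij := inertiaJ s Ii; set j := (s * i * s^-1)%g in Ij *.
have [k k_gt0 kP] := monodromic_power mN Ii; have [k' k'_gt0 kP'] := monodromic_power mN Ij.
have km0 : (k * k')%:R != 0 :> F.
  by rewrite ((pcharf0P F).1 F0) muln_eq0 negb_or -!lt0n k'_gt0 andbT.
have us := rep_unit s rhoR.
have eX m : (j ^+ m = s * i ^+ m * s^-1)%g.
  elim: m => [|m IHm]; first by rewrite !expg0 mulg1 mulgV.
  by rewrite expgS IHm /j !mulgA mulgVK expgS !mulgA.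
have := kP' k; rewrite eX mulnC; case: rhoR => _ rM.
rewrite !rM (repV _ rhoR) kP => eqE.
pose M := rho s *m ((k * k')%:R *: (z (t i) *: N)) *m invmx (rho s).
have nilM : nilpotent_mx M by apply: nilpotent_conj => //; do 2 apply: nilpotentZ.
have MP : rho s *m ((k * k')%:R *: (z (t i) *: N)) = M *m rho s by rewrite mulmxKV.
have : exp_mx M = exp_mx ((k * k')%:R *: (z (t j) *: N)).
  by rewrite -eqE (exp_mx_intertwine MP) mulmxK.
move/(exp_mx_inj F0 nilM (nilpotentZ _ (nilpotentZ _ nilN)))/(congr1 (mulmx^~ (rho s))).
by rewrite -MP -!scalemxAr -!scalemxAl => /(scalerI km0).
Qed.

Lemma inertia_comm_monodromy i : I i -> rho i *m N = N *m rho i.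
Proof.
move=> Ii; have [s Is ts] := tame_onto S 1; have := monodromy_conj i Is.
have -> : t (i * s * i^-1)%g = t s.
  rewrite (tame_add (inertiaM Ii Is) (inertiaV Ii)) (tame_add Ii Is) addrAC.
  by rewrite -(tame_add Ii (inertiaV Ii)) mulgV tame1 add0r.
by rewrite ts rmorph1 !scale1r.
Qed.

Local Notation D := (wd_of z rho).

Lemma wd_of_N : wd_N D = N.
Proof. exact: monodromyE. Qed.

Let it (s : S) := (weil_expz phi (- v s) * s)%g.

Lemma wd_ofE s : wd_r D s = rho s *m exp_mx ((- z (t (it s))) *: N).
Proof. by rewrite /= (monodromyE mN) scaleNr. Qed.

Lemma wd_of_inertia i : I i -> wd_r D i = rho i *m exp_mx ((- z (t i)) *: N).
Proof. by move=> Ii; rewrite wd_ofE /it weil_vI //= mul1g. Qed.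

Lemma wd_of_phi : wd_r D phi = rho phi.
Proof.
rewrite wd_ofE /it weil_vphi /= expg1 mulVg tame1 rmorph0 oppr0 scale0r.
by rewrite exp_mx0 mulmx1.
Qed.

(** The exponential factor is a cocycle by [monodromy_conj]. *)
Lemma wd_of_rep : is_rep (wd_r D).
Proof.
have [r1 rM] := rhoR; split.
  rewrite wd_of_inertia ?r1 ?tame1 ?rmorph0 ?oppr0 ?scale0r ?exp_mx0 ?mulmx1 //.
  exact: inertia_gen_in1.
move=> s s'; rewrite !wd_ofE rM -!mulmxA; congr (_ *m _).
have [Is Is'] : I (it s) /\ I (it s') by split; exact: weil_decomp.
pose c := (s'^-1 * it s * s')%g; have Ic : I c.
  by rewrite /c -{2}[s']invgK; exact: inertiaJ.
have eqc : rho s' *m ((- z (t c)) *: N) = ((- z (t (it s))) *: N) *m rho s'.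
  have := monodromy_conj s' Ic; rewrite /c !mulgA mulgV mul1g mulgK => eqc.
  by rewrite -scalemxAr -scalemxAl !scaleNr eqc.
rewrite [RHS]mulmxA -(exp_mx_intertwine eqc) -mulmxA; congr (_ *m _).
rewrite exp_mxD // -opprD -rmorphD -tame_add //; congr (exp_mx (- z _ *: N)).
have -> : it (s * s')%g = (it s' * c)%g.
  by rewrite /c /it weil_vM opprD addrC weil_expzD !mulgA mulgK.
by rewrite (tame_add Is' Ic) (tame_add Ic Is') addrC.
Qed.

Lemma wd_of_finite : finite_inertia (wd_r D).
Proof.
have [_ [L [j [jK rhoP]]]] := mN; have [H HI HP] := inertia_of_index jK.
exists [seq wd_r D h | h <- H] => i Ii; have [h hH ILhi] := HP i Ii.
apply/mapP; exists h => //; have [_ rM] := wd_of_rep.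
rewrite -{1}(mulVKg h i) rM; suff -> : wd_r D (h^-1 * i)%g = 1%:M by rewrite mulmx1.
by rewrite wd_of_inertia ?rhoP // ?exp_mxD ?subrr ?scale0r ?exp_mx0 //; case: ILhi.
Qed.

Lemma wd_of_smooth : exists (L : fieldExtType (ws_K S)) (j : {rmorphism L -> ws_Kbar S}),
  (forall x, j x%:A = acl_emb (ws_Kbar S) x) /\
  forall s, inertia_of j s -> wd_r D s = 1%:M.
Proof.
have [_ [L [j [jK rhoP]]]] := mN; exists L, j; split=> // s ILs.
by rewrite wd_of_inertia ?rhoP ?exp_mxD ?subrr ?scale0r ?exp_mx0 //; case: ILs.
Qed.

Lemma wd_of_inertia_comm i : I i -> wd_r D i *m N = N *m wd_r D i.
Proof.
move=> Ii; rewrite wd_of_inertia // -mulmxA.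
have -> : exp_mx ((- z (t i)) *: N) *m N = N *m exp_mx ((- z (t i)) *: N).
  by apply/esym/exp_mx_intertwine; rewrite -scalemxAl -scalemxAr.
by rewrite !mulmxA inertia_comm_monodromy.
Qed.

End OverField.

Section OverClosedField.
Variables (F : closedFieldType) (F0 : [pchar F] =i pred0).
Variables (z : {rmorphism padic_int pP -> F}) (z_inj : injective z).
Variables (n : nat) (rho : S -> 'M[F]_n) (rhoR : is_rep rho) (N : 'M[F]_n).
Hypothesis mN : monodromic_with z rho N.

Local Notation D := (wd_of z rho).
Local Notation r := (wd_r D).
Local Notation Dss := (frob_ss D).
Local Notation rss := (wd_r Dss).
Let u := unipotent_part (r phi).

Let rR : is_rep r := wd_of_rep F0 rhoR mN.
Let ug : r phi \in unitmx := rep_unit phi rR.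

Let jordan : exists s, jordan_pair (r phi) s u := unipotent_partP ug.

Let nilu : unipotent_mx u. Proof. by have [s []] := jordan. Qed.
Let uu : u \in unitmx := unipotent_unit nilu.

Lemma frob_ss_inertia i : I i -> rss i = r i.
Proof. by move=> Ii /=; rewrite weil_vI //= expr0 mulmx1. Qed.

Lemma frob_ss_phi : jordan_pair (r phi) (rss phi) u.
Proof.
have [s js] := jordan; suff -> : rss phi = s by [].
rewrite -[RHS](mulmxK uu); case: js => _ _ -> _.
by rewrite -[LHS]/(r phi *m mx_expz u (- v phi)) weil_vphi /= expr1.
Qed.

(** Conjugation by some power of [phi] fixes a given element of the finite image
    of inertia; so [u^M], hence [u], commutes with it. *)
Lemma unipotent_part_comm s : u *m r s = r s *m u.
Proof.
have rM := rR.2; have jg := frob_ss_phi.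
apply: (@frob_ind _ _ _ (weil_frobenius_generated S) (fun s => u *m r s = r s *m u)).
- by case: jg => _ _ e1 e2; rewrite -{1}e1 mulmxA e2.
- move=> i Ii; have [e eP] := wd_of_finite F0 rhoR mN.
  pose f k := r (phi ^+ k * i * (phi ^+ k)^-1)%g.
  have fe k : f k \in e by apply: eP; exact: inertiaJ.
  have [a [b [lt_ab fab]]] := pigeonhole fe.
  pose M := (b - a)%N; have M_gt0 : (0 < M)%N by rewrite subn_gt0.
  have cM : r i *m r phi ^+ M = r phi ^+ M *m r i.
    have ri : r i = r (phi ^+ M * i * (phi ^+ M)^-1)%g.
      have := congr1 (fun X => r (phi ^+ a)^-1%g *m X *m r (phi ^+ a)%g) fab.
      rewrite /f -!rM !mulgA mulVg mul1g !mulgVK => ->.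
      have -> : (phi ^+ b = phi ^+ a * phi ^+ M)%g.
        by rewrite -expgnDr subnKC // ltnW.
      by rewrite invgM !mulgA mulVg mul1g mulgVK.
    by rewrite -(repX phi M rR) [in LHS]ri -!rM mulgVK.
  apply: esym; apply: (unipotent_comm_root F0 M_gt0 nilu).
  exact: (jordan_comm (unitX_mx M ug) (jordanX M jg) cM).2.
- by move=> s1 s2 us us'; rewrite rM mulmxA us -mulmxA us' mulmxA.
- by move=> s1 us; rewrite repV //; exact: mx_comm_inv.
Qed.

(** The conjugation by [phi] scales [N], so it commutes with [u] and the
    semisimple part of [rho phi] scales it by the same factor. *)
Lemma frob_ss_scale i : I i -> t i = 1 -> N != 0 ->
  u *m N = N *m u /\
  rss phi *m N = z (t (phi * i * phi^-1)%g) *: (N *m rss phi).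
Proof.
move=> Ii ti N0; set c := z _; have jg := frob_ss_phi.
have gN : r phi *m N = c *: (N *m r phi).
  rewrite (wd_of_phi F0 mN) /c -(monodromy_conj F0 rhoR mN phi Ii) ti rmorph1.
  by rewrite scale1r.
have c0 : c != 0.
  apply: contra_neq N0 => c0; apply: (can_inj (mulKmx ug)).
  by rewrite mulmx0 gN c0 scale0r.
have ucg : c *: r phi \in unitmx by rewrite unitmxZ ?unitfE.
have Ng : N *m (c *: r phi) = r phi *m N by rewrite gN -scalemxAr.
have [Ns Nu] := jordan_intertwine ucg ug (jordanZ c0 jg) jg Ng.
by split; [rewrite Nu | rewrite -Ns -scalemxAr].
Qed.

Lemma unipotent_part_monodromy : u *m N = N *m u.
Proof.
have [->|N0] := eqVneq N 0; first by rewrite mulmx0 mul0mx.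
by have [i Ii ti] := tame_onto S 1; case: (frob_ss_scale Ii ti N0).
Qed.

(** The semisimple part of [rho phi] scales [N] as [rho phi] does, which determines
    the effect of conjugation by [phi] on the tame character. *)
Lemma tame_frobenius_of_scale : N != 0 ->
  rss phi *m N = q%:R^-1 *: (N *m rss phi) -> tame_frobenius.
Proof.
move=> N0 sN i Ii; have [i1 Ii1 ti1] := tame_onto S 1.
have q0 : q%:R != 0 :> F.
  by rewrite ((pcharf0P F).1 F0) -lt0n ltnW // residue_card_gt1.
have us : rss phi \in unitmx.
  have jg := frob_ss_phi; case: jg => _ _ e1 _; move: ug; rewrite -e1 unitmx_mul.
  by case/andP.
have Ns0 : N *m rss phi != 0.
  by apply: contra_neq N0 => Ns; rewrite -[N](mulmxK us) Ns mul0mx.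
have Ng0 : N *m rho phi != 0.
  by apply: contra_neq N0 => Ns; rewrite -[N](mulmxK (rep_unit phi rhoR)) Ns mul0mx.
have scI (a b : F) (A : 'M[F]_n) : A != 0 -> a *: A = b *: A -> a = b.
  move=> A0 /eqP; rewrite -subr_eq0 -scalerBl scaler_eq0 (negPf A0) orbF subr_eq0.
  by move/eqP.
have c1 : z (t (phi * i1 * phi^-1)%g) = q%:R^-1.
  apply: (scI _ _ _ Ns0); rewrite -sN.
  by case: (frob_ss_scale Ii1 ti1 N0).
have m1 := monodromy_conj F0 rhoR mN phi Ii1.
have m2 := monodromy_conj F0 rhoR mN phi Ii.
move: m1; rewrite ti1 rmorph1 scale1r c1 => m1.
move: m2; rewrite m1 scalerA => /(scI _ _ _ Ng0) m2.
by apply: z_inj; rewrite rmorphM rmorph_nat -m2 mulrCA mulfV ?mulr1.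
Qed.

Lemma frob_ss_rep : is_rep rss.
Proof. exact (unipotent_twist_rep nilu rR unipotent_part_comm). Qed.

Definition frob_char (s : S) : F := q%:R ^ (- v s).

Lemma frob_char_neq0 s : frob_char s != 0.
Proof.
rewrite /frob_char expfz_neq0 // ((pcharf0P F).1 F0) -lt0n.
exact: ltnW (residue_card_gt1 S).
Qed.

Lemma frob_charM : {morph frob_char : s s' / (s * s')%g >-> s * s'}.
Proof.
move=> s s'; rewrite /frob_char weil_vM opprD expfzDr // ((pcharf0P F).1 F0) -lt0n.
exact: ltnW (residue_card_gt1 S).
Qed.

Lemma frob_charI i : I i -> frob_char i = 1.
Proof. by move=> Ii; rewrite /frob_char weil_vI // oppr0 expr0z. Qed.

Lemma frob_char1 : frob_char 1%g = 1.
Proof. by rewrite /frob_char weil_v1 oppr0 expr0z. Qed.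

(** A relation [A s N = frob_char s N A s] is multiplicative in [s]. *)
Lemma frob_tw_gen m (A : S -> 'M[F]_m) M : is_rep A ->
  (forall i, I i -> A i *m M = M *m A i) -> A phi *m M = q%:R^-1 *: (M *m A phi) ->
  tw frob_char 1 A A M.
Proof.
move=> rA AI Aphi; have [_ AM] := rA.
apply: (@frob_ind _ _ _ (weil_frobenius_generated S)
  (fun s => A s *m M = frob_char s ^ 1 *: (M *m A s))).
- by rewrite Aphi expr1z /frob_char weil_vphi -invr_expz expr1z.
- by move=> i Ii; rewrite AI // frob_charI // expr1z scale1r.
- move=> s s'; rewrite !expr1z => sM s'M; rewrite AM frob_charM -mulmxA s'M.
  by rewrite -scalemxAr mulmxA sM -scalemxAl scalerA mulrC mulmxA.
- move=> s; rewrite !expr1z => sM; have us := rep_unit s rA.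
  have -> : frob_char s^-1%g = (frob_char s)^-1.
    by apply: (mulfI (frob_char_neq0 s)); rewrite -frob_charM mulgV frob_char1 mulfV ?frob_char_neq0.
  rewrite repV //; apply: (can_inj (mulmxK us)); apply: (can_inj (mulKmx us)).
  rewrite -scalemxAl -(mulmxA M) mulVmx // mulmx1 -scalemxAr sM scalerA.
  by rewrite mulVf ?frob_char_neq0 // scale1r mulmxA mulKVmx.
Qed.

Theorem frob_ss_good_wd : N = 0 \/ tame_frobenius ->
  good_wd I phi frob_char rss (wd_N Dss).
Proof.
move=> HN; have jg := frob_ss_phi; have -> : wd_N Dss = N := wd_of_N F0 mN.
split; [split | exact: mN.1 |].
- exact: frob_ss_rep.
- have [e eP] := wd_of_finite F0 rhoR mN.
  by exists e => i Ii; rewrite frob_ss_inertia // eP.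
- by case: jg.
- apply: frob_tw_gen => [|i Ii|]; first exact: frob_ss_rep.
    by rewrite frob_ss_inertia // wd_of_inertia_comm.
  case: HN => [->|tf]; first by rewrite mulmx0 mul0mx scaler0.
  have [->|N0] := eqVneq N 0; first by rewrite mulmx0 mul0mx scaler0.
  have [i Ii ti] := tame_onto S 1; have [_ ->] := frob_ss_scale Ii ti N0.
  congr (_ *: _); have q0 : q%:R != 0 :> F.
    by rewrite ((pcharf0P F).1 F0) -lt0n ltnW // residue_card_gt1.
  apply: (mulfI q0); rewrite mulfV // -(rmorph_nat z) -rmorphM tf //.
  by rewrite ti rmorph1.
Qed.

(** [r s] and [rss s] differ by a unipotent factor commuting with everything. *)
Theorem frob_ss_trace s j B : N = 0 \/ tame_frobenius ->
  N ^+ j *m B *m N ^+ j = N ^+ j ->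
  \tr (rss s *m (N ^+ j *m B)) = \tr (r s *m (N ^+ j *m B)).
Proof.
move=> HN NBN; have [_ _] := frob_ss_good_wd HN.
have -> : wd_N Dss = N := wd_of_N F0 mN.
move=> tN; have tj := tw_exp (frob_char_neq0) j tN.
have [rM uN] := (unipotent_part_comm, unipotent_part_monodromy).
have [C rC] : exists C, r s *m N ^+ j = N ^+ j *m C.
  have rE : r s = rss s *m mx_expz u (v s).
    rewrite -[rss s]/(r s *m mx_expz u _) -(mulmxA (r s)) (mx_expzD nilu) addNr /= expr0.
    by rewrite mulmx1.
  have cN : mx_expz u (v s) *m N ^+ j = N ^+ j *m mx_expz u (v s).
    by apply/esym/expz_comm; rewrite !mulmxE; apply/commr_sym/commrX.
  exists (frob_char s ^ j%:Z *: (rss s *m mx_expz u (v s))).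
  rewrite rE -(mulmxA (rss s)) cN (mulmxA (rss s)) (tw_exp frob_char_neq0 j tN).
  by rewrite -scalemxAl -scalemxAr -(mulmxA (N ^+ j)).
rewrite -(unipotent_twist_trace nilu unipotent_part_comm _ rC NBN) //.
by rewrite !mulmxE; apply: commrX; exact: uN.
Qed.

End OverClosedField.

End MonodromicReps.

(** * Direct sums of special representations *)

Section BlockDiagonal.
Variables (F : fieldType) (m : nat) (n : 'I_m -> nat).
Implicit Types A B : forall i, 'M[F]_(n i).

Lemma mxdiagM A B : (\mxdiag_i A i) *m (\mxdiag_i B i) = \mxdiag_i (A i *m B i).
Proof.
rewrite [in RHS]/mxdiag mul_mxdiag_mxblock; apply: eq_mxblock => i j.
by case: eqP => [e|_]; [subst j; rewrite !conform_mx_id | rewrite mulmx0].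
Qed.

Lemma mxdiagX A k : (\mxdiag_i A i) ^+ k = \mxdiag_i (A i ^+ k).
Proof.
elim: k => [|k IHk].
  rewrite expr0 -[LHS]/(1%:M) -mxdiagZ; apply: eq_mxdiag => i.
  by rewrite expr0.
rewrite exprS IHk -mulmxE mxdiagM; apply: eq_mxdiag => i.
by rewrite exprS.
Qed.

Lemma mxdiagZm a A : a *: (\mxdiag_i A i) = \mxdiag_i (a *: A i).
Proof.
rewrite -mul_scalar_mx -mxdiagZ mxdiagM; apply: eq_mxdiag => i.
by rewrite mul_scalar_mx.
Qed.

Lemma mxdiag_unit A : (forall i, A i \in unitmx) -> \mxdiag_i A i \in unitmx.
Proof.
move=> uA; have : (\mxdiag_i A i) *m (\mxdiag_i invmx (A i)) = 1%:M.
  by rewrite mxdiagM -mxdiagZ; apply: eq_mxdiag => i; rewrite mulmxV.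
by case/mulmx1_unit.
Qed.

Lemma diagable_mxdiag A : (forall i, diagable (A i)) -> diagable (\mxdiag_i A i).
Proof.
move=> dA; pose P i := projT1 (cid (dA i)); have PP i := projT2 (cid (dA i)).
pose D i := projT1 (cid (PP i)); have DP i := projT2 (cid (PP i)).
exists (\mxdiag_i P i), (\mxrow_i D i); split.
  by apply: mxdiag_unit => i; case: (DP i).
rewrite diag_mxrow !mxdiagM; apply: eq_mxdiag => i.
by case: (DP i).
Qed.

(** Finiteness of a family of products, through the indices of the factors. *)
Lemma mxdiag_finite (T : Type) (Q : T -> Prop) (A : forall i, T -> 'M[F]_(n i)) :
  (forall i, exists e : seq 'M[F]_(n i), forall s, Q s -> A i s \in e) ->
  exists e : seq 'M[F]_(\sum_i n i), forall s, Q s -> (\mxdiag_i A i s) \in e.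
Proof.
move=> fA; pose e i := projT1 (cid (fA i)); have eP i := projT2 (cid (fA i)).
pose M := (\max_i size (e i))%N.
exists [seq \mxdiag_i nth 0 (e i) ((f : {ffun 'I_m -> 'I_M.+1}) i)
  | f <- enum {: {ffun 'I_m -> 'I_M.+1}}] => s Qs.
apply/mapP; exists [ffun i => inord (index (A i s) (e i))]; first by rewrite mem_enum.
apply: eq_mxdiag => i; rewrite ffunE inordK ?nth_index ?eP // ltnS.
by apply: leq_trans (index_size _ _) _; exact: (leq_bigmax (F := fun i => size (e i))).
Qed.

End BlockDiagonal.

Section SpecialRepresentations.
Variables (p l : nat) (pP : prime p) (lP : prime l) (S : weil_setup pP lP).
Variables (F : closedFieldType) (F0 : [pchar F] =i pred0).

Local Notation I := (fun s : S => inertia (weil_val s)).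
Local Notation v := (@ws_v _ _ _ _ S).
Local Notation q := (ws_q S).
Local Notation phi := (ws_phi S : S).
Local Notation kap := (@frob_char _ _ _ _ S F).
Local Notation good := (good_rep I phi).

Lemma good_wd_sum m (n : 'I_m -> nat) (D : forall i, wd_rep S F (n i)) :
  (forall i, good_wd I phi kap (wd_r (D i)) (wd_N (D i))) ->
  good_wd I phi kap (wd_r (wd_sum D)) (wd_N (wd_sum D)).
Proof.
move=> gD; split; [split|..].
- split=> [|s s'] /=.
    by rewrite -mxdiagZ; apply: eq_mxdiag => i; case: (gD i) => -[[]].
  by rewrite mxdiagM; apply: eq_mxdiag => i; case: (gD i) => -[[]].
- by apply: mxdiag_finite => i; case: (gD i) => -[].
- by apply: diagable_mxdiag => i; case: (gD i) => -[].
- exists (\sum_i n i)%N; rewrite /= mxdiagX -[RHS]mxdiag0; apply: eq_mxdiag => i.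
  have [_ /nilpotentXn Nn _] := gD i.
  by rewrite (bigD1 i) //= exprD Nn mul0r.
- move=> s; rewrite /= !mxdiagM mxdiagZm; apply: eq_mxdiag => i.
  by case: (gD i) => _ _ ->.
Qed.

(** The Kronecker product of [c] and the identity. *)
Definition blk t d (c : 'M[F]_t) : 'M[F]_(\sum_(i < t) d) :=
  \mxblock_(i < t, j < t) ((c i j)%:M : 'M[F]_d).

Lemma blkM t d (c c' : 'M[F]_t) : blk d c *m blk d c' = blk d (c *m c').
Proof.
rewrite /blk mul_mxblock; apply: eq_mxblock => i j; rewrite mxE raddf_sum.
by apply: eq_bigr => k _ /=; rewrite -scalar_mxM.
Qed.

Lemma blk1 t d : blk d (1%:M : 'M[F]_t) = 1%:M.
Proof.
rewrite -mxdiagZ /mxdiag; apply: eq_mxblock => i j; rewrite mxE.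
by case: eqP => [e|_]; [subst j; rewrite conform_mx_id | rewrite raddf0].
Qed.

Lemma blkX t d (c : 'M[F]_t) k : blk d c ^+ k = blk d (c ^+ k).
Proof.
elim: k => [|k IHk]; first by rewrite !expr0 -[1]/(1%:M) -[1 in RHS]/(1%:M) blk1.
by rewrite !exprS IHk -!mulmxE blkM.
Qed.

(** The [k]-th power of the nilpotent Jordan block. *)
Definition shift t k : 'M[F]_t := \matrix_(i, j) (i == j + k :> nat)%N%:R.

Lemma sum_delta t (f g : 'I_t -> bool) (k : 'I_t) : f k -> (forall i, f i -> i = k) ->
  \sum_i (f i)%:R * (g i)%:R = (g k)%:R :> F.
Proof.
move=> fk fP; rewrite (bigD1 k) //= fk mul1r big1 ?addr0 // => i ik.
by case fi: (f i); rewrite ?mul0r //; case/eqP: ik; exact: fP.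
Qed.

Lemma shiftS t k : shift t 1 *m shift t k = shift t k.+1.
Proof.
apply/matrixP => i j; rewrite !mxE; under eq_bigr do rewrite !mxE.
case: i => [[|i] lt_it] /=.
  rewrite addnS big1 // => h _.
  by rewrite addn1 mul0r.
have lt_i : (i < t)%N by exact: ltnW.
rewrite (@sum_delta _ (fun h => i.+1 == h + 1)%N (fun h => h == j + k :> nat)%N (Ordinal lt_i)) /=.
- by rewrite addnS eqSS.
- by rewrite addn1.
- by move=> h /eqP; rewrite addn1 => -[ih]; exact/val_inj.
Qed.

Lemma shiftX t k : shift t 1 ^+ k = shift t k.
Proof.
elim: k => [|k IHk]; last by rewrite exprS IHk -mulmxE shiftS.
by rewrite expr0; apply/matrixP => i j; rewrite !mxE addn0.
Qed.

Lemma shift_proj t k i j :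
  (shift t k *m (shift t k)^T) i j = ((i == j) && (k <= i)%N)%:R.
Proof.
rewrite mxE; under eq_bigr do rewrite !mxE.
have [le_ki|lt_ik] := leqP k i; last first.
  rewrite andbF big1 // => h _; case: eqP => [ih|_]; last by rewrite mul0r.
  by move: lt_ik; rewrite ih ltnNge leq_addl.
have lt_i : (i - k < t)%N by apply: leq_ltn_trans (leq_subr _ _) (ltn_ord i).
rewrite (@sum_delta _ (fun h => i == h + k :> nat)%N (fun h => j == h + k :> nat)%N
  (Ordinal lt_i)) /=.
- by rewrite subnK // andbT eq_sym.
- by rewrite subnK.
- by move=> h /eqP ih; apply/val_inj; rewrite /= ih addnK.
Qed.

Lemma shift_ginv t k : shift t k *m (shift t k)^T *m shift t k = shift t k.
Proof.
apply/matrixP => i j; rewrite mxE; under eq_bigr do rewrite shift_proj mxE.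
rewrite mxE; have [le_ki|lt_ik] := leqP k i.
  rewrite (@sum_delta _ (fun h => (i == h) && true)%N (fun h => h == j + k :> nat)%N i) //.
    by rewrite eqxx.
  by move=> h /andP[/eqP].
rewrite big1 => [|h _]; last by rewrite andbF mul0r.
by case: eqP => // ij; move: lt_ik; rewrite ij ltnNge leq_addl.
Qed.

Lemma wd_spN t d (r : S -> 'M[F]_d) : wd_N (wd_sp t r) = blk d (shift t 1).
Proof. by apply: eq_mxblock => i j; rewrite mxE addn1. Qed.

Lemma wd_spr t d (r : S -> 'M[F]_d) s :
  wd_r (wd_sp t r) s = \mxdiag_(i < t) (kap s ^+ i *: r s).
Proof.
apply: eq_mxdiag => i; congr (_ *: _).
by rewrite /frob_char -mulNr -exprz_exp.
Qed.

Lemma good_wd_sp t d (r : S -> 'M[F]_d) : good r ->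
  good_wd I phi kap (wd_r (wd_sp t r)) (wd_N (wd_sp t r)).
Proof.
case=> -[r1 rM] [e eP] [P [D [uP PD]]]; split; [split|..].
- split=> [|s s']; rewrite !wd_spr.
    by rewrite -mxdiagZ; apply: eq_mxdiag => i; rewrite frob_char1 expr1n scale1r r1.
  rewrite mxdiagM; apply: eq_mxdiag => i.
  by rewrite (frob_charM F0) exprMn rM -scalemxAl -scalemxAr scalerA.
- have [E EP] : exists E : seq 'M[F]_(\sum_(i < t) d), forall s, I s ->
      (\mxdiag_(i < t) r s) \in E.
    by apply: mxdiag_finite => i; exists e.
  exists E => s Is; rewrite wd_spr.
  by under eq_mxdiag do rewrite frob_charI // expr1n scale1r; exact: EP.
- rewrite wd_spr; apply: diagable_mxdiag => i; exists P, (kap phi ^+ i *: D); split=> //.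
  by rewrite -scalemxAr PD scalemxAl -linearZ.
- exists t; rewrite wd_spN blkX shiftX; apply/mxblockP => i j.
  rewrite mxblockK submxblock0 mxE; case: eqP => [ij|_]; last by rewrite raddf0.
  by have := ltn_ord i; rewrite ij ltnNge leq_addl.
- move=> s; rewrite wd_spN wd_spr /blk mul_mxdiag_mxblock mul_mxblock_mxdiag.
  rewrite expr1z -mul_scalar_mx -mxdiagZ mul_mxdiag_mxblock; apply: eq_mxblock => i j.
  rewrite !mxE; case: eqP => [->|_]; last by rewrite raddf0 mulmx0 mul0mx mulmx0.
  by rewrite mulmx1 mul1mx mul_scalar_mx scalerA addn1 exprS.
Qed.

Lemma sp_image_trace t d (r : S -> 'M[F]_d) k s :
  exists B, wd_N (wd_sp t r) ^+ k *m B *m wd_N (wd_sp t r) ^+ k = wd_N (wd_sp t r) ^+ k /\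
  \tr (wd_r (wd_sp t r) s *m (wd_N (wd_sp t r) ^+ k *m B)) =
    \sum_(i < t | (k <= i)%N) kap s ^+ i * \tr (r s).
Proof.
exists (blk d (shift t k)^T); rewrite wd_spN blkX shiftX !blkM shift_ginv; split=> //.
rewrite wd_spr /blk mul_mxdiag_mxblock mxtrace_mxblock [RHS]big_mkcond.
apply: eq_bigr => i _; rewrite shift_proj eqxx /=.
case: leqP => _; last by rewrite raddf0 mulmx0 mxtrace0.
by rewrite mulmx1 mxtraceZ.
Qed.

Lemma sum_image_trace m (n : 'I_m -> nat) (D : forall i, wd_rep S F (n i)) k s
    (th : 'I_m -> F) :
  (forall i, exists B, wd_N (D i) ^+ k *m B *m wd_N (D i) ^+ k = wd_N (D i) ^+ k /\
    \tr (wd_r (D i) s *m (wd_N (D i) ^+ k *m B)) = th i) ->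
  exists B, wd_N (wd_sum D) ^+ k *m B *m wd_N (wd_sum D) ^+ k = wd_N (wd_sum D) ^+ k /\
    \tr (wd_r (wd_sum D) s *m (wd_N (wd_sum D) ^+ k *m B)) = \sum_i th i.
Proof.
move=> DB; pose B i := projT1 (cid (DB i)); have BP i := projT2 (cid (DB i)).
exists (\mxdiag_i B i); rewrite /= mxdiagX !mxdiagM; split.
  by apply: eq_mxdiag => i; case: (BP i).
by rewrite mxtrace_mxdiag; apply: eq_bigr => i _; case: (BP i).
Qed.

(** The trace of [s] on the image of [N^k] in a sum of special representations. *)
Definition sp_char m (t : 'I_m -> nat) (chi : 'I_m -> F) (kp : F) k : F :=
  \sum_i \sum_(j < t i | (k <= j)%N) kp ^+ j * chi i.

Lemma sum_sp_image_trace m (t d : 'I_m -> nat) (r : forall i, S -> 'M[F]_(d i)) k s :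
  let D := wd_sum (fun i => wd_sp (t i) (r i)) in
  exists B, wd_N D ^+ k *m B *m wd_N D ^+ k = wd_N D ^+ k /\
    \tr (wd_r D s *m (wd_N D ^+ k *m B)) = sp_char t (fun i => \tr (r i s)) (kap s) k.
Proof. by apply: sum_image_trace => i; exact: sp_image_trace. Qed.

Lemma good_wd_sum_sp m (t d : 'I_m -> nat) (r : forall i, S -> 'M[F]_(d i)) :
  (forall i, good (r i)) ->
  let D := wd_sum (fun i => wd_sp (t i) (r i)) in
  good_wd I phi kap (wd_r D) (wd_N D).
Proof. by move=> gr; apply: good_wd_sum => i; exact: good_wd_sp. Qed.

End SpecialRepresentations.

(** * Specialization of Weil-Deligne representations *)

Section Comparison.
Variables (p l : nat) (pP : prime p) (lP : prime l) (S : weil_setup pP lP).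

Local Notation I := (fun s : S => inertia (weil_val s)).
Local Notation v := (@ws_v _ _ _ _ S).
Local Notation q := (ws_q S).
Local Notation phi := (ws_phi S : S).
Local Notation kap F := (@frob_char _ _ _ _ S F).

Section Transport.
Variables (F : closedFieldType) (F0 : [pchar F] =i pred0).

(** The representations considered as [s_i] in [Sp_t(s_i)]. *)
Definition unramified_twist n (r : S -> 'M[F]_n) : Prop :=
  [/\ is_rep r, exists e : seq 'M[F]_n, forall s, I s -> r s \in e
    & exists M c, (0 < M)%N /\ r phi ^+ M = c%:M].

Lemma unramified_twist_good n (r : S -> 'M[F]_n) : unramified_twist r -> good_rep I phi r.
Proof.
case=> rr fr [M [c [M_gt0 rM]]]; split=> //; case: n r rr fr rM => [|n] r rr fr rM.
  exact: diagable_size0.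
apply: (diagable_finite_order F0 M_gt0 _ rM).
apply/eqP => c0; have := unitX_mx M (rep_unit phi rr).
by rewrite rM c0 raddf0 -row_full_unit /row_full mxrank0.
Qed.

(** By [trace_on_image] any generalized inverse may be used, for instance one that is
    transported by the isomorphism. *)
Lemma iso_image_trace n n' (D : wd_rep S F n) (D' : wd_rep S F n') j s th :
  good_wd I phi (kap F) (wd_r D) (wd_N D) -> wd_iso D D' ->
  (exists B, wd_N D' ^+ j *m B *m wd_N D' ^+ j = wd_N D' ^+ j /\
    \tr (wd_r D' s *m (wd_N D' ^+ j *m B)) = th) ->
  forall B, wd_N D ^+ j *m B *m wd_N D ^+ j = wd_N D ^+ j ->
  \tr (wd_r D s *m (wd_N D ^+ j *m B)) = th.
Proof.
move=> [_ _ tN] [P [Q [PQ QP Pr PN]]] [B' [B'P <-]] B BP.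
have PNj := intertwineX j PN.
have NQ : wd_N D ^+ j *m Q = Q *m wd_N D' ^+ j.
  by rewrite -[LHS]mul1mx -QP -mulmxA (mulmxA P) PNj -mulmxA PQ mulmx1.
have B1 : wd_N D ^+ j *m (Q *m B' *m P) *m wd_N D ^+ j = wd_N D ^+ j.
  rewrite !mulmxA NQ -(mulmxA _ P) PNj !mulmxA -(mulmxA Q) -(mulmxA Q) B'P.
  by rewrite -mulmxA -PNj mulmxA QP mul1mx.
have rN : wd_r D s *m wd_N D ^+ j = wd_N D ^+ j *m (kap F s ^ j%:Z *: wd_r D s).
  by rewrite (tw_exp (frob_char_neq0 F0) j tN) scalemxAr.
rewrite (trace_on_image rN BP B1).
move: (wd_r D s) (wd_r D' s) (Pr s) (wd_N D ^+ j) (wd_N D' ^+ j) PNj.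
move=> X X' PX A A' PA; rewrite (_ : X *m _ = X *m A *m Q *m B' *m P) ?mulmxA //.
rewrite mxtrace_mulC !mulmxA PX.
by rewrite -(mulmxA X' P A) PA !mulmxA -(mulmxA _ P Q) PQ mulmx1.
Qed.

Variables (z : {rmorphism padic_int pP -> F}) (z_inj : injective z).
Variables (n : nat) (rho : S -> 'M[F]_n) (rhoR : is_rep rho) (N : 'M[F]_n).
Hypothesis mN : monodromic_with z rho N.

Lemma iso_tame_frobenius n' (D' : wd_rep S F n') :
  good_wd I phi (kap F) (wd_r D') (wd_N D') -> wd_iso (frob_ss (wd_of z rho)) D' ->
  N = 0 \/ tame_frobenius S.
Proof.
move=> [_ _ tN'] [P [Q [PQ QP Pr PN]]].
have [->|N0] := eqVneq N 0; [by left | right].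
apply: (tame_frobenius_of_scale F0 z_inj rhoR mN N0).
have NE : wd_N (frob_ss (wd_of z rho)) = N := wd_of_N F0 mN.
move: (Pr phi) PN (tN' phi); rewrite NE expr1z /frob_char weil_vphi -invr_expz expr1z.
move: (wd_r _ phi) (wd_r D' phi) (wd_N D') => X X' N' PX PN XN.
rewrite -[LHS]mul1mx -[RHS]mul1mx -QP -!mulmxA; congr (Q *m _).
rewrite (mulmxA P X) PX -(mulmxA X') PN (mulmxA X') XN -scalemxAl -scalemxAr.
by rewrite (mulmxA P N) PN -!mulmxA PX.
Qed.

Variables (m : nat) (t d : 'I_m -> nat) (sg : forall i, S -> 'M[F]_(d i)).
Hypothesis sgP : forall i, unramified_twist (sg i).
Hypothesis decomp : wd_iso (frob_ss (wd_of z rho)) (wd_sum (fun i => wd_sp (t i) (sg i))).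

Lemma sum_sp_good : good_wd I phi (kap F) (wd_r (wd_sum (fun i => wd_sp (t i) (sg i))))
  (wd_N (wd_sum (fun i => wd_sp (t i) (sg i)))).
Proof. by apply: good_wd_sum_sp => // i; exact: unramified_twist_good. Qed.

Lemma decomp_tame_frobenius : N = 0 \/ tame_frobenius S.
Proof. exact: iso_tame_frobenius sum_sp_good decomp. Qed.

Lemma decomp_trace j s B : N ^+ j *m B *m N ^+ j = N ^+ j ->
  \tr (wd_r (wd_of z rho) s *m (N ^+ j *m B)) =
    sp_char t (fun i => \tr (sg i s)) (kap F s) j.
Proof.
move=> NB; rewrite -(frob_ss_trace F0 rhoR mN s decomp_tame_frobenius NB).
have gD := frob_ss_good_wd F0 rhoR mN decomp_tame_frobenius.
have NE : wd_N (frob_ss (wd_of z rho)) = N := wd_of_N F0 mN.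
have := iso_image_trace (s := s) gD decomp (sum_sp_image_trace t sg j s) (B := B).
by rewrite NE; apply.
Qed.

End Transport.

Lemma kap_specialize (K E : closedFieldType) (P : place K E) (s : S) : [pchar E] =i pred0 ->
  P (kap K s) (kap E s).
Proof.
move=> E0; apply: pl_expz; first exact: pl_nat.
by rewrite ((pcharf0P E).1 E0) -lt0n ltnW // residue_card_gt1.
Qed.

Lemma wd_of_specialize (K E : fieldType) (K0 : [pchar K] =i pred0) (E0 : [pchar E] =i pred0)
    (zK : {rmorphism padic_int pP -> K}) (zE : {rmorphism padic_int pP -> E})
    (P : place K E) (Pz : forall a, P (zK a) (zE a)) n
    (rK : S -> 'M[K]_n) (rE : S -> 'M[E]_n) (Pr : forall s, mpl P (rK s) (rE s)) NK NE
    (mK : monodromic_with zK rK NK) (mE : monodromic_with zE rE NE)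
    (PN : mpl P NK NE) s :
  mpl P (wd_r (wd_of zK rK) s) (wd_r (wd_of zE rE) s).
Proof.
rewrite !(wd_ofE _ mK, wd_ofE _ mE) //; apply: mplM => //; apply: mpl_exp_mx => //.
by apply: mplZ => //; apply: plN; exact: Pz.
Qed.

Section Specialization.
Variables (K E : closedFieldType) (K0 : [pchar K] =i pred0) (E0 : [pchar E] =i pred0).
Variables (zK : {rmorphism padic_int pP -> K}) (zE : {rmorphism padic_int pP -> E}).
Hypotheses (zK_inj : injective zK) (zE_inj : injective zE).
Variables (P : place K E) (Pz : forall a, P (zK a) (zE a)).
Variables (n : nat) (rK : S -> 'M[K]_n) (rE : S -> 'M[E]_n).
Hypotheses (rKR : is_rep rK) (rER : is_rep rE) (Pr : forall s, mpl P (rK s) (rE s)).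
Variables (NK : 'M[K]_n) (NE : 'M[E]_n).
Hypotheses (mK : monodromic_with zK rK NK) (mE : monodromic_with zE rE NE).
Hypothesis PN : mpl P NK NE.

Lemma monodromy_specialize0 : NK = 0 -> NE = 0.
Proof. by move=> NK0; apply: (mpl_fun PN) => i j; rewrite NK0 !mxE; exact: pl0. Qed.

Variables (m : nat) (t d : 'I_m -> nat).
Variables (sK : forall i, S -> 'M[K]_(d i)) (sE : forall i, S -> 'M[E]_(d i)).
Hypotheses (sKP : forall i, unramified_twist (sK i)) (sEP : forall i, unramified_twist (sE i)).
Hypothesis Ps : forall i s, mpl P (sK i s) (sE i s).
Hypothesis decomp : wd_iso (frob_ss (wd_of zK rK)) (wd_sum (fun i => wd_sp (t i) (sK i))).

Lemma sp_char_specialize j s :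
  P (sp_char t (fun i => \tr (sK i s)) (kap K s) j) (sp_char t (fun i => \tr (sE i s)) (kap E s) j).
Proof.
apply: pl_sum => i _; apply: pl_sum => h _; apply: plM; last by apply: pl_trace; exact: Ps.
by apply: plX; exact: kap_specialize.
Qed.

Lemma specialize_tame_frobenius : NE = 0 \/ tame_frobenius S.
Proof.
case: (decomp_tame_frobenius K0 zK_inj rKR mK sKP decomp) => [/monodromy_specialize0|]; auto.
Qed.

(** When the ranks of the powers of [N] are preserved, a common minor gives
    generalized inverses that specialize; so do then the traces on the images of
    the powers of [N], which determine both sides. *)
Theorem specialize_decomp : (forall j, \rank (NK ^+ j) = \rank (NE ^+ j)) ->
  wd_iso (frob_ss (wd_of zE rE)) (wd_sum (fun i => wd_sp (t i) (sE i))).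
Proof.
move=> rkN.
have gE := frob_ss_good_wd E0 rER mE specialize_tame_frobenius.
have gS := sum_sp_good E0 t sEP.
have NEE : wd_N (frob_ss (wd_of zE rE)) = NE := wd_of_N E0 mE.
have [|||||T [U [TU UT Tr TN]]] :=
  wd_iso_of_image_traces (weil_frobenius_generated S) E0 _ _ _ _ gE gS.
- exact: frob_char_neq0.
- exact: frob_char1.
- exact: frob_charM.
- exact: frob_charI.
- move=> j s; rewrite NEE.
  have [BK [BE [PB KB EB]]] := mpl_ginv (mplX j PN) (rkN j).
  have [B' [B'1 B'2]] := sum_sp_image_trace t sE j s.
  exists BE, B'; split=> //; rewrite B'2.
  rewrite (frob_ss_trace E0 rER mE s specialize_tame_frobenius EB).
  apply: pl_fun (sp_char_specialize j s).
  rewrite -(decomp_trace K0 zK_inj rKR mK sKP decomp s KB); apply: pl_trace.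
  by apply: mplM; [exact: (wd_of_specialize K0 E0 Pz Pr mK mE PN) | apply: mplM => //; exact: mplX].
by exists T, U; split=> // s; rewrite -Tr.
Qed.

End Specialization.
End Comparison.

Section SpecializedData.
Variables (p l : nat) (pP : prime p) (lP : prime l) (S : weil_setup pP lP).

Local Notation I := (fun s : S => inertia (weil_val s)).
Local Notation phi := (ws_phi S : S).

Lemma mpl_rep (K E : fieldType) (P : place K E) n (r : S -> 'M[K]_n) (r' : S -> 'M[E]_n) :
  is_rep r -> (forall s, mpl P (r s) (r' s)) -> is_rep r'.
Proof.
case=> r1 rM Pr; split=> [|s s']; apply: (mpl_fun (P := P)).
- exact: Pr.
- by rewrite r1; apply: mpl_scalar; exact: pl1.
- exact: Pr.
- by rewrite rM; exact: mplM.
Qed.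

Lemma mpl_monodromic (K E : fieldType) (P : place K E) (E0 : [pchar E] =i pred0)
    (zK : padic_int pP -> K) (zE : padic_int pP -> E) n
    (r : S -> 'M[K]_n) (r' : S -> 'M[E]_n) N N' :
  (forall a, P (zK a) (zE a)) -> (forall s, mpl P (r s) (r' s)) -> mpl P N N' ->
  monodromic_with zK r N -> monodromic_with zE r' N'.
Proof.
move=> Pz Pr PN [[k Nk] [L [j [jK rP]]]]; split.
  exists k; apply: (mpl_fun (P := P)) (mplX k PN) _.
  by move=> i h; rewrite Nk !mxE; exact: pl0.
exists L, j; split=> // s Is; apply: (mpl_fun (P := P)) (Pr s) _.
by rewrite rP //; apply: mpl_exp_mx => //; exact: mplZ.
Qed.

Lemma mpl_unramified_twist (K E : closedFieldType) (P : place K E) n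
    (r : S -> 'M[K]_n) (r' : S -> 'M[E]_n) :
  unramified_twist r -> (forall s, mpl P (r s) (r' s)) -> unramified_twist r'.
Proof.
case=> rR [e eP] [M [c [M_gt0 rM]]] Pr; split; first exact: mpl_rep rR Pr.
  pose red (A : 'M[K]_n) : 'M[E]_n := xget 0 [set A' : 'M[E]_n | mpl P A A']%classic.
  exists [seq red A | A <- e] => s Is; apply/mapP; exists (r s); first exact: eP.
  rewrite /red; case: xgetP => [A' _ PA|/(_ (r' s)) []]; last exact: Pr.
  by apply: mpl_fun PA.
case: n r r' rR e eP rM Pr => [|n] r r' rR e eP rM Pr.
  by exists M, 0; split=> //; apply/matrixP => -[].
have PX := mplX M (Pr phi).
exists M, ((r' phi ^+ M) ord0 ord0); split=> //; apply: (mpl_fun PX).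
by rewrite rM; apply: mpl_scalar; have := PX ord0 ord0; rewrite rM mxE eqxx mulr1n.
Qed.

Lemma finite_image_order (F : fieldType) n (r : S -> 'M[F]_n) s :
  is_rep r -> finite_image r -> exists2 M, (0 < M)%N & r s ^+ M = 1%:M.
Proof.
move=> rR [e eP]; pose f k := r (s ^+ k)%g.
have [a [b [lt_ab fab]]] := pigeonhole (fun k => eP (s ^+ k)%g : f k \in e).
exists (b - a)%N; first by rewrite subn_gt0.
have us := unitX_mx a (rep_unit s rR).
apply: (can_inj (mulKmx us)); rewrite mulmx1 mulmxE -exprD subnKC ?(ltnW lt_ab) //.
by rewrite -!(repX _ _ rR).
Qed.

Variables (R : idomainType) (Om : alg_closure {fraction R}).
Variables (chi : S -> intal Om) (chiP : unramified_char chi).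
Variables (d : nat) (r : S -> 'M[intalp p Om]_d) (rR : is_rep r) (rF : finite_image r).

Lemma map_rep (A B : nzRingType) (f : {rmorphism A -> B}) n (r0 : S -> 'M[A]_n) :
  is_rep r0 -> is_rep (fun s => map_mx f (r0 s)).
Proof. by case=> r1 rM; split=> [|s s']; rewrite ?r1 ?map_mx1 // rM map_mxM. Qed.

Lemma twist_unramified :
  unramified_twist (fun s => map_mx (\val : _ -> Om) (twist chi r s)).
Proof.
have [chi1 chiM _ chiI] := chiP.
pose r1 s := map_mx (\val : _ -> Om) (r s).
have r1R : is_rep r1 by exact: map_rep.
pose c s : Om := val (chi s).
have c1 : c 1%g = 1 by rewrite /c chi1.
have cM s s' : c (s * s')%g = c s * c s' by rewrite /c chiM.
have cI s : I s -> c s = 1 by move=> Is; rewrite /c chiI.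
have twE s : map_mx (\val : _ -> Om) (twist chi r s) = c s *: r1 s.
  by rewrite /twist map_mxZ.
have r1F : finite_image r1.
  by have [e eP] := rF; exists [seq map_mx (\val : _ -> Om) A | A <- e] => s; exact: (map_f _ (eP s)).
rewrite (funext twE); move: c r1 c1 cM cI r1R r1F {twE} => c r1 c1 cM cI r1R r1F.
split.
- split=> [|s s']; first by rewrite c1 scale1r; case: r1R.
  by case: r1R => _ ->; rewrite cM -scalemxAl -scalemxAr scalerA.
- by have [e eP] := r1F; exists e => s Is; rewrite cI // scale1r.
- have [M M_gt0 rM] := finite_image_order phi r1R r1F.
  by exists M, (c phi ^+ M); rewrite exprZmx rM scalemx1.
Qed.

End SpecializedData.

(** * The monodromy filtration *)

Section Filtration.
Variables (F : closedFieldType) (F0 : [pchar F] =i pred0) (n : nat).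
Variables (N g : 'M[F]_n) (M : int -> 'M[F]_n).
Hypothesis filtM : monodromy_filtration N M.

Local Notation Z := (N^T).
Local Notation h := (g^T).

Lemma filt_mono i k : (M i <= M (i + k%:Z))%MS.
Proof.
have [mono _ _ _ _] := filtM.
elim: k => [|k IHk]; first by rewrite addr0.
by apply: submx_trans IHk _; rewrite intS [1 + _]addrC addrA.
Qed.

Lemma filt_le i j : i <= j -> (M i <= M j)%MS.
Proof.
move=> ij; have -> : j = i + `|j - i|%N%:Z by lia.
exact: filt_mono.
Qed.

Lemma filt_mulX i k : (M i *m Z ^+ k <= M (i - (2 * k)%N%:Z))%MS.
Proof.
have [_ _ MZ _ _] := filtM.
elim: k => [|k IHk]; first by rewrite expr0 mulmx1 muln0 subr0.
rewrite exprSr -mulmxE mulmxA; apply: submx_trans (submxMr _ IHk) _.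
by apply: submx_trans (MZ _) _; apply: filt_le; lia.
Qed.

(** By the surjectivity of [Gr_i -> Gr_(-i)] for all [i >= k], down to the zero step
    of the filtration. *)
Lemma filt_opp (k : nat) : (M (- k%:Z) <= M k%:Z *m Z ^+ k)%MS.
Proof.
have [_ [[b Mb] _] MZ Mk _] := filtM.
have step d : (M (- k%:Z) <= M k%:Z *m (Z ^+ k)%R + M (- k%:Z - d%:Z))%MS.
  elim: d => [|d IHd]; first by rewrite subr0 addsmxSr.
  apply: submx_trans IHd _; rewrite addsmx_sub addsmxSl /=.
  have -> : - k%:Z - d%:Z = - (k + d)%N%:Z by lia.
  apply: submx_trans (Mk _) _; rewrite addsmx_sub; apply/andP; split.
    apply: submx_trans (addsmxSl _ _); rewrite addnC exprD -mulmxE mulmxA submxMr //.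
    by apply: submx_trans (filt_mulX _ _) _; apply: filt_le; lia.
  by apply: submx_trans (addsmxSr _ _); apply: filt_le; lia.
have := step `|b|%N; suff -> : M (- k%:Z - `|b|%N%:Z) = 0 by rewrite addsmx0.
by apply/eqP; rewrite -submx0 -Mb filt_le //; lia.
Qed.

(** By the injectivity of [Gr_i -> Gr_(-i)] for all [i > k], from the full step of
    the filtration. *)
Lemma filt_ker k : (kermx (Z ^+ k.+1) <= M k%:Z)%MS.
Proof.
have [_ [_ [b Mb]] _ _ MkV] := filtM.
apply/rV_subP => x /sub_kermxP xZ.
suff down d : (x <= M (k + d)%N%:Z)%MS -> (x <= M k%:Z)%MS.
  apply: (down `|b|%N); apply: submx_trans (submx_full x Mb) _.
  by apply: filt_le; lia.
elim: d => [|d IHd] xM; first by rewrite addn0 in xM.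
apply: IHd; have -> : (k + d)%N%:Z = (k + d.+1)%N%:Z - 1 by lia.
apply: MkV => //; rewrite addnS -addSn exprD -mulmxE mulmxA xZ mul0mx.
exact: sub0mx.
Qed.

(** The kernel of [N^j] lies in [M j], and the image of [M j] contains [M (-j)]. *)
Lemma filt_rank (j : nat) :
  (n + \rank (M (- j%:Z)) <= \rank (Z ^+ j) + \rank (M j%:Z))%N.
Proof.
have kerM : (kermx (Z ^+ j) <= M j%:Z)%MS.
  apply: submx_trans (filt_ker j); apply/sub_kermxP.
  by rewrite exprSr -mulmxE mulmxA mulmx_ker mul0mx.
have := mxrank_mul_ker (M j%:Z) (Z ^+ j).
have -> : \rank (M j%:Z :&: kermx (Z ^+ j)) = (n - \rank (Z ^+ j))%N.
  by rewrite (capmx_idPr kerM) mxrank_ker.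
have := mxrankS (filt_opp j); have := rank_leq_row (Z ^+ j).
move: (\rank _) (\rank (M _)) (\rank (M _)) (\rank _) => a b c' d.
lia.
Qed.

(** [W i a] reads: [a] has weight [i], relative to the weight of the purity. *)
Variable W : int -> F -> Prop.
Hypothesis grW : forall i a, gr_eigenvalue M g i a -> W i a.

(** In the first step of the filtration that contains it, an eigenvector represents
    an eigenvector of the graded piece. *)
Lemma eigen_filt (x : 'rV_n) a i : x != 0 -> x *m h = a *: x -> (x <= M i)%MS ->
  exists2 k, k <= i & W k a.
Proof.
have [_ [[b Mb] _] _ _ _] := filtM; move=> x0 xa xM.
have down e : (x <= M (b + e%:Z))%MS -> exists2 k, k <= b + e%:Z & W k a.
  elim: e => [|e IHe]; first by rewrite addr0 Mb submx0 (negPf x0).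
  have eE : b + e.+1%:Z - 1 = b + e%:Z by lia.
  move=> xMe; have [/IHe[k kb Wk]|xMe'] := boolP (x <= M (b + e%:Z))%MS.
    by exists k => //; lia.
  exists (b + e.+1%:Z) => //; apply: grW; exists x; rewrite eE; split=> //.
  by rewrite xa subrr sub0mx.
have [ib|bi] := lerP i b.
  by move: (submx_trans xM (filt_le ib)); rewrite Mb submx0 (negPf x0).
have -> : i = b + `|i - b|%N%:Z by lia.
by apply: down; apply: submx_trans xM _; apply: filt_le; lia.
Qed.

Variables (c : F) (c0 : c != 0).
Hypothesis gN : g *m N = c *: (N *m g).

Lemma shift_ZX k : Z ^+ k *m h = c ^+ k *: (h *m Z ^+ k).
Proof.
have Zh : Z *m h = c *: (h *m Z) by rewrite -trmx_mul gN linearZ /= trmx_mul.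
elim: k => [|k IHk]; first by rewrite !expr0 mul1mx mulmx1 scale1r.
rewrite !exprSr -mulmxE -mulmxA Zh -scalemxAr (mulmxA (Z ^+ k)) IHk -scalemxAl scalerA.
by rewrite -mulmxA mulrC.
Qed.

(** For [k >= 0], [M k = ker N^(k+1) + N (M (k+2))]. *)
Lemma filt_stable (k : nat) : stablemx (M k%:Z) h.
Proof.
have [_ [_ [b Mb]] MZ _ _] := filtM.
suff down d : stablemx (M (k + d)%N%:Z) h -> stablemx (M (k + d).+1%N%:Z) h ->
    stablemx (M k%:Z) h.
  have full e : b <= e%:Z -> stablemx (M e%:Z) h.
    by move=> be; apply: submx_full; rewrite -sub1mx (submx_trans _ (filt_le be)) // sub1mx.
  by apply: (down `|b|%N); apply: full; lia.
elim: d => [|d IHd]; rewrite ?addn0 // !addnS => st1 st2; apply: IHd => //.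
move: (k + d)%N st2 => {st1}k st2.
have kerk : stablemx (kermx (Z ^+ k.+1)) h.
  apply/sub_kermxP; apply: (scalerI (expf_neq0 k.+1 c0)).
  by rewrite scaler0 -mulmxA scalemxAr -shift_ZX mulmxA mulmx_ker mul0mx.
have MZk : (M k.+2%:Z *m Z <= M k%:Z)%MS.
  by have := MZ k.+2%:Z; have -> : k.+2%:Z - 2 = k%:Z by lia.
have Mk : (M k%:Z <= kermx (Z ^+ k.+1) + M k.+2%:Z *m Z)%MS.
  apply/rV_subP => x xM; have : (x *m Z ^+ k.+1 <= M k.+2%:Z *m Z ^+ k.+2)%MS.
    apply: submx_trans (filt_opp k.+2); apply: submx_trans (submxMr _ xM) _.
    by apply: submx_trans (filt_mulX _ _) _; apply: filt_le; lia.
  case/submxP => y xy; rewrite -[x](subrK (y *m M k.+2%:Z *m Z)).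
  apply: addmx_sub_adds; last by rewrite -mulmxA submxMl.
  by apply/sub_kermxP; rewrite mulmxBl xy exprS -mulmxE !mulmxA subrr.
apply: submx_trans (submxMr _ Mk) _; rewrite addsmxMr addsmx_sub.
rewrite (submx_trans kerk) ?filt_ker //=.
have -> : M k.+2%:Z *m Z *m h = c *: (M k.+2%:Z *m h *m Z).
  by have := shift_ZX 1; rewrite !expr1 -mulmxA => ->; rewrite -scalemxAr mulmxA.
by apply: scalemx_sub; apply: submx_trans MZk; exact: submxMr.
Qed.

Definition sel_rows (X : 'M[F]_n) (P : pred 'I_n) : 'M[F]_n :=
  diag_mx (\row_i (P i)%:R) *m X.

Lemma sel_rows_rank X P : X \in unitmx -> \rank (sel_rows X P) = #|P|.
Proof.
move=> uX; rewrite /sel_rows mxrankMfree ?row_free_unit //.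
set e := diag_mx _; have ee : e *m e = e.
  rewrite mulmx_diag; congr diag_mx; apply/rowP => i; rewrite !mxE.
  by case: (P i); rewrite ?mulr1 ?mulr0.
apply: (char0_natf_inj F0); rewrite -trace_idempotent // mxtrace_diag.
by rewrite -sum1_card natr_sum [RHS]big_mkcond; apply: eq_bigr => i _; rewrite mxE unfold_in; case: (P i).
Qed.

Variables (X : 'M[F]_n) (D : 'rV[F]_n).
Hypotheses (uX : X \in unitmx) (XD : X *m h = diag_mx D *m X).

Lemma sel_rows_stable P : stablemx (sel_rows X P) h.
Proof.
rewrite /sel_rows -mulmxA XD mulmxA.
have -> : forall e : 'rV_n, diag_mx e *m diag_mx D = diag_mx D *m diag_mx e.
  by move=> e; rewrite !mulmx_diag; congr diag_mx; apply/rowP => i; rewrite !mxE mulrC.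
by rewrite -mulmxA submxMl.
Qed.

Lemma sel_rows_eigen P (x : 'rV_n) a : x != 0 -> (x <= sel_rows X P)%MS -> x *m h = a *: x ->
  exists2 i, P i & D 0 i = a.
Proof.
move=> x0 /submxP[y xy] xa; have [z [xz zE]] : exists z, x = z *m X /\ forall i, z 0 i = y 0 i * (P i)%:R.
  exists (y *m diag_mx (\row_i (P i)%:R)); rewrite xy /sel_rows mulmxA.
  by split=> // i; rewrite mul_mx_diag !mxE.
have zD : z *m diag_mx D = a *: z.
  by apply: (can_inj (mulmxK uX)); rewrite -mulmxA -XD mulmxA -xz xa xz scalemxAl.
have [i zi] : exists i, z 0 i != 0.
  by apply/rV0Pn; apply: contra_neq x0 => z0; rewrite xz z0 mul0mx.
exists i; first by move: zi; rewrite zE; case: (P i) => //; rewrite mulr0 eqxx.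
by move/rowP/(_ i): zD; rewrite mul_mx_diag !mxE mulrC => /(mulIf zi).
Qed.

Hypothesis W_fun : forall i j a, W i a -> W j a -> i = j.
Variable Y : 'I_n -> int.
Hypothesis YD : forall i, W (Y i) (D 0 i).

Lemma row_eigen i : row i X *m h = D 0 i *: row i X /\ row i X != 0.
Proof.
split; first by rewrite -row_mul XD row_mul row_diag_mx -scalemxAl -rowE.
apply/eqP => Xi; have := congr1 (fun x => x *m invmx X) Xi.
rewrite -row_mul mulmxV // mul0mx => /rowP/(_ i).
by rewrite !mxE eqxx => /eqP; rewrite oner_eq0.
Qed.

(** The first step of the filtration that contains an eigenvector has index its
    weight, as weights are unique. *)
Lemma row_filt i : (row i X <= M (Y i))%MS.
Proof.
have [_ [_ [b Mb]] _ _ _] := filtM; have [Xi Xi0] := row_eigen i.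
have [k [e kE]] : exists k (e : nat), Y i + e%:Z = k /\ b <= k.
  by exists (Y i + `|b - Y i|%N%:Z), `|b - Y i|%N; split=> //; lia.
move: kE => [kE bk]; have: (row i X <= M (Y i + e%:Z))%MS.
  by apply: submx_trans (submx_full _ Mb) _; rewrite kE filt_le.
elim: e {kE} => [|e IHe]; first by rewrite addr0.
have eE : Y i + e.+1%:Z - 1 = Y i + e%:Z by lia.
move=> xMe; apply: IHe; apply/negPn/negP => xMe'.
have : W (Y i + e.+1%:Z) (D 0 i).
  by apply: grW; exists (row i X); rewrite eE; split=> //; rewrite Xi subrr sub0mx.
by move/(W_fun (YD i)); lia.
Qed.

Lemma filt_rank_ge y : (#|[pred i | Y i <= y]%R| <= \rank (M y))%N.
Proof.
rewrite -(sel_rows_rank _ uX) mxrankS //; apply/row_subP => i.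
rewrite /sel_rows row_mul row_diag_mx -scalemxAl -rowE !mxE /=.
case: leP => Yi; last by rewrite scale0r sub0mx.
by rewrite scale1r; apply: submx_trans (row_filt i) (filt_le Yi).
Qed.

(** Being stable, [M j] would contain an eigenvector if it met the span of the
    eigenvectors of weight larger than [j]. *)
Lemma filt_rank_le (j : nat) :
  (\rank (M j%:Z) + #|[pred i | j%:Z < Y i]%R| <= n)%N.
Proof.
rewrite -(sel_rows_rank _ uX) -mxrank_disjoint_sum ?rank_leq_row //.
apply/eqP/negPn/negP => UV0.
have stUV : stablemx (M j%:Z :&: sel_rows X (fun i => j%:Z < Y i)%R)%MS h.
  rewrite sub_capmx; apply/andP; split.
    by apply: submx_trans (submxMr _ (capmxSl _ _)) (filt_stable _).
  by apply: submx_trans (submxMr _ (capmxSr _ _)) (sel_rows_stable _).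
have [x [a [x0 xUV xa]]] := stable_eigenvector stUV UV0.
move: xUV; rewrite sub_capmx => /andP[xM xS].
have [i /= ji Da] := sel_rows_eigen x0 xS xa.
have [k kj Wk] := eigen_filt x0 xa xM.
by move: (YD i); rewrite Da => /(W_fun Wk); lia.
Qed.

(** The [h]-eigenvectors of weight at most [-j] lie in the image of [N^j], and
    those of weight larger than [j] are not seen by its kernel. *)
Lemma rank_monodromy_ge (j : nat) :
  (#|[pred i | (Y i <= - j%:Z) || (j%:Z < Y i)]%R| <= \rank (N ^+ j))%N.
Proof.
have -> : \rank (N ^+ j) = \rank (Z ^+ j).
  rewrite -mxrank_tr; congr (\rank _); elim: j => [|j IHj]; first by rewrite !expr0 trmx1.
  by rewrite exprS -mulmxE trmx_mul IHj exprSr.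
have := filt_rank j; have := filt_rank_le j; have := filt_rank_ge (- j%:Z).
rewrite (_ : #|[pred i | _ || _]%R| =
  (#|[pred i | Y i <= - j%:Z]%R| + #|[pred i | j%:Z < Y i]%R|)%N).
  move: (\rank (Z ^+ j)) (\rank (M (- j%:Z))) (\rank (M j%:Z)) => a b c'; lia.
rewrite -(cardUI [pred i | Y i <= - j%:Z]%R) [X in (_ + X)%N]eq_card0 ?addn0.
  by apply: eq_card => i; rewrite !inE.
by move=> i; rewrite !inE; apply/negP => /andP[]; lia.
Qed.

End Filtration.

(** * Weil numbers *)

Section TotalRelation.
Variables (L C : fieldType) (T : L -> C -> Prop).
Hypothesis T1 : T 1 1.
Hypothesis TB : forall x y e f, T x e -> T y f -> T (x - y) (e - f).
Hypothesis TM : forall x y e f, T x e -> T y f -> T (x * y) (e * f).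
Hypothesis T0 : forall e, T 0 e -> e = 0.

Lemma rmorph_of_graph : (forall x, exists e, T x e) ->
  exists f : {rmorphism L -> C}, forall x, T x (f x).
Proof.
move=> Ttot; pose f x := projT1 (cid (Ttot x)); have fP x : T x (f x) := projT2 (cid (Ttot x)).
have uniq x e e' : T x e -> T x e' -> e = e'.
  by move=> Te Te'; apply/eqP; rewrite -subr_eq0; apply/eqP/T0; rewrite -(subrr x); exact: TB.
have fB : zmod_morphism f by move=> x y; apply: uniq (fP _) _; exact: TB.
have fM : monoid_morphism f.
  by split=> [|x y]; apply: uniq (fP _) _ => //; exact: TM.
pose fz := GRing.isZmodMorphism.Build _ _ f fB.
pose fm := GRing.isMonoidMorphism.Build _ _ f fM.
pose F : {rmorphism L -> C} := HB.pack f fz fm.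
by exists F.
Qed.

End TotalRelation.

(** The elements of a field generated by [b] are polynomials in [b] with rational
    coefficients. *)
Lemma generated_total (L : fieldExtType rat) (b : L) (C : numFieldType) (T : L -> C -> Prop) e :
  <<1; b>>%VS = fullv ->
  (forall c, T c%:A (ratr c)) ->
  (forall x y e f, T x e -> T y f -> T (x - y) (e - f)) ->
  (forall x y e f, T x e -> T y f -> T (x * y) (e * f)) ->
  T b e -> forall x, exists e', T x e'.
Proof.
move=> genb Tc TB TM Tb x.
have T0 : T 0 0 by have := Tc 0; rewrite scale0r rmorph0.
have TD y z f g : T y f -> T z g -> T (y + z) (f + g).
  by move=> Ty /(TB _ _ _ _ T0); rewrite !sub0r => /(TB _ _ _ _ Ty); rewrite !opprK.
have : x \in <<1%AS; b>>%VS by rewrite genb memvf.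
case/Fadjoin_polyP => p p1 ->; elim/poly_ind: p p1 => [|p c IHp] pc.
  by exists 0; rewrite horner0.
have [p1 [k ck]] : p \is a polyOver 1%AS /\ exists k, c = k%:A.
  split; last first.
    have := polyOverP pc 0%N; rewrite coefD coefMX coefC /= add0r => /vlineP[k ->].
    by exists k.
  apply/polyOverP => i; have := polyOverP pc i.+1.
  by rewrite coefD coefMX coefC /= addr0.
have [f pf] := IHp p1.
by exists (f * e + ratr k); rewrite hornerD hornerMX hornerC ck; apply: TD => //; exact: TM.
Qed.

(** The embedding of the rationals, viewed as a place, extends to the generator [b],
    hence to the whole field. *)
Lemma number_field_embedding (L : fieldExtType rat) (b : L) (C : numClosedFieldType) :
  <<1; b>>%VS = fullv -> exists s : {rmorphism L -> C}, True.
Proof.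
move=> genb.
have [c|P0 P0P] := place_of_rmorph (i := in_alg L) (f := ratr : {rmorphism rat -> C}).
  by move/eqP; rewrite fmorph_eq0 => /eqP ->; rewrite rmorph0.
have P0c c : P0 c%:A (ratr c) by exact: P0P.
pose pL := minPoly 1%AS b.
have pLc i : exists c, pL`_i = c%:A.
  by have /vlineP[k ->] := polyOverP (minPolyOver 1%AS b) i; exists k.
pose cf i := projT1 (cid (pLc i)); have cfP i : pL`_i = (cf i)%:A := projT2 (cid (pLc i)).
pose pC : {poly C} := \poly_(i < size pL) ratr (cf i).
have pp : ppl P0 pL pC.
  move=> i; rewrite coef_poly; case: ltnP => iL; first by rewrite cfP.
  by rewrite nth_default //; exact: pl0.
have [P [P0P' [e Pb]]] := place_extend pp (monic_minPoly _ _) (eqP (root_minPoly 1%AS b)).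
have [|||||f fP] := @rmorph_of_graph L C P.
- exact: pl1.
- exact: plB.
- exact: plM.
- exact: pl0_eq0.
- apply: (generated_total genb _ _ _ Pb) => [c|*|*]; first exact: P0P'.
    exact: plB.
  exact: plM.
- by exists f.
Qed.

Section WeilNumbers.
Variables (Rr : realType) (F : fieldType) (q : nat) (q_gt1 : (1 < q)%N).
Hypothesis F0 : [pchar F] =i pred0.

(** Every complex embedding of [Q(b')] restricts to one of [Q(q^k b')]. *)
Lemma weil_number_shift w w' (a : F) (k : nat) :
  weil_number Rr q w a -> weil_number Rr q w' (q%:R^-1 ^+ k * a) -> w' = w - (2 * k)%N%:Z.
Proof.
case=> -[L [b [j [jb genb ab]]]] _ [[L' [b' [j' [jb' genb' ab']]]] _].
have q0 : q%:R != 0 :> F by rewrite ((pcharf0P F).1 F0) -lt0n ltnW.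
have [s' _] := number_field_embedding Rr[i] genb'.
have jj' : j b = j' (q%:R ^+ k * b').
  by rewrite rmorphM rmorphXn rmorph_nat jb jb' mulrA -exprMn mulfV // expr1n mul1r.
have [|||||s sP] := @rmorph_of_graph L Rr[i] (fun x e => exists y, j x = j' y /\ s' y = e).
- by exists 1; rewrite !rmorph1.
- by move=> x y _ _ [x' [jx <-]] [y' [jy <-]]; exists (x' - y'); rewrite !rmorphB jx jy.
- by move=> x y _ _ [x' [jx <-]] [y' [jy <-]]; exists (x' * y'); rewrite !rmorphM jx jy.
- move=> _ [y [/esym/eqP + <-]]; rewrite rmorph0 fmorph_eq0 => /eqP ->.
  by rewrite rmorph0.
- apply: (generated_total (e := s' (q%:R ^+ k * b')) genb) => [c|||].
  + exists c%:A; have -> : j c%:A = ratr c := fmorph_eq_rat (j \o in_alg L) c.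
    have -> : j' c%:A = ratr c := fmorph_eq_rat (j' \o in_alg L') c.
    by have -> : s' c%:A = ratr c := fmorph_eq_rat (s' \o in_alg L') c.
  + by move=> x y _ _ [x' [jx <-]] [y' [jy <-]]; exists (x' - y'); rewrite !rmorphB jx jy.
  + by move=> x y _ _ [x' [jx <-]] [y' [jy <-]]; exists (x' * y'); rewrite !rmorphM jx jy.
  + by exists (q%:R ^+ k * b').
have [y [jy sy]] := sP b; have yE : y = q%:R ^+ k * b'.
  by apply: (fmorph_inj j'); rewrite -jy jj'.
have := ab s; rewrite -sy yE rmorphM rmorphXn rmorph_nat normrM normrX normr_nat ab'.
set u := sqrtC q%:R; have -> : q%:R = u ^+ 2 :> Rr[i] by rewrite sqrtCK.
have u1 : 1 < u by rewrite -[1]sqrtC1 ltr_sqrtC ?nnegrE ?ler0n ?ler01 ?ltr1n.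
have u0 : u != 0 by rewrite gt_eqF // (lt_trans ltr01).
have uZ (d : int) : u ^ d = 1 -> d = 0.
  have uX m : u ^+ m.+1 = 1 -> False.
    by move=> um; have : 1 < u ^+ m.+1 by [rewrite exprn_egt1]; rewrite um ltxx.
  case: d => [[|m]|m] //; first by move/uX.
  by rewrite NegzE -invr_expz => /(congr1 GRing.inv); rewrite invrK invr1 => /uX.
rewrite -exprM exprnP -expfzDr // => uw.
suff : (2 * k)%N%:Z + w' - w = 0 by lia.
by apply: uZ; rewrite expfzDr // uw -expfzDr // subrr expr0z.
Qed.

End WeilNumbers.

(** * Power sums *)

Section PowerSums.
Variables (F : fieldType) (F0 : [pchar F] =i pred0).

Lemma interpolation (s : seq F) (f : F -> F) : uniq s ->
  exists p : {poly F}, {in s, forall x, p.[x] = f x}.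
Proof.
elim: s => [|x s IHs] /= => [_|/andP[xs us]]; first by exists 0.
have [p pP] := IHs us; pose w := \prod_(y <- s) ('X - y%:P).
have wx : w.[x] != 0 by rewrite -[_ == 0]/(root w x) root_prod_XsubC.
exists (p + ((f x - p.[x]) / w.[x])%:P * w) => y; rewrite inE => /orP[/eqP ->|ys].
  by rewrite hornerD hornerCM divfK // addrC subrK.
have wy : w.[y] = 0 by apply/eqP; rewrite -[_ == 0]/(root w y) root_prod_XsubC.
by rewrite hornerD hornerCM wy mulr0 addr0 pP.
Qed.

(** Families with the same power sums have the same members with the same
    multiplicities: they agree on a polynomial that interpolates any function. *)
Lemma power_sums (J1 J2 : finType) (x1 : J1 -> F) (x2 : J2 -> F) :
  (forall k, \sum_j x1 j ^+ k = \sum_j x2 j ^+ k) ->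
  forall f : F -> nat, (\sum_j f (x1 j) = \sum_j f (x2 j))%N.
Proof.
move=> eqX f.
have [p pP] := @interpolation (undup (codom x1 ++ codom x2)) (fun x => (f x)%:R) (undup_uniq _).
have x1P j : p.[x1 j] = (f (x1 j))%:R by apply: pP; rewrite mem_undup mem_cat codom_f.
have x2P j : p.[x2 j] = (f (x2 j))%:R by apply: pP; rewrite mem_undup mem_cat codom_f orbT.
apply: (char0_natf_inj F0); rewrite !natr_sum -(eq_bigr _ (fun j _ => x1P j)).
rewrite -(eq_bigr _ (fun j _ => x2P j)).
have horE (J : finType) (x : J -> F) : \sum_j p.[x j] = \sum_(i < size p) p`_i * \sum_j x j ^+ i.
  under eq_bigr do rewrite horner_coef; rewrite exchange_big /=.
  by apply: eq_bigr => i _; rewrite mulr_sumr.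
by rewrite !horE; apply: eq_bigr => i _; rewrite eqX.
Qed.

End PowerSums.

(** * Purity and the ranks of the powers of the monodromy *)

(** The weights [y, y - 2, y - 4, ...] of a Jordan string have the same parity and the
    interval [(-j, j]] contains [2 j] integers; so at most [j] of them lie in it. *)
Lemma string_count (y : int) (j t : nat) :
  (t - j <= \sum_(h < t) ~~ ((- j%:Z < y - (2 * h)%N%:Z) && (y - (2 * h)%N%:Z <= j%:Z))%R)%N.
Proof.
pose c (h : nat) : bool := ((- j%:Z < y - (2 * h)%N%:Z) && (y - (2 * h)%N%:Z <= j%:Z))%R.
have [m mP] : exists m : int, y - j%:Z <= 2 * m <= y - j%:Z + 1.
  by exists ((y - j%:Z + 1) %/ 2)%Z; lia.
(* [m] is the least integer such that [y - 2 m <= j]. *)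
have cnt : ((\sum_(h < t) c h)%N <= j)%N /\
    ((\sum_(h < t) c h)%N = 0%N \/ (\sum_(h < t) c h)%N%:Z <= t%:Z - m).
  elim: t => [|t [IH1 IH2]]; first by rewrite big_ord0; split=> //; left.
  rewrite big_ord_recr /=; move: (\sum_(h < t) c h)%N IH1 IH2 => e IH1 IH2.
  case: (boolP (c t)) => /= ct; last by rewrite addn0; split=> //; case: IH2 => ?; [left|right]; lia.
  by move: ct; rewrite /c; lia.
have : (\sum_(h < t) c h + \sum_(h < t) ~~ c h = t)%N.
  rewrite -big_split /= -[RHS]card_ord -sum1_card; apply: eq_bigr => h _.
  by case: (c h).
by move: cnt.1; move: (\sum_(h < t) c h)%N (\sum_(h < t) ~~ c h)%N => a b; lia.
Qed.

Lemma trace_diagX (F : fieldType) n (P A : 'M[F]_n) (D : 'rV[F]_n) k :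
  P \in unitmx -> P *m A = diag_mx D *m P -> \tr (A ^+ k) = \sum_i D 0 i ^+ k.
Proof.
move=> uP PA; have PAk := intertwineX k PA.
rewrite -[A ^+ k](mulKmx uP) PAk mxtrace_mulC mulmxK // diag_mxX mxtrace_diag.
by apply: eq_bigr => i _; rewrite mxE.
Qed.

Lemma big_sigma_pair (V : Type) (idx : V) (op : Monoid.com_law idx) m (t d : 'I_m -> nat)
    (G : forall i, 'I_(t i) -> 'I_(d i) -> V) :
  \big[op/idx]_(c : {i : 'I_m & ('I_(t i) * 'I_(d i))%type})
     G (tag c) (tagged c).1 (tagged c).2 =
  \big[op/idx]_i \big[op/idx]_(h < t i) \big[op/idx]_(g < d i) G i h g.
Proof.
under [RHS]eq_bigr do rewrite pair_bigA /=.
by rewrite (sig_big_dep xpredT (fun=> xpredT)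
  (fun i (c : 'I_(t i) * 'I_(d i)) => G i c.1 c.2)).
Qed.

Section RankOfPure.
Variables (p l : nat) (pP : prime p) (lP : prime l) (S : weil_setup pP lP).

Local Notation I := (fun s : S => inertia (weil_val s)).
Local Notation q := (ws_q S).
Local Notation phi := (ws_phi S : S).
Local Notation kap F := (@frob_char _ _ _ _ S F).

Section GenericRank.
Variables (F : closedFieldType) (F0 : [pchar F] =i pred0).
Variables (z : {rmorphism padic_int pP -> F}) (z_inj : injective z).
Variables (n : nat) (rho : S -> 'M[F]_n) (rhoR : is_rep rho) (N : 'M[F]_n).
Hypothesis mN : monodromic_with z rho N.
Variables (m : nat) (t d : 'I_m -> nat) (sg : forall i, S -> 'M[F]_(d i)).
Hypothesis sgP : forall i, unramified_twist (sg i).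
Hypothesis decomp : wd_iso (frob_ss (wd_of z rho)) (wd_sum (fun i => wd_sp (t i) (sg i))).

(** The rank of [N^j] is the trace of 1 on its image. *)
Lemma decomp_rank j : \rank (N ^+ j) = (\sum_i (t i - j) * d i)%N.
Proof.
have [B BP] := ginv_exists (N ^+ j).
have := decomp_trace F0 z_inj rhoR mN sgP decomp 1%g BP.
have [-> _] := wd_of_rep F0 rhoR mN.
rewrite mul1mx trace_idempotent; last by rewrite mulmxA BP.
have -> : \rank (N ^+ j *m B) = \rank (N ^+ j).
  by apply/eqP; rewrite eqn_leq mxrankM_maxl /= -{1}BP mxrankM_maxl.
move=> rk; apply: (char0_natf_inj F0); rewrite rk natr_sum; apply: eq_bigr => i _.
have [[-> _] _ _] := sgP i; rewrite frob_char1 mxtrace1.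
under eq_bigr do rewrite expr1n mul1r.
rewrite sumr_const natrM -[LHS]mulr_natl; congr (_%:R * _).
rewrite -sum1_card big_mkcond -(big_mkord xpredT (fun h => if (j <= h)%N then 1%N else 0%N)).
elim: (t i) => [|t' IH]; first by rewrite big_nil.
by rewrite big_nat_recr //= IH; case: leqP; lia.
Qed.

End GenericRank.

Section Specialization.
Variables (K E : closedFieldType) (K0 : [pchar K] =i pred0) (E0 : [pchar E] =i pred0).
Variables (zK : {rmorphism padic_int pP -> K}) (zE : {rmorphism padic_int pP -> E}).
Hypotheses (zK_inj : injective zK) (zE_inj : injective zE).
Variables (P : place K E) (Pz : forall a, P (zK a) (zE a)).
Variables (n : nat) (rK : S -> 'M[K]_n) (rE : S -> 'M[E]_n).
Hypotheses (rKR : is_rep rK) (rER : is_rep rE) (Pr : forall s, mpl P (rK s) (rE s)).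
Variables (NK : 'M[K]_n) (NE : 'M[E]_n).
Hypotheses (mK : monodromic_with zK rK NK) (mE : monodromic_with zE rE NE).
Hypothesis PN : mpl P NK NE.
Variables (m : nat) (t d : 'I_m -> nat).
Variables (sK : forall i, S -> 'M[K]_(d i)) (sE : forall i, S -> 'M[E]_(d i)).
Hypotheses (sKP : forall i, unramified_twist (sK i)) (sEP : forall i, unramified_twist (sE i)).
Hypothesis Ps : forall i s, mpl P (sK i s) (sE i s).
Hypothesis decomp : wd_iso (frob_ss (wd_of zK rK)) (wd_sum (fun i => wd_sp (t i) (sK i))).

Local Notation rss := (wd_r (frob_ss (wd_of zE rE))).

Lemma specialize_trace s : \tr (rss s) = sp_char t (fun i => \tr (sE i s)) (kap E s) 0.
Proof.
have tf := specialize_tame_frobenius K0 zK_inj rKR mK PN sKP decomp.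
have one (F : closedFieldType) (N : 'M[F]_n) : N ^+ 0 *m 1%:M *m N ^+ 0 = N ^+ 0.
  by rewrite expr0 !mulmx1.
have := frob_ss_trace E0 rER mE s tf (one E NE).
have := decomp_trace K0 zK_inj rKR mK sKP decomp s (one K NK).
rewrite !expr0 !mulmx1 => trK ->.
apply: pl_fun (sp_char_specialize E0 t Ps 0 s); rewrite -trK; apply: pl_trace.
exact: (wd_of_specialize K0 E0 Pz Pr mK mE PN s).
Qed.

(** Purity forces the Jordan strings of the specialization to be centered at the
    weight, while a string of the generic representation has at most [j] of its
    weights in an interval [(-j, j]]. *)
Theorem specialize_rank (Rr : realType) w : wd_pure Rr w (frob_ss (wd_of zE rE)) ->
  forall j, (\rank (NK ^+ j) <= \rank (NE ^+ j))%N.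
Proof.
have tf := specialize_tame_frobenius K0 zK_inj rKR mK PN sKP decomp.
have [[rssR _ drss] _ tN] := frob_ss_good_wd E0 rER mE tf.
have NEE : wd_N (frob_ss (wd_of zE rE)) = NE := wd_of_N E0 mE.
move: tN => /(_ phi); rewrite NEE expr1z => gN.
case=> M; rewrite NEE => filtM grM j.
have q_gt1 := residue_card_gt1 S.
have q0 : q%:R != 0 :> E by rewrite ((pcharf0P E).1 E0) -lt0n ltnW.
pose W (y : int) (a : E) := weil_number Rr q (w + y) a.
have W_shift y y' a k : W y a -> W y' (q%:R^-1 ^+ k * a) -> y' = y - (2 * k)%N%:Z.
  by move=> Wy Wy'; have := weil_number_shift q_gt1 E0 Wy Wy'; lia.
have W_fun y y' a : W y a -> W y' a -> y = y'.
  by move=> Wy Wy'; have := W_shift y y' a 0%N Wy; rewrite expr0 mul1r => /(_ Wy') ->; lia.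
have [X [D [uX XD]]] := diagable_tr drss.
have gr0 := frob_char_neq0 E0 phi.
have WD i : exists y, W y (D 0 i).
  have [_ [_ [b Mb]] _ _ _] := filtM; have [Xi Xi0] := row_eigen uX XD i.
  have [k _ Wk] := eigen_filt filtM grM Xi0 Xi (submx_full _ Mb).
  by exists k.
pose Y (a : E) : int := xget 0 [set y | W y a]%classic.
have YP y a : W y a -> W (Y a) a.
  by move=> Wy; rewrite /Y; case: xgetP => [y' _ //|/(_ y) []].
have YD i : W (Y (D 0 i)) (D 0 i) by have [y Wy] := WD i; exact: YP Wy.
apply: leq_trans (rank_monodromy_ge E0 filtM grM gr0 gN uX XD W_fun YD j).
pose Dd i := cid (let: And3 _ _ d := unramified_twist_good E0 (sEP i) in d).
pose e i := projT1 (cid (projT2 (Dd i))).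
have eP i k : \tr (sE i phi ^+ k) = \sum_h e i 0 h ^+ k.
  have [uQ Qe] := projT2 (cid (projT2 (Dd i))); exact: trace_diagX uQ Qe.
pose J := {i : 'I_m & ('I_(t i) * 'I_(d i))%type}.
pose x (c : J) := q%:R^-1 ^+ (tagged c).1 * e (tag c) 0 (tagged c).2.
have eqX : forall f : E -> nat, (\sum_i f (D 0%R i) = \sum_c f (x c))%N.
  apply: power_sums => // k.
  have uXT := uX; have trXD : \tr (rss phi ^+ k) = \sum_i D 0 i ^+ k.
    rewrite -(trace_diagX k uX XD) -mxtrace_tr; congr (\tr _).
    elim: k => [|k IHk]; first by rewrite !expr0 trmx1.
    by rewrite exprS -mulmxE trmx_mul IHk exprSr.
  rewrite -trXD -(repX phi k rssR) specialize_trace /sp_char.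
  rewrite (big_sigma_pair _ (fun i (h : 'I_(t i)) g => (q%:R^-1 ^+ h * e i 0 g) ^+ k)).
  apply: eq_bigr => i _; apply: eq_bigr => h _; have [sR _ _] := sEP i; rewrite (repX phi k sR) eP mulr_sumr.
  apply: eq_bigr => g _; rewrite exprMn; congr (_ * _).
  by rewrite /frob_char weil_vphiX -invr_expz -exprnP -exprVn -!exprM mulnC.
(* The members of the strings are Frobenius eigenvalues, so they have weights. *)
have Yx c : W (Y (x c)) (x c).
  have := eqX (fun a => ~~ `[< W (Y a) a >]); rewrite big1 => [/esym/eqP|i _]; last first.
    by apply/eqP; rewrite eqb0 negbK; apply/asboolP.
  rewrite sum_nat_eq0 => /forallP/(_ c) /=.
  by rewrite eqb0 negbK => /asboolP.
(* [out a] says that the relative weight of [a] is outside [(-j, j]]. *)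
pose out (a : E) := ~~ ((- j%:Z < Y a) && (Y a <= j%:Z))%R.
rewrite (decomp_rank K0 zK_inj rKR mK sKP decomp).
have -> : #|[pred i | (Y (D 0 i) <= - j%:Z) || (j%:Z < Y (D 0 i))]%R| = (\sum_i out (D 0%R i))%N.
  rewrite -sum1_card big_mkcond; apply: eq_bigr => i _; rewrite inE /out.
  by rewrite negb_and -leNgt -ltNge; case: (_ || _).
rewrite (eqX out) (big_sigma_pair _ (fun i (h : 'I_(t i)) g =>
  out (q%:R^-1 ^+ h * e i 0%R g)%R : nat)).
apply: leq_sum => i _; rewrite exchange_big /=.
rewrite mulnC -[X in (X * _)%N]card_ord -sum_nat_const; apply: leq_sum => g _.
case: (posnP (t i)) => [->|ti]; first by rewrite sub0n.
apply: leq_trans (string_count (Y (e i 0%R g)) j (t i)) _.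
apply: leq_sum => h _; rewrite /out.
have Wh := Yx (Tagged (fun i => ('I_(t i) * 'I_(d i))%type) (h, g)).
have W0 := Yx (Tagged (fun i => ('I_(t i) * 'I_(d i))%type) (Ordinal ti, g)).
by rewrite /x /= mul1r in W0; rewrite (W_shift _ _ _ _ W0 Wh).
Qed.

End Specialization.
End RankOfPure.

(** * Euler factors *)

(** Sylvester's identity. *)
Lemma det_1BC (A : comNzRingType) m n (B : 'M[A]_(m, n)) (C : 'M[A]_(n, m)) :
  \det (1%:M - B *m C) = \det (1%:M - C *m B).
Proof.
have e1 : block_mx 1%:M 0 C 1%:M *m block_mx 1%:M B 0 (1%:M - C *m B) =
    block_mx 1%:M B C (1%:M : 'M[A]_n).
  by rewrite mulmx_block ?(mul1mx, mulmx1, mul0mx, mulmx0) !addr0 [_ + (_ - _)]addrC subrK.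
have e2 : block_mx 1%:M B 0 1%:M *m block_mx (1%:M - B *m C) 0 C 1%:M =
    block_mx (1%:M : 'M[A]_m) B C 1%:M.
  by rewrite mulmx_block ?(mul1mx, mulmx1, mul0mx, mulmx0) !add0r subrK.
have := congr1 determinant (etrans e2 (esym e1)).
by rewrite !det_mulmx !det_ublock !det_lblock !det1 !mul1r !mulr1.
Qed.

(** Both sides agree at each nonzero [x], as [det (1 - x A) = x^n det (x^-1 - A)]. *)
Lemma det_1XM (F : closedFieldType) (F0 : [pchar F] =i pred0) n (A : 'M[F]_n) (as_ : seq F) :
  char_poly A = \prod_(a <- as_) ('X - a%:P) ->
  \det (1%:M - 'X *: map_mx polyC A) = \prod_(a <- as_) (1 - a *: 'X).
Proof.
move=> cA; have sz : size as_ = n.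
  have := size_char_poly A; rewrite cA size_prod_XsubC.
  by case.
apply/eqP; rewrite -subr_eq0; apply/eqP; set p := (X in X = 0).
have p0 x : x != 0 -> p.[x] = 0.
  move=> x0; have dx : \det (1%:M - x *: A) = x ^+ n * (char_poly A).[x^-1].
    rewrite -horner_evalE -det_map_mx /= -detZ; congr (\det _).
    apply/matrixP => i j; rewrite !mxE /= horner_evalE hornerD hornerN hornerC hornerMn hornerX.
    by rewrite mulrBr mulrnAr mulfV.
  rewrite /p hornerD hornerN; apply/eqP; rewrite subr_eq0; apply/eqP.
  transitivity (\det (1%:M - x *: A)).
    rewrite -horner_evalE -det_map_mx /=; congr (\det _); apply/matrixP => i j.
    by rewrite !mxE /= horner_evalE hornerD hornerN hornerMn hornerM hornerX !hornerC.
  rewrite dx cA !horner_prod -sz; elim: as_ {cA sz p dx} => [|a s IHs].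
    by rewrite !big_nil expr0 mulr1.
  rewrite !big_cons exprS mulrACA IHs; congr (_ * _).
  by rewrite hornerXsubC hornerD hornerN hornerZ hornerX hornerC mulrBr mulfV // mulrC.
apply/eqP/negPn/negP => pN0.
have := max_poly_roots pN0 (rs := [seq i.+1%:R | i <- iota 0 (size p)]).
rewrite size_map size_iota ltnn => H; apply: (notF (H _ _)).
  by apply/allP => _ /mapP[i _ ->]; apply/eqP/p0; rewrite ((pcharf0P F).1 F0).
by rewrite map_inj_uniq ?iota_uniq // => i j /(char0_natf_inj F0) [].
Qed.

Section Projector.
Variables (p l : nat) (pP : prime p) (lP : prime l) (S : weil_setup pP lP).
Local Notation I := (fun s : S => inertia (weil_val s)).
Local Notation phi := (ws_phi S : S).

Variables (F : fieldType) (n : nat) (D : wd_rep S F n).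
Local Notation r := (wd_r D).
Local Notation N := (wd_N D).
Hypothesis rR : is_rep r.
Variable c : F.
Hypothesis Nphi : N *m r phi = c *: (r phi *m N).
Variable pi : 'M[F]_n.
Hypothesis Npi : N *m pi = 0.
Hypothesis rpi : forall s, I s -> r s *m pi = pi.
Hypothesis piP : forall x : 'rV[F]_n, x *m N^T = 0 ->
  (forall s, I s -> x *m (r s)^T = x) -> x *m pi^T = x.

Lemma euler_spaceP (x : 'rV[F]_n) : (x <= euler_space D)%MS <-> x *m pi^T = x.
Proof.
have piE (y : 'rV[F]_n) : (y <= pi^T)%MS <->
    y *m N^T = 0 /\ forall s, I s -> y *m (r s)^T = y.
  split=> [/submxP[z ->]|[yN yr]]; last by rewrite -(piP yN yr) submxMl.
  split=> [|s Is]; first by rewrite -mulmxA -trmx_mul Npi trmx0 mulmx0.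
  by rewrite -mulmxA -trmx_mul rpi.
rewrite /euler_space; case: xgetP => [U _ UP|/(_ pi^T) []]; last exact: piE.
split=> [/UP[yN yr]|<-]; first exact: piP.
by apply/UP/piE; rewrite submxMl.
Qed.

(** The invariants of the inertia killed by [N] form a space stable under [r phi]. *)
Lemma projector_stable : pi *m r phi *m pi = r phi *m pi.
Proof.
apply: trmx_inj; rewrite -mulmxA trmx_mul; apply/row_matrixP => i.
rewrite row_mul; apply: piP.
  rewrite -row_mul -trmx_mul mulmxA Nphi -scalemxAl -mulmxA Npi mulmx0 scaler0.
  by rewrite trmx0 row0.
move=> s Is; rewrite -row_mul -trmx_mul mulmxA; congr (row _ _^T).
have Ij : I (phi^-1 * s * phi)%g.
  by rewrite -{2}[phi]invgK; exact: inertiaJ.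
have -> : r s *m r phi = r phi *m r (phi^-1 * s * phi)%g.
  by rewrite -!(rR.2) !mulgA mulgV mul1g.
by rewrite -mulmxA (rpi Ij).
Qed.

(** Through a basis [B] of the Euler space, [pi^T = A B] with [B A = 1]; Sylvester's
    identity exchanges the two factors. *)
Lemma euler_det : wd_euler_inv D = \det (1%:M - 'X *: map_mx polyC (r phi *m pi)).
Proof.
rewrite /wd_euler_inv /rev_char_poly_on; set U := euler_space D.
have UE (k : nat) (A : 'M_(k, n)) : (A <= U)%MS -> A *m pi^T = A.
  move=> AU; apply/row_matrixP => i; rewrite row_mul; apply/euler_spaceP.
  by apply: submx_trans AU; exact: row_sub.
have piU : (pi^T <= U)%MS.
  apply/row_subP => i; apply/euler_spaceP; apply: piP.
    by rewrite -row_mul -trmx_mul Npi trmx0 row0.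
  by move=> s Is; rewrite -row_mul -trmx_mul rpi.
have stU : stablemx U (r phi)^T.
  rewrite -{1}(UE _ _ (submx_refl U)) -mulmxA -trmx_mul -projector_stable -(mulmxA pi) trmx_mul.
  by rewrite mulmxA; apply: submx_trans piU; exact: submxMl.
set B := row_base U; set C := conjmx B _.
have BC : B *m (r phi)^T = C *m B.
  by apply: simmxPp; [rewrite stablemx_row_base | exact: eqxx].
have [A piAB] : exists A, pi^T = A *m B by apply/submxP; rewrite eq_row_base.
have BA : B *m A = 1%:M.
  apply: (row_free_inj (row_base_free U)); rewrite mul1mx -mulmxA -piAB UE //.
  by rewrite eq_row_base.
have gpi : (r phi *m pi)^T = A *m (C *m B) by rewrite trmx_mul piAB -mulmxA BC.
have trE : (1%:M - 'X *: map_mx polyC (r phi *m pi))^T =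
    1%:M - ('X *: map_mx polyC A) *m (map_mx polyC (C *m B)).
  rewrite -scalemxAl -map_mxM -gpi; apply/matrixP => i j.
  by rewrite !mxE eq_sym.
rewrite -[RHS]det_tr trE det_1BC.
by rewrite -scalemxAr -map_mxM -mulmxA BA mulmx1.
Qed.

End Projector.

Section InertiaProjector.
Variables (p l : nat) (pP : prime p) (lP : prime l) (S : weil_setup pP lP).
Local Notation I := (fun s : S => inertia (weil_val s)).
Local Notation phi := (ws_phi S : S).

Definition list_avg (F : fieldType) n (L : seq S) (r : S -> 'M[F]_n) : 'M[F]_n :=
  (size L)%:R^-1 *: \sum_(h <- L) r h.

(** The average [e] projects onto the invariants of the inertia, on which [e B e] is a
    generalized inverse of [N], as [e] and [N] commute; [1 - e B e N] projects the
    invariants onto the kernel of [N]. *)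
Definition inertia_proj (F : fieldType) n (L : seq S) (D : wd_rep S F n) B : 'M[F]_n :=
  let e := list_avg L (wd_r D) in e - e *m B *m wd_N D *m e.

Section OneField.
Variables (F : fieldType) (F0 : [pchar F] =i pred0) (n : nat) (D : wd_rep S F n).
Local Notation r := (wd_r D).
Local Notation N := (wd_N D).
Variables (L : seq S) (L0 : (0 < size L)%N) (LI : forall h, h \in L -> I h).
Local Notation e := (list_avg L r).
Hypothesis re : forall s, I s -> r s *m e = e.
Hypothesis rN : forall s, I s -> r s *m N = N *m r s.

Let sL : (size L)%:R != 0 :> F.
Proof. by rewrite ((pcharf0P F).1 F0) -lt0n. Qed.

Lemma list_avg_fixed m (y : 'M[F]_(m, n)) (f : 'M[F]_n -> 'M[F]_(m, n)) :
  (forall s, I s -> f (r s) = y) -> (forall a A B, f (a *: A + B) = a *: f A + f B) ->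
  f e = y.
Proof.
move=> fy flin; have f0 : f 0 = 0.
  by apply: (addrI (f 0)); have := flin 1 0 0; rewrite !scale1r !addr0 => <-.
rewrite -[list_avg _ _]addr0 flin f0 addr0.
have -> : f (\sum_(h <- L) r h) = \sum_(h <- L) y.
  rewrite big_seq [RHS]big_seq; elim/big_rec2: _ => [|h a b hL <-]; first exact: f0.
  by have := flin 1 (r h) b; rewrite !scale1r fy //; exact: LI.
by rewrite big_const_seq count_predT iter_addr_0 -scaler_nat scalerA mulVf // scale1r.
Qed.

Lemma list_avg_idem : e *m e = e.
Proof.
apply: (@list_avg_fixed n e (fun A => A *m e)) => [s Is|a A B]; first exact: re.
by rewrite mulmxDl -scalemxAl.
Qed.

Lemma list_avg_comm : e *m N = N *m e.
Proof.
rewrite /list_avg -scalemxAl -scalemxAr; congr (_ *: _).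
rewrite mulmx_suml mulmx_sumr big_seq [RHS]big_seq; apply: eq_bigr => h /LI.
exact: rN.
Qed.

Variables (B : 'M[F]_n) (NB : N *m B *m N = N).
Local Notation pi := (inertia_proj L D B).

Lemma inertia_proj_N : N *m pi = 0.
Proof.
rewrite /inertia_proj; move: list_avg_idem list_avg_comm.
move: (list_avg L r) => f ff fN.
rewrite mulmxBr !mulmxA -fN -(mulmxA f N B) -(mulmxA f (N *m B)) NB.
by rewrite fN -mulmxA ff subrr.
Qed.

Lemma inertia_proj_r s : I s -> r s *m pi = pi.
Proof. by move=> Is; rewrite /inertia_proj mulmxBr !mulmxA re. Qed.

Lemma inertia_projP (x : 'rV[F]_n) : x *m N^T = 0 ->
  (forall s, I s -> x *m (r s)^T = x) -> x *m pi^T = x.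
Proof.
move=> xN xr; have xe : x *m e^T = x.
  apply: (@list_avg_fixed 1 x (fun A => x *m A^T)) => [s Is|a A C]; first exact: xr.
  by rewrite linearP /= mulmxDr -scalemxAr.
rewrite /inertia_proj linearB /= mulmxBr xe !trmx_mul !mulmxA xe xN !mul0mx.
by rewrite subr0.
Qed.

End OneField.

Lemma ppl_det (F E : fieldType) (P : place F E) n (A : 'M[{poly F}]_n) (A' : 'M[{poly E}]_n) :
  (forall i j, ppl P (A i j) (A' i j)) -> ppl P (\det A) (\det A').
Proof.
move=> AA; have ppl0 : ppl P 0 0 by move=> i; rewrite !coef0; exact: pl0.
have ppl1 : ppl P 1 1 by apply: pplC; exact: pl1.
have pplN p0 q0 : ppl P p0 q0 -> ppl P (- p0) (- q0).
  by move=> pq; rewrite -sub0r -[- q0]sub0r; exact: pplB.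
have pplD p1 q1 p2 q2 : ppl P p1 q1 -> ppl P p2 q2 -> ppl P (p1 + p2) (q1 + q2).
  by move=> pq1 /pplN/(pplB pq1); rewrite !opprK.
rewrite /determinant; elim/big_ind2: _ => // [*|s _]; first exact: pplD.
apply: pplM; last by elim/big_ind2: _ => // *; exact: pplM.
by case: (odd_perm s) => //; rewrite !expr1; exact: pplN.
Qed.

Section Specialization.
Variables (K E : fieldType) (K0 : [pchar K] =i pred0) (E0 : [pchar E] =i pred0).
Variables (zK : {rmorphism padic_int pP -> K}) (zE : {rmorphism padic_int pP -> E}).
Variables (P : place K E) (Pz : forall a, P (zK a) (zE a)).
Variables (n : nat) (rK : S -> 'M[K]_n) (rE : S -> 'M[E]_n).
Hypotheses (rKR : is_rep rK) (rER : is_rep rE) (Pr : forall s, mpl P (rK s) (rE s)).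
Variables (NK : 'M[K]_n) (NE : 'M[E]_n).
Hypotheses (mK : monodromic_with zK rK NK) (mE : monodromic_with zE rE NE).
Hypothesis PN : mpl P NK NE.

Lemma wd_of_scale (F : fieldType) (F0 : [pchar F] =i pred0)
    (z : {rmorphism padic_int pP -> F}) (r : S -> 'M[F]_n) N :
  is_rep r -> monodromic_with z r N ->
  exists c, N *m wd_r (wd_of z r) phi = c *: (wd_r (wd_of z r) phi *m N).
Proof.
move=> rR mN; rewrite (wd_of_phi F0 mN); have [i Ii ti] := tame_onto S 1.
have Ij : I (phi^-1 * i * phi)%g by rewrite -{2}[phi]invgK; exact: inertiaJ.
have := monodromy_conj F0 rR mN phi Ij; rewrite !mulgA mulgV mul1g mulgK ti rmorph1 scale1r.
by move=> <-; eexists.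
Qed.

(** An eigenvector of [(g pi)^T] for a nonzero eigenvalue is fixed by [pi^T], hence is
    an eigenvector of [g^T]. *)
Lemma char_poly_projector (F : fieldType) m (g pi : 'M[F]_m) a :
  pi *m g *m pi = g *m pi -> root (char_poly (g *m pi)) a -> a = 0 \/ root (char_poly g) a.
Proof.
have char_tr (A : 'M[F]_m) : char_poly A^T = char_poly A.
  rewrite /char_poly -det_tr; congr (\det _); apply/matrixP => i j.
  by rewrite !mxE eq_sym.
move=> pgp rt; have [->|a0] := eqVneq a 0; [by left | right].
move: rt; rewrite -char_tr -eigenvalue_root_char => /eigenvalueP[x xa x0].
rewrite -char_tr -eigenvalue_root_char; apply/eigenvalueP; exists x => //.
suff xpi : x *m pi^T = x by rewrite -xa trmx_mul mulmxA xpi.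
by apply: (scalerI a0); rewrite scalemxAl -xa -mulmxA -trmx_mul mulmxA pgp.
Qed.

(** Where the rank of [N] is preserved, the projector onto [ker N] in the
    invariants of the inertia specializes. *)
Theorem euler_specialize : \rank NK = \rank NE ->
  (exists2 pi, wd_euler_inv (wd_of zK rK) = \det (1%:M - 'X *: map_mx polyC (rK phi *m pi)) &
    pi *m rK phi *m pi = rK phi *m pi) /\
  ppl P (wd_euler_inv (wd_of zK rK)) (wd_euler_inv (wd_of zE rE)).
Proof.
move=> rkN; have rR := wd_of_rep K0 rKR mK; have rR' := wd_of_rep E0 rER mE.
have [L [L0 LI permL]] := finite_transversal (weil_frobenius_generated S) rR (wd_of_finite K0 rKR mK).
have Pwd := wd_of_specialize K0 E0 Pz Pr mK mE PN.
set DK := wd_of zK rK in rR permL Pwd *; set DE := wd_of zE rE in rR' Pwd *.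
have NKE : wd_N DK = NK := wd_of_N K0 mK.
have NEE : wd_N DE = NE := wd_of_N E0 mE.
have [BK [BE [PB KB EB]]] := mpl_ginv PN rkN.
have Pavg : mpl P (list_avg L (wd_r DK)) (list_avg L (wd_r DE)).
  apply: mplZ; last by apply: mpl_sum => h _; exact: Pwd.
  by apply: plV; [exact: pl_nat | rewrite ((pcharf0P E).1 E0) -lt0n].
have reK s : I s -> wd_r DK s *m list_avg L (wd_r DK) = list_avg L (wd_r DK).
  move=> Is; rewrite /list_avg -scalemxAr mulmx_sumr; congr (_ *: _).
  by rewrite -(big_map (wd_r DK) xpredT id) -(perm_big _ (permL s Is)) big_map.
have reE s : I s -> wd_r DE s *m list_avg L (wd_r DE) = list_avg L (wd_r DE).
  move=> Is; apply: (mpl_fun (P := P)) (mplM (Pwd s) Pavg) _.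
  by rewrite reK.
have rNK s : I s -> wd_r DK s *m wd_N DK = wd_N DK *m wd_r DK s.
  by rewrite NKE => Is; exact: (wd_of_inertia_comm K0 rKR mK Is).
have rNE s : I s -> wd_r DE s *m wd_N DE = wd_N DE *m wd_r DE s.
  by rewrite NEE => Is; exact: (wd_of_inertia_comm E0 rER mE Is).
have KB' : wd_N DK *m BK *m wd_N DK = wd_N DK by rewrite NKE.
have EB' : wd_N DE *m BE *m wd_N DE = wd_N DE by rewrite NEE.
have [cK cKP] := wd_of_scale K0 rKR mK; have [cE cEP] := wd_of_scale E0 rER mE.
rewrite -NKE -/DK in cKP; rewrite -NEE -/DE in cEP.
have NpK := inertia_proj_N K0 L0 LI reK rNK KB'.
have NpE := inertia_proj_N E0 L0 LI reE rNE EB'.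
have rpK := inertia_proj_r reK BK; have rpE := inertia_proj_r reE BE.
have KP x := @inertia_projP _ K0 _ DK L L0 LI BK x.
have EP x := @inertia_projP _ E0 _ DE L L0 LI BE x.
have eulK := euler_det rR cKP NpK rpK KP.
have eulE := euler_det rR' cEP NpE rpE EP.
have phK : wd_r DK phi = rK phi := wd_of_phi K0 mK.
split.
  exists (inertia_proj L DK BK); first by rewrite eulK phK.
  by have := projector_stable rR cKP NpK rpK KP; rewrite phK.
have Pg : mpl P (wd_r DK phi *m inertia_proj L DK BK) (wd_r DE phi *m inertia_proj L DE BE).
  apply: (mplM (Pwd phi)); apply: mplB => //; apply: mplM => //.
  by apply: mplM; [exact: mplM | rewrite NKE NEE].
rewrite eulK eulE; move: (_ *m _) (wd_r DE phi *m _) Pg => A A' Pg.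
apply: ppl_det => i j; rewrite !mxE; apply: pplB.
  case: (i == j); first by apply: pplC; exact: pl1.
  by move=> k; rewrite !coef0; exact: pl0.
by apply: pplM; [exact: pplX | exact: pplC].
Qed.

End Specialization.
End InertiaProjector.

Section EulerIntegrality.
Variables (A : comNzRingType) (F : closedFieldType) (F0 : [pchar F] =i pred0).
Variable f : {rmorphism A -> F}.

(** The inverse roots of [det (1 - X g)] are the eigenvalues of [g]. *)
Lemma integral_det_1XM n (g : 'M[F]_n) :
  (forall a, root (char_poly g) a -> integralOver f a) ->
  forall k, integralOver f (\det (1%:M - 'X *: map_mx polyC g))`_k.
Proof.
move=> gi; have [as_ cg] := closed_field_poly_normal (char_poly g).
rewrite (monicP (char_poly_monic g)) scale1r in cg; rewrite (det_1XM F0 cg).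
have asi a : a \in as_ -> integralOver f a.
  by move=> aa; apply: gi; rewrite cg root_prod_XsubC.
elim: as_ asi {cg} => [|a s IHs] si k.
  rewrite big_nil coef1; case: (k == 0%N); [exact: integral1 | exact: integral0].
have ia : integralOver f a by apply: si; rewrite mem_head.
have {}IHs : forall k, integralOver f (\prod_(a <- s) (1 - a *: 'X))`_k.
  by apply: IHs => b bs; apply: si; rewrite inE bs orbT.
rewrite big_cons mulrBl mul1r -scalerAl coefB coefZ coefXM.
apply: integral_sub => //; case: (k == 0%N); first by rewrite mulr0; exact: integral0.
exact: integral_mul.
Qed.

End EulerIntegrality.

(** * Specialization of irreducibility *)

Section Irreducibility.
Variables (G : groupType).

Lemma frobenius_generatedT : frobenius_generated (fun _ : G => True) 1%g.
Proof. by split=> // P _ PT _ _ s; exact: PT. Qed.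

Definition conj_avg (F : fieldType) n (L : seq G) (r : G -> 'M[F]_n) (M : 'M[F]_n) : 'M[F]_n :=
  \sum_(h <- L) (r h^-1%g)^T *m M *m (r h)^T.

(** Schur's lemma. *)
Lemma conj_avg_scalar (F : closedFieldType) (F0 : [pchar F] =i pred0) n (r : G -> 'M[F]_n) :
  is_rep r -> irreducible_rep r -> finite_image r ->
  exists L : seq G, (0 < size L)%N /\
    forall M, conj_avg L r M = ((size L)%:R * \tr M / n%:R)%:M.
Proof.
move=> rr [n_gt0 irr] [e eP].
have [L [L0 _ permL]] := finite_transversal frobenius_generatedT rr (ex_intro _ e (fun s _ => eP s)).
exists L; split=> // M; set T := conj_avg L r M.
have [r1 rM] := rr.
have TE : T = \sum_(h <- [seq r h | h <- L]) (invmx h)^T *m M *m h^T.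
  by rewrite big_map; apply: eq_bigr => h _; rewrite repV.
have comT s : T *m (r s)^T = (r s)^T *m T.
  rewrite [in RHS]TE -(perm_big _ (permL s I)) big_map [LHS]mulmx_suml mulmx_sumr.
  apply: eq_bigr => h _; rewrite -rM -repV // invgM !rM !trmx_mul !mulmxA.
  by rewrite -(trmx_mul (r s^-1%g)) rep_invV // trmx1 mul1mx.
have [|x [a [x0 _ xa]]] := stable_eigenvector (V := 1%:M : 'M[F]_n) (h := T) (submx1 _).
  by rewrite -mxrank_eq0 mxrank1 -lt0n.
have eigT : T = a%:M.
  have full : row_full (eigenspace T a).
    apply: irr => [s|]; first by apply: comm_mx_stable_eigenspace; exact: comT.
    by apply: contra_neq x0 => E0; apply/eqP; rewrite -submx0 -E0; apply/eigenspaceP.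
  have /eigenspaceP : (1%:M <= eigenspace T a)%MS by rewrite sub1mx.
  by rewrite mul1mx scalemx1.
have n0 : n%:R != 0 :> F by rewrite ((pcharf0P F).1 F0) -lt0n.
rewrite eigT; congr (_%:M); apply: (mulIf n0); rewrite divfK // mulr_natr -mxtrace_scalar -eigT.
rewrite /T /conj_avg raddf_sum /= (eq_bigr (fun=> \tr M)) => [|h _].
  by rewrite big_const_seq count_predT iter_addr_0 mulr_natl.
by rewrite mxtrace_mulC mulmxA -trmx_mul rep_invV // trmx1 mul1mx.
Qed.

(** If [u] is a nonzero vector of a stable subspace, the average of a matrix of rank 1
    with row space spanned by [u] is a nonzero multiple of the identity whose rows
    lie in this subspace. *)
Lemma irreducible_of_avg (F : fieldType) (F0 : [pchar F] =i pred0) n (r : G -> 'M[F]_n) L :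
  (0 < n)%N -> (0 < size L)%N ->
  (forall i j, conj_avg L r (delta_mx i j) = ((size L)%:R * (i == j)%:R / n%:R)%:M) ->
  irreducible_rep r.
Proof.
move=> n_gt0 L0 avgP; split=> // U stU /eqP U0.
have nz k : (0 < k)%N -> k%:R != 0 :> F by move=> k0; rewrite ((pcharf0P F).1 F0) -lt0n.
have [i ui] : exists i, row i U != 0.
  apply: contrapT => nU; apply: U0; apply/row_matrixP => i; rewrite row0.
  by apply/eqP/negPn/negP => ri; apply: nU; exists i.
have [k uk] : exists k, U i k != 0.
  by have /rV0Pn[k] := ui; rewrite mxE; exists k.
pose M := delta_mx k 0 *m row i U : 'M[F]_n.
have ME : M = \sum_j U i j *: delta_mx k j.
  apply/matrixP => a b; rewrite !mxE summxE big_ord1 !mxE /= andbT.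
  rewrite (bigD1 b) //= big1 => [|j jb]; last by rewrite !mxE [b == j]eq_sym (negPf jb) andbF mulr0.
  by rewrite !mxE eqxx andbT addr0 mulrC.
have avgM : conj_avg L r M = ((size L)%:R * U i k / n%:R)%:M.
  have -> : conj_avg L r M = \sum_j U i j *: conj_avg L r (delta_mx k j).
    rewrite /conj_avg ME; under [RHS]eq_bigr do rewrite scaler_sumr.
    rewrite exchange_big; apply: eq_bigr => h _.
    rewrite mulmx_sumr mulmx_suml; apply: eq_bigr => j _.
    by rewrite -scalemxAr -scalemxAl.
  rewrite (bigD1 k) //= big1 => [|j jk].
    by rewrite avgP eqxx addr0 mulr1 scale_scalar_mx; congr (_%:M); rewrite mulrCA mulrA.
  by rewrite avgP eq_sym (negPf jk) mulr0 mul0r raddf0 scaler0.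
rewrite -sub1mx; set c := _ / _ in avgM.
have c0 : c != 0 by rewrite /c !mulf_neq0 ?invr_eq0 ?nz.
have -> : 1%:M = c^-1 *: conj_avg L r M by rewrite avgM scale_scalar_mx mulVf.
apply: scalemx_sub; apply: summx_sub => h _; rewrite /M !mulmxA -mulmxA.
by apply: submx_trans (submxMl _ _) _; apply: submx_trans (submxMr _ (row_sub i U)) (stU h).
Qed.

End Irreducibility.

(** * Transport along field homomorphisms *)

Section Transport.
Variables (E C : fieldType) (f : {rmorphism E -> C}).

Lemma place_comp (K : fieldType) (P : place K E) :
  exists P' : place K C, forall x e, P x e -> P' x (f e).
Proof.
have [|||e|P' P'P] := @place_of_graph K C (fun x c => exists2 e, P x e & c = f e).
- by exists 1; [exact: pl1 | rewrite rmorph1].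
- by move=> x y _ _ [e Pe ->] [e' Pe' ->]; exists (e - e'); [exact: plB | rewrite rmorphB].
- by move=> x y _ _ [e Pe ->] [e' Pe' ->]; exists (e * e'); [exact: plM | rewrite rmorphM].
- by case=> e' /pl0_eq0 -> ->; rewrite rmorph0.
- by exists P' => x e Pe; apply: P'P; exists e.
Qed.

Lemma map_mxdiag m (n : 'I_m -> nat) (A : forall i, 'M[E]_(n i)) :
  map_mx f (\mxdiag_i A i) = \mxdiag_i map_mx f (A i).
Proof.
apply/mxblockP => i j.
have -> : submxblock (map_mx f (\mxdiag_i A i)) i j = map_mx f (submxblock (\mxdiag_i A i) i j).
  by apply/matrixP => a b; rewrite !mxE.
rewrite /mxdiag !mxblockK; case: eqP => _; last exact: map_mx0.
by rewrite map_conform_mx map_mx0.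
Qed.

Lemma map_diagable n (A : 'M[E]_n) : diagable A -> diagable (map_mx f A).
Proof.
case=> P [D [uP PA]]; exists (map_mx f P), (map_mx f D).
by rewrite map_unitmx uP -map_diag_mx -!map_mxM PA.
Qed.

Lemma wd_iso_map (G : Type) n n' (D : wd_rep G E n) (D' : wd_rep G E n') :
  wd_iso D D' -> wd_iso (wd_map f D) (wd_map f D').
Proof.
case=> P [Q [PQ QP Pr PN]]; exists (map_mx f P), (map_mx f Q).
split=> [||s|]; rewrite /= -!map_mxM.
- by rewrite PQ map_mx1.
- by rewrite QP map_mx1.
- by rewrite Pr.
- by rewrite PN.
Qed.

Variables (p l : nat) (pP : prime p) (lP : prime l) (S : weil_setup pP lP).

Lemma map_frob_pow (k : int) : f ((ws_q S)%:R ^ k) = (ws_q S)%:R ^ k.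
Proof.
case: k => k; first by rewrite -exprnP rmorphXn rmorph_nat.
by rewrite NegzE -!invr_expz -!exprnP fmorphV rmorphXn rmorph_nat.
Qed.

Lemma wd_map_sum_sp m (t d : 'I_m -> nat) (r : forall i, S -> 'M[E]_(d i)) :
  wd_map f (wd_sum (fun i => wd_sp (t i) (r i))) =
  wd_sum (fun i => wd_sp (t i) (fun s => map_mx f (r i s))).
Proof.
rewrite /wd_map; congr WDRep.
  apply: funext => s /=; rewrite map_mxdiag; congr mxdiag; apply: functional_extensionality_dep => i.
  rewrite map_mxdiag; congr mxdiag; apply: functional_extensionality_dep => j.
  by rewrite map_mxZ map_frob_pow.
rewrite /= map_mxdiag; congr mxdiag; apply: functional_extensionality_dep => i.
by apply/matrixP => a b; rewrite !mxE; case: eqP => _;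
  rewrite ?rmorph_nat ?mxE //= ?rmorphMn ?rmorph_nat ?rmorph0.
Qed.

End Transport.

(** A twist by a character does not change the averages [conj_avg], which are
    rational multiples of the identity by Schur's lemma, hence specialize. *)
Lemma specialize_irreducible (G : groupType) (K E : closedFieldType) (P : place K E)
    (K0 : [pchar K] =i pred0) (E0 : [pchar E] =i pred0) d (r : G -> 'M[K]_d)
    (c : G -> K) (sE : G -> 'M[E]_d) :
  is_rep r -> irreducible_rep r -> finite_image r ->
  c 1%g = 1 -> {morph c : s t / (s * t)%g >-> s * t} ->
  (forall s, mpl P (c s *: r s) (sE s)) -> irreducible_rep sE.
Proof.
move=> rR irr fr c1 cM PsE; have [L [L0 avgP]] := conj_avg_scalar K0 rR irr fr.
have d0 := irr.1; apply: (irreducible_of_avg E0 d0 L0) => i j.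
have trE (F : fieldType) : \tr (delta_mx i j : 'M[F]_d) = (i == j)%:R.
  rewrite /mxtrace (bigD1 i) //= big1 ?addr0 => [|k ki]; last by rewrite mxE (negPf ki).
  by rewrite mxE eqxx.
apply: (mpl_fun (P := P)) (_ : mpl P (conj_avg L r (delta_mx i j)) _) _.
  apply: mpl_sum => h _.
  have -> : (r h^-1%g)^T *m delta_mx i j *m (r h)^T =
      (c h^-1%g *: r h^-1%g)^T *m delta_mx i j *m (c h *: r h)^T.
    have TZ a (A : 'M[K]_d) : (a *: A)^T = a *: A^T by rewrite linearZ.
    by rewrite !TZ -!scalemxAl -scalemxAr scalerA -cM mulVg c1 scale1r.
  have PT A A' : mpl P A A' -> mpl P A^T A'^T by move=> PA a b; rewrite !mxE.
  apply: mplM; last exact/PT/PsE; apply: mplM; first exact/PT/PsE.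
  by move=> a b; rewrite !mxE; exact: pl_nat.
rewrite avgP trE; apply: mpl_scalar; apply: plM; first by apply: plM; exact: pl_nat.
by apply: plV; [exact: pl_nat | rewrite ((pcharf0P E).1 E0) -lt0n].
Qed.

Lemma map_mx_expr (A B : nzRingType) (f : {rmorphism A -> B}) n (M : 'M[A]_n) k :
  map_mx f (M ^+ k) = map_mx f M ^+ k.
Proof.
by elim: k => [|k IHk]; rewrite ?expr0 ?map_mx1 // !exprS -!mulmxE map_mxM IHk.
Qed.

(** * Specializations of a family of Weil group representations *)

Section Setting.
Variables (p l : nat) (pP : prime p) (lP : prime l) (S : weil_setup pP lP).
Variables (R : idomainType) (iR : {rmorphism padic_int pP -> R}) (iR_inj : injective iR).
Variables (n : nat) (rho : S -> 'M[R]_n) (rho_rep : is_rep rho) (N : 'M[Rp p R]_n).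
Hypothesis rhoN : monodromic_with (@tofrac R \o iR)
  (fun s => map_mx (@tofrac R) (rho s)) (map_mx \val N).
Variable Om : alg_closure {fraction R}.
Variables (m : nat) (t : 'I_m -> nat) (chi : 'I_m -> S -> intal Om).
Hypothesis chi_char : forall i, unramified_char (chi i).
Variables (d : 'I_m -> nat) (r : forall i, S -> 'M[intalp p Om]_(d i)).
Hypothesis r_rep : forall i, is_rep (r i).
Hypothesis r_finite : forall i, finite_image (r i).
Hypothesis r_irr : forall i, irr_frob_ss (fun s => map_mx (\val : _ -> Om) (r i s)).
Hypothesis decomp : wd_iso
  (frob_ss (wd_of (frac_emb Om \o iR) (fun s => map_mx (frac_emb Om) (rho s))))
  (wd_sum (fun i => wd_sp (t i) (fun s => map_mx (\val : _ -> Om) (twist (chi i) (r i) s)))).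

Local Notation phi := (ws_phi S : S).
Local Notation N0 := (map_mx (\val : _ -> {fraction R}) N).
Local Notation NO := (map_mx (acl_emb Om) N0).
Local Notation V := (fun s => map_mx (frac_emb Om) (rho s)).
Local Notation sO i := (fun s => map_mx (\val : _ -> Om) (twist (chi i) (r i) s)).

Lemma tofrac_inj : injective (@tofrac R).
Proof. by move=> a b /eqP; rewrite tofrac_eq => /eqP. Qed.

Lemma frac_emb_inj : injective (frac_emb Om).
Proof. exact: inj_comp (fmorph_inj _) tofrac_inj. Qed.

Lemma generic_inj : injective (frac_emb Om \o iR).
Proof. exact: inj_comp frac_emb_inj iR_inj. Qed.

Lemma char0_of_inj (F : fieldType) (z : {rmorphism padic_int pP -> F}) :
  injective z -> [pchar F] =i pred0.
Proof.
move=> z_inj; apply/pcharf0P => k.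
by rewrite -(rmorph_nat z) -(rmorph0 z) (inj_eq z_inj) ((pcharf0P _).1 (padic_char0 pP)).
Qed.

Lemma frac_char0 : [pchar {fraction R}] =i pred0.
Proof. exact: (char0_of_inj (z := @tofrac R \o iR) (inj_comp tofrac_inj iR_inj)). Qed.

Lemma Om_char0 : [pchar Om] =i pred0.
Proof. exact: (char0_of_inj (z := frac_emb Om \o iR) generic_inj). Qed.

Lemma frac_place : exists P : place {fraction R} Om, forall x, P x (acl_emb Om x).
Proof.
apply: (place_of_rmorph (i := idfun) (f := acl_emb Om)) => a /= ->.
exact: rmorph0.
Qed.

(** The inclusion of [Frac R] in [Om] is a place. *)
Lemma generic_monodromic : monodromic_with (frac_emb Om \o iR) V NO.
Proof.
have [P PP] := frac_place.
apply: (mpl_monodromic (P := P) Om_char0 _ _ _ rhoN) => [a|s i j|i j]; rewrite ?mxE; exact: PP.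
Qed.

Lemma V_rep : is_rep V.
Proof. exact: map_rep. Qed.

Lemma sO_unramified i : unramified_twist (sO i).
Proof. exact: twist_unramified. Qed.

Lemma rank_NO j : \rank (NO ^+ j) = \rank (N0 ^+ j).
Proof. by rewrite -map_mx_expr mxrank_map. Qed.

Section Target.
Variables (E : closedFieldType) (zE : {rmorphism padic_int pP -> E}).
Hypothesis zE_inj : injective zE.
Variables (f : {rmorphism R -> E}) (fz : forall a, f (iR a) = zE a).
Variables (P : place Om E) (Pf : forall a, P (frac_emb Om a) (f a)).

Local Notation VE := (fun s => map_mx f (rho s)).

Let E0 : [pchar E] =i pred0 := char0_of_inj zE_inj.

Let pE : p%:R != 0 :> E.
Proof. by rewrite ((pcharf0P E).1 E0) -lt0n prime_gt0. Qed.

Lemma place_div x e k : P (p%:R ^+ k * x) e -> P x (e / p%:R ^+ k).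
Proof.
move=> Px; have pk : p%:R ^+ k != 0 :> E by rewrite expf_neq0.
have pO : p%:R ^+ k != 0 :> Om.
  by rewrite expf_neq0 // ((pcharf0P Om).1 Om_char0) -lt0n prime_gt0.
have -> : x = p%:R ^+ k * x / p%:R ^+ k by rewrite mulrC mulKf.
by apply: plM => //; apply: plV => //; apply: plX; exact: pl_nat.
Qed.

Lemma place_Rp (x : Rp p R) k a e : p%:R ^+ k * val x = tofrac a -> p%:R ^+ k * e = f a ->
  P (acl_emb Om (val x)) e.
Proof.
move=> xa ea; have pk : p%:R ^+ k != 0 :> E by rewrite expf_neq0.
have -> : e = f a / p%:R ^+ k by rewrite -ea mulrC mulKf.
apply: place_div; have -> : p%:R ^+ k * acl_emb Om (val x) = frac_emb Om a.
  by rewrite /frac_emb /= -xa rmorphM rmorphXn rmorph_nat.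
exact: Pf.
Qed.

(** The domain of the place contains [R[1 / p]], as [p] is nonzero in [E]. *)
Lemma exists_monodromy_specialization : exists NE, mpl P NO NE.
Proof.
have ex (x : Rp p R) : exists e, P (acl_emb Om (val x)) e.
  have /asboolP[k [a xa]] := valP x; exists (f a / p%:R ^+ k).
  by apply: (place_Rp xa); rewrite mulrC divfK // expf_neq0.
pose g x := projT1 (cid (ex x)); have gP x : P (acl_emb Om (val x)) (g x) := projT2 (cid (ex x)).
by exists (map_mx g N) => i j; rewrite !mxE.
Qed.

Variables (NE : 'M[E]_n) (PN : mpl P NO NE).

Let Pz a : P ((frac_emb Om \o iR) a) (zE a).
Proof. by rewrite -fz; exact: Pf. Qed.

Let Pr s : mpl P (map_mx (frac_emb Om) (rho s)) (map_mx f (rho s)).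
Proof. by move=> i j; rewrite !mxE; exact: Pf. Qed.

Let VE_rep : is_rep VE. Proof. exact: map_rep. Qed.

Lemma target_monodromic : monodromic_with zE VE NE.
Proof.
by apply: (mpl_monodromic (P := P) E0 _ _ PN generic_monodromic) => [a|s];
  [exact: Pz | exact: Pr].
Qed.

Lemma target_rank_le j : (\rank (NE ^+ j) <= \rank (NO ^+ j))%N.
Proof. by apply: mpl_rank; exact: mplX. Qed.

Variable sE : forall i, S -> 'M[E]_(d i).
Hypothesis Ps : forall i s, mpl P (map_mx (\val : _ -> Om) (twist (chi i) (r i) s)) (sE i s).

Lemma sE_unramified i : unramified_twist (sE i).
Proof. by apply: (mpl_unramified_twist (P := P) (sO_unramified i)) => s; exact: Ps. Qed.

Lemma target_decomp : (forall j, \rank (NO ^+ j) = \rank (NE ^+ j)) ->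
  wd_iso (frob_ss (wd_of zE VE)) (wd_sum (fun i => wd_sp (t i) (sE i))).
Proof.
exact: (specialize_decomp Om_char0 E0 generic_inj Pz V_rep VE_rep Pr generic_monodromic
  target_monodromic PN sO_unramified sE_unramified Ps decomp).
Qed.

Lemma target_rank (Rr : realType) : pure_rep zE Rr VE ->
  forall j, \rank (NO ^+ j) = \rank (NE ^+ j).
Proof.
case=> _ [w pw] j; apply/eqP; rewrite eqn_leq target_rank_le andbT.
exact: (specialize_rank Om_char0 E0 generic_inj Pz V_rep VE_rep Pr generic_monodromic
  target_monodromic PN sO_unramified sE_unramified Ps decomp pw).
Qed.

(** The coefficients lie in [Frac R], over which the monodromy and [rho] are
    defined, and are integral as the eigenvalues of [rho phi] are. *)
Theorem target_euler : \rank NO = \rank NE ->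
  exists Q : {poly intal Om},
  [/\ forall k, exists2 y : {fraction R}, integralOver (@tofrac R) y & \val Q`_k = acl_emb Om y,
    map_poly \val Q = wd_euler_inv (wd_of (frac_emb Om \o iR) V)
  & ppl P (wd_euler_inv (wd_of (frac_emb Om \o iR) V)) (wd_euler_inv (wd_of zE VE))].
Proof.
move=> rkN; have [P0 P0P] := frac_place.
have P0N : mpl P0 N0 NO by move=> i j; rewrite [NO i j]mxE; exact: P0P.
have P0r s : mpl P0 (map_mx (@tofrac R) (rho s)) (map_mx (frac_emb Om) (rho s)).
  by move=> i j; rewrite !mxE; exact: P0P.
have fr_rep : is_rep (fun s => map_mx (@tofrac R) (rho s)) := map_rep _ rho_rep.
have P0z a : P0 ((@tofrac R \o iR) a) ((frac_emb Om \o iR) a) := P0P _.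
have rk0 : \rank N0 = \rank NO by rewrite mxrank_map.
have [_ defQ] := euler_specialize frac_char0 Om_char0 P0z fr_rep V_rep P0r rhoN
  generic_monodromic P0N rk0.
have [[pi eulE pgp] PE] := euler_specialize Om_char0 E0 Pz V_rep VE_rep Pr
  generic_monodromic target_monodromic PN rkN.
set eu := wd_euler_inv (wd_of (frac_emb Om \o iR) V) in defQ eulE PE *.
set eu0 := wd_euler_inv _ in defQ.
have euE k : eu`_k = acl_emb Om eu0`_k by apply: pl_fun (defQ k) (P0P _).
have eui k : integralOver (frac_emb Om) eu`_k.
  rewrite eulE; apply: (integral_det_1XM Om_char0) => a.
  case/(char_poly_projector pgp) => [->|]; first exact: integral0.
  by rewrite -map_char_poly => ra; exists (char_poly (rho phi)); first exact: char_poly_monic.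
pose Q : {poly intal Om} := \poly_(k < size eu) Intcl (asboolT (eui k)).
have QE k : \val Q`_k = eu`_k.
  by rewrite coef_poly; case: ltnP => // ke; rewrite nth_default.
exists Q; split=> // [k|].
  exists eu0`_k; last by rewrite QE euE.
  have [q qmon] := eui k; rewrite euE => rq; exists q => //.
  by rewrite -(fmorph_root (acl_emb Om)) -map_poly_comp.
by apply/polyP => k; rewrite coef_map; exact: QE.
Qed.

Section ComplexType.
Variables (C : closedFieldType) (iota : {rmorphism E -> C}).

Local Notation D := (frob_ss (wd_of zE VE)).

Let C0 : [pchar C] =i pred0.
Proof. by move=> k; rewrite (fmorph_pchar iota) E0. Qed.

Lemma target_frob_ss_wd : frob_ss_wd (wd_map iota D).
Proof.
have tf := specialize_tame_frobenius Om_char0 generic_inj V_rep generic_monodromic PN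
  sO_unramified decomp.
have [[Drep [e eP] Ddiag] [k Dk] Dtw] := frob_ss_good_wd E0 VE_rep target_monodromic tf.
split; first split.
- exact: map_rep.
- by exists [seq map_mx iota A | A <- e] => s Is; exact: (map_f _ (eP s Is)).
- by exists k; rewrite /= -map_mx_expr Dk map_mx0.
- move=> s /=; rewrite -!map_mxM -(map_frob_pow iota) -map_mxZ; congr map_mx.
  have := Dtw s; rewrite expr1z => ->.
  by rewrite -scalemxAl -mulmxA -(Drep.2) mulgV Drep.1 mulmx1.
- apply: diagable_semisimple; last exact: map_diagable.
  by rewrite map_unitmx; exact: rep_unit.
- have [L [j [jK Lj]]] := wd_of_smooth E0 target_monodromic.
  exists L, j; split=> // s Ls; have [Is _] := Ls.
  rewrite /= -[RHS](map_mx1 iota); congr map_mx.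
  by rewrite -(Lj s Ls); exact: (frob_ss_inertia zE VE Is).
Qed.

Hypothesis t_gt0 : forall i, (0 < t i)%N.

Lemma target_type (rec : wd_rep S C n -> gl_rep S C n) :
  (forall j, \rank (NO ^+ j) = \rank (NE ^+ j)) ->
  automorphic_type rec (rec (wd_map iota D)) [seq (d i, t i) | i <- enum 'I_m].
Proof.
move=> rkN; exists (wd_map iota D); split; first exact: target_frob_ss_wd.
  by exists idfun; first by exists idfun.
have [P2 P2P] := place_comp iota P.
have Ps2 i s : mpl P2 (map_mx (\val : _ -> Om) (twist (chi i) (r i) s)) (map_mx iota (sE i s)).
  by move=> a b; rewrite [X in P2 _ X]mxE; apply: P2P; exact: Ps.
exists m, d, t, (fun i s => map_mx iota (sE i s)); split=> // [i|]; last first.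
  by rewrite -wd_map_sum_sp; apply: wd_iso_map; exact: target_decomp.
have ut : unramified_twist (fun s => map_mx iota (sE i s)).
  by apply: (mpl_unramified_twist (P := P2) (sO_unramified i)) => s; exact: Ps2.
have [rR fr diagr] := unramified_twist_good C0 ut.
split=> //; last by apply: diagable_semisimple => //; exact: (rep_unit phi rR).
have [r0R r0irr _ _] := r_irr i; have [chi1 chiM _ _] := chi_char i.
apply: (specialize_irreducible (P := P2) Om_char0 C0 r0R r0irr
  (c := fun s => val (chi i s))) => [|||s].
- have [e eP] := r_finite i; exists [seq map_mx (\val : _ -> Om) A | A <- e] => s.
  exact: (map_f _ (eP s)).
- by rewrite chi1.
- by move=> s s'; rewrite chiM.
- have := Ps2 i s; rewrite /twist map_mxZ; exact.
Qed.

End ComplexType.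

End Target.
Section ExtendedPlace.
Variables (E : closedFieldType) (zE : {rmorphism padic_int pP -> E}).
Hypothesis zE_inj : injective zE.
Variable f : {rmorphism R -> E}.

Lemma place_extend_integral (P : place Om E) (xs : seq Om) :
  (forall a, P (frac_emb Om a) (f a)) ->
  (forall x, x \in xs -> integralOver (frac_emb Om) x) ->
  exists P' : place Om E, (forall a, P' (frac_emb Om a) (f a)) /\
    forall x, x \in xs -> exists e, P' x e.
Proof.
elim: xs P => [|x xs IHxs] P Pf ixs; first by exists P.
have [P1 [P1f P1xs]] := IHxs P Pf (fun y ys => ixs y (mem_behead (s := x :: xs) ys)).
have [g gmon /rootP gx] := ixs x (mem_head _ _).
have pp : ppl P1 (map_poly (frac_emb Om) g) (map_poly f g).
  by move=> i; rewrite !coef_map; exact: P1f.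
have gm : map_poly (frac_emb Om) g \is monic by rewrite monic_map.
have [P2 [P2P [e P2x]]] := place_extend pp gm gx.
exists P2; split=> [a|y]; first exact: P2P.
rewrite inE => /orP[/eqP ->|/P1xs[e' ye]]; first by exists e.
by exists e'; exact: P2P.
Qed.

(** Only finitely many elements, integral after multiplication by powers of [p],
    are involved in the representations: the values of [chi_i] at [phi] and [phi^-1]
    and the entries of the finitely many values of [r_i].  A place extends to them
    one after the other. *)
Lemma exists_target_place : exists P : place Om E,
  (forall a, P (frac_emb Om a) (f a)) /\
  forall i s, exists B, mpl P (map_mx (\val : _ -> Om) (twist (chi i) (r i) s)) B.
Proof.
have [a fa0|P0 P0f] := place_of_rmorph (i := frac_emb Om) (f := f).
  have -> : a = 0 by apply: frac_emb_inj; rewrite fa0 rmorph0.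
  by rewrite rmorph0.
have numP (x : intalp p Om) : exists k, integralOver (frac_emb Om) (p%:R ^+ k * val x).
  have /asboolP[k [a xa]] := valP x; exists k.
  by have -> : p%:R ^+ k * val x = val a :> Om := xa; have /asboolP := valP a.
pose num (x : intalp p Om) : Om := p%:R ^+ projT1 (cid (numP x)) * val x.
pose fin i := projT1 (cid (r_finite i)).
have finP i s : r i s \in fin i := projT2 (cid (r_finite i)) s.
pose xs i := val (chi i phi) :: val (chi i phi^-1%g) ::
  flatten [seq [seq num (A ab.1 ab.2) | ab : 'I_(d i) * 'I_(d i)]
    | A : 'M[intalp p Om]_(d i) <- fin i].
have [x /flatten_mapP[i _]|P [Pf Pxs]] :=
    @place_extend_integral P0 (flatten [seq xs i | i <- enum 'I_m]) P0f.
  rewrite !inE => /or3P[/eqP ->|/eqP ->|/flatten_mapP[A _ /mapP[ab _ ->]]].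
  - by have /asboolP := valP (chi i phi).
  - by have /asboolP := valP (chi i phi^-1%g).
  - exact: projT2 (cid (numP _)).
exists P; split=> // i s.
have {}Pxs x : x \in xs i -> exists e, P x e.
  by move=> xi; apply: Pxs; apply/flatten_mapP; exists i; rewrite ?mem_enum.
have Pr a b : exists e, P (val (r i s a b)) e.
  have [|e Pe] := Pxs (num (r i s a b)).
    rewrite !inE; apply/or3P/Or33/flatten_mapP; exists (r i s); first exact: finP.
    by apply/mapP; exists (a, b); rewrite ?mem_enum.
  by exists (e / p%:R ^+ projT1 (cid (numP (r i s a b)))); exact: (place_div zE_inj Pe).
have [chi1 chiM _ chiI] := chi_char i.
have Pc : exists2 e, e != 0 & P (val (chi i s)) e.
  apply: (@frob_ind _ _ _ (weil_frobenius_generated S)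
    (fun s => exists2 e, e != 0 & P (val (chi i s)) e)).
  - have [|e Pe] := Pxs (val (chi i phi)); first by rewrite mem_head.
    have [|e' Pe'] := Pxs (val (chi i phi^-1%g)); first by rewrite !inE eqxx orbT.
    exists e => //; apply/eqP => e0; have := plM Pe Pe'.
    have -> : val (chi i phi) * val (chi i phi^-1%g) = 1.
      by have := congr1 val (chiM phi phi^-1%g); rewrite mulgV chi1.
    rewrite e0 mul0r => /(pl_fun (pl1 P))/eqP; by rewrite oner_eq0.
  - by move=> h Ih; exists 1; rewrite ?oner_eq0 // chiI //; exact: pl1.
  - move=> h h' [e e0 Pe] [e' e'0 Pe']; exists (e * e'); first by rewrite mulf_neq0.
    by rewrite chiM; exact: plM.
  - move=> h [e e0 Pe]; exists e^-1; first by rewrite invr_eq0.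
    have -> : val (chi i h^-1%g) = (val (chi i h))^-1.
      apply: (mulfI (pl_neq0 Pe e0)); rewrite mulfV ?(pl_neq0 Pe) //.
      by have := congr1 val (chiM h h^-1%g); rewrite mulgV chi1.
    exact: plV.
have [c _ Pce] := Pc.
pose B := \matrix_(a, b) (c * projT1 (cid (Pr a b))).
exists B => a b; rewrite [X in P X _]mxE [X in P _ X]mxE /twist mxE.
exact: plM Pce (projT2 (cid (Pr a b))).
Qed.

End ExtendedPlace.

Section IntalExtPlace.
Variables (E : closedFieldType) (zE : {rmorphism padic_int pP -> E}).
Hypothesis zE_inj : injective zE.
Variables (f : {rmorphism R -> E}) (ie : intal_ext p Om f).

Lemma ie_Rp_eq (x : Rp p R) k a : p%:R ^+ k * val x = tofrac a ->
  p%:R ^+ k * ie_Rp ie x = f a.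
Proof.
move=> xa; have eqx : p%:R ^+ k * x = locp_of p (@tofrac R) a.
  by apply: val_inj; apply: etrans xa; rewrite rmorphM rmorphXn rmorph_nat.
by rewrite -(ie_RpP ie) -eqx rmorphM rmorphXn rmorph_nat.
Qed.

(** The extension of [f] to the integral closure, with [p] inverted, is a place. *)
Lemma intal_ext_place : exists P : place Om E,
  [/\ forall a, P (frac_emb Om a) (f a), forall x, P (val x) (ie_intp ie x),
      forall x, P (val x) (ie_int ie x) & forall x, P (acl_emb Om (val x)) (ie_Rp ie x)].
Proof.
have [x x0|P PP] := place_of_rmorph (i := \val : intalp p Om -> Om) (f := ie_intp ie).
  have -> : x = 0 by apply: val_inj; rewrite x0 rmorph0.
  by rewrite rmorph0.
have Pi x : P (val x) (ie_int ie x).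
  by rewrite -ie_intpP; exact: (PP (locp_of p (\val : intal Om -> Om) x)).
have Pf a : P (frac_emb Om a) (f a).
  by rewrite -(ie_intP ie); exact: (Pi (intcl_of (frac_emb Om) a)).
exists P; split=> // x.
have /asboolP[k [a xa]] := valP x.
by apply: (place_Rp zE_inj Pf xa); exact: ie_Rp_eq.
Qed.

End IntalExtPlace.

End Setting.

(** * Pure specializations *)

Theorem theorem1p1
  (p l : nat) (pP : prime p) (lP : prime l) (neq_pl : p != l)
  (S : weil_setup pP lP)
  (Rr : realType) (Qpbar : alg_closure (padic pP))
  (R : idomainType) (iR : {rmorphism padic_int pP -> R}) (iR_inj : injective iR)
  (n : nat) (rho : S -> 'M[R]_n) (rho_rep : is_rep rho)
  (N : 'M[Rp p R]_n)
  (rhoN : monodromic_with (@tofrac R \o iR)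
            (fun s => map_mx (@tofrac R) (rho s)) (map_mx \val N))
  (Om : alg_closure {fraction R})
  (m : nat) (m_gt0 : (0 < m)%N)
  (t : 'I_m -> nat) (t_gt0 : forall i, (0 < t i)%N)
  (t_le : forall i j : 'I_m, (i <= j)%N -> (t i <= t j)%N)
  (chi : 'I_m -> S -> intal Om)
  (chi_char : forall i, unramified_char (chi i))
  (d : 'I_m -> nat) (r : forall i, S -> 'M[intalp p Om]_(d i))
  (r_rep : forall i, is_rep (r i))
  (r_finite : forall i, finite_image (r i))
  (r_irr : forall i, irr_frob_ss (fun s => map_mx (\val : _ -> Om) (r i s)))
  (decomp : wd_iso
     (frob_ss (wd_of (frac_emb Om \o iR)
        (fun s => map_mx (frac_emb Om) (rho s))))
     (wd_sum (fun i => wd_sp (t i)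
        (fun s => map_mx (\val : _ -> Om) (twist (chi i) (r i) s)))))
  (lam : {rmorphism R -> Qpbar})
  (lam_alg : forall z, lam (iR z) = padic_emb Qpbar z)
  (lam_pure : pure_rep (padic_emb Qpbar) Rr (fun s => map_mx lam (rho s)))
  (lamI : intal_ext p Om lam) :
  let V := fun s => map_mx (frac_emb Om) (rho s) in
  let Vlam := fun s => map_mx lam (rho s) in
  [/\
      forall j, (0 < j)%N ->
        (\rank (map_mx (\val : _ -> {fraction R}) N ^+ j)
           <= \rank (map_mx (ie_Rp lamI) N ^+ j))%N,
      wd_iso (frob_ss (wd_of (padic_emb Qpbar) Vlam))
        (wd_sum (fun i => wd_sp (t i)
           (fun s => map_mx (ie_intp lamI) (twist (chi i) (r i) s)))),
      exists P : {poly intal Om},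
        [/\ forall k, exists2 y : {fraction R},
              integralOver (@tofrac R) y & \val P`_k = acl_emb Om y,
            map_poly \val P = wd_euler_inv (wd_of (frac_emb Om \o iR) V)
          & map_poly (ie_int lamI) P
              = wd_euler_inv (wd_of (padic_emb Qpbar) Vlam)],
      forall (iota_p : {rmorphism Qpbar -> Rr[i]}) (iota_bij : bijective iota_p)
        (rec : wd_rep S Rr[i] n -> gl_rep S Rr[i] n)
        (rec_bij : langlands_bijection rec)
        (xi : {rmorphism R -> Qpbar})
        (xi_alg : forall z, xi (iR z) = padic_emb Qpbar z),
        let Vxi := fun s => map_mx xi (rho s) in
        pure_rep (padic_emb Qpbar) Rr Vxi ->
        exists tau : seq (nat * nat),
          automorphic_type rec
            (rec (wd_map iota_p (frob_ss (wd_of (padic_emb Qpbar) Vxi)))) tau /\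
          automorphic_type rec
            (rec (wd_map iota_p (frob_ss (wd_of (padic_emb Qpbar) Vlam)))) tau
    &
      forall (KK : fieldType) (iK : {rmorphism padic pP -> KK})
        (KKbar : alg_closure KK) (mu : {rmorphism R -> KK})
        (mu_alg : forall z, mu (iR z) = iK (tofrac z))
        (lam_ker_mu : forall x, mu x = 0 -> lam x = 0)
        (muI : intal_ext p Om (acl_emb KKbar \o mu)),
        let Vmu := fun s => map_mx (acl_emb KKbar) (map_mx mu (rho s)) in
        wd_iso (frob_ss (wd_of (fun z => acl_emb KKbar (iK (tofrac z))) Vmu))
          (wd_sum (fun i => wd_sp (t i)
             (fun s => map_mx (ie_intp muI) (twist (chi i) (r i) s))))].
Proof.
move=> V Vlam.
pose zQ : {rmorphism padic_int pP -> Qpbar} := acl_emb Qpbar \o @tofrac (padic_int pP).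
have zQE : padic_emb Qpbar = zQ by [].
have zQ_inj : injective zQ := inj_comp (fmorph_inj _) (@tofrac_inj _).
rewrite zQE in lam_alg lam_pure *.
have [P [Pf Pintp Pint PRp]] := intal_ext_place iR_inj zQ_inj lamI.
pose NE := map_mx (ie_Rp lamI) N.
have PN : mpl P (map_mx (acl_emb Om) (map_mx \val N)) NE by move=> i j; rewrite !mxE.
pose sE i s := map_mx (ie_intp lamI) (twist (chi i) (r i) s).
have Ps i s : mpl P (map_mx (\val : _ -> Om) (twist (chi i) (r i) s)) (sE i s).
  by move=> a b; rewrite [X in P X _]mxE [X in P _ X]mxE; exact: Pintp.
have rk := target_rank iR_inj rho_rep rhoN chi_char r_rep r_finite decomp zQ_inj lam_alg Pf
  PN Ps lam_pure.
split.
- by move=> j _; rewrite -(rank_NO N Om) rk.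
- exact: (target_decomp iR_inj rho_rep rhoN chi_char r_rep r_finite decomp zQ_inj lam_alg Pf
    PN Ps rk).
- have [|Q [Qint QV PQ]] := target_euler iR_inj rho_rep rhoN zQ_inj lam_alg Pf PN.
    by have := rk 1%N; rewrite !expr1.
  exists Q; split=> //; apply/polyP => k; rewrite coef_map.
  by apply: pl_fun (Pint _) _; have := PQ k; rewrite -QV coef_map.
- move=> iota_p _ rec _ xi xi_alg Vxi xi_pure; exists [seq (d i, t i) | i <- enum 'I_m].
  split; last first.
    exact: (target_type iR_inj rho_rep rhoN chi_char r_rep r_finite r_irr decomp zQ_inj
      lam_alg Pf PN Ps iota_p t_gt0 rec rk).
  have [Q [Qf QB]] := exists_target_place iR_inj chi_char r_finite zQ_inj xi.
  have [NX PX] := exists_monodromy_specialization iR_inj N zQ_inj Qf.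
  pose sX i s := projT1 (cid (QB i s)).
  have PsX i s : mpl Q (map_mx (\val : _ -> Om) (twist (chi i) (r i) s)) (sX i s).
    exact: projT2 (cid (QB i s)).
  have rkX := target_rank iR_inj rho_rep rhoN chi_char r_rep r_finite decomp zQ_inj xi_alg Qf
    PX PsX xi_pure.
  exact: (target_type iR_inj rho_rep rhoN chi_char r_rep r_finite r_irr decomp zQ_inj
    xi_alg Qf PX PsX iota_p t_gt0 rec rkX).
- move=> KK iK KKbar mu mu_alg lam_ker_mu muI Vmu.
  pose zK : {rmorphism padic_int pP -> KKbar} := acl_emb KKbar \o iK \o @tofrac (padic_int pP).
  have zK_inj : injective zK.
    exact: (inj_comp (inj_comp (fmorph_inj _) (fmorph_inj _)) (@tofrac_inj _)).
  pose mu' : {rmorphism R -> KKbar} := acl_emb KKbar \o mu.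
  have mu_alg' a : mu' (iR a) = zK a by rewrite /mu' /= mu_alg.
  have VmuE : Vmu = (fun s => map_mx mu' (rho s)).
    by apply: funext => s; rewrite /Vmu -map_mx_comp.
  have [Q [Qf Qintp _ QRp]] := intal_ext_place iR_inj zK_inj muI.
  pose NK := map_mx (ie_Rp muI) N.
  have QN : mpl Q (map_mx (acl_emb Om) (map_mx \val N)) NK by move=> i j; rewrite !mxE.
  pose sK i s := map_mx (ie_intp muI) (twist (chi i) (r i) s).
  have Qs i s : mpl Q (map_mx (\val : _ -> Om) (twist (chi i) (r i) s)) (sK i s).
    by move=> a b; rewrite [X in Q X _]mxE [X in Q _ X]mxE; exact: Qintp.
  have [x x0|T TP] := place_of_rmorph (i := ie_Rp muI) (f := ie_Rp lamI).
    have /asboolP[k [a xa]] := valP x.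
    have := ie_Rp_eq muI xa; rewrite x0 mulr0 => /esym/eqP; rewrite fmorph_eq0 => /eqP.
    move/lam_ker_mu => la; have := ie_Rp_eq lamI xa; rewrite la.
    move/eqP; rewrite mulf_eq0 expf_eq0.
    have -> : (p%:R == 0 :> Qpbar) = false.
      by rewrite ((pcharf0P Qpbar).1 (char0_of_inj zQ_inj)) eqn0Ngt prime_gt0.
    by rewrite andbF => /eqP.
  (* The rank for [mu] lies between those for [lam] and over [Om]. *)
  have rkK j : \rank (map_mx (acl_emb Om) (map_mx \val N) ^+ j) = \rank (NK ^+ j).
    apply/eqP; rewrite eqn_leq (target_rank_le QN) andbT rk.
    by apply: (mpl_rank (P := T)); apply: mplX => a b; rewrite !mxE.
  rewrite VmuE.
  exact: (target_decomp iR_inj rho_rep rhoN chi_char r_rep r_finite decomp zK_inj mu_alg' Qf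
    QN Qs rkK).
Qed.
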